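(* Let $T>0$ and let $\rho_0:\mathbb T\to[0,1]$ be piecewise continuous. For every $\alpha>0$ there exists a weak solution $\rho^\alpha:[0,T]\times[0,1]\to[0,1]$ of the heat equation with Robin's boundary conditions with parameter $\alpha$ and initial condition $\rho_0$. Moreover, such a solution is unique, and there is a constant $K_0$ not depending on $\alpha$ such that, for every $\alpha>0$, $$\sup_{H}\Big\{\langle\!\langle\rho^\alpha,\partial_uH\rangle\!\rangle-2\langle\!\langle H,H\rangle\!\rangle_\alpha\Big\}\le K_0,$$ where the supremum is over functions $H\in C^{0,1}([0,T]\times\mathbb T)$.
   Context: $\mathbb T=\mathbb R/\mathbb Z$; functions on $\mathbb T$ and on $[0,1]$ are identified Lebesgue almost everywhere. A subindex $t$ denotes the time variable: $\rho_t(u)=\rho(t,u)$. $\langle\cdot,\cdot\rangle$ is the inner product of $L^2[0,1]$ (or $L^2(\mathbb T)$). $\Delta=\partial_u^2$. $C^{n,m}(A\times B)$ is the space of real functions on $A\times B$ of class $C^n$ in the first variable and $C^m$ in the second (with the corresponding derivatives continuous on $A\times B$). $W_\alpha(du)=du+\frac1\alpha\delta_0(du)$ is a measure on $\mathbb T$ (Lebesgue plus a Dirac mass at $0$ of weight $1/\alpha$). $\langle\!\langle f,g\rangle\!\rangle=\int_0^T\int_{\mathbb T}f_s(u)g_s(u)\,du\,ds$ and $\langle\!\langle f,g\rangle\!\rangle_\alpha=\int_0^T\int_{\mathbb T}f_s(u)g_s(u)\,W_\alpha(du)\,ds$. $\mathcal H^1$ is the set of locally summable $\zeta:[0,1]\to\mathbb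 R$ for which there is $\partial_u\zeta\in L^2[0,1]$ with $\langle\partial_uG,\zeta\rangle=-\langle G,\partial_u\zeta\rangle$ for all $G\in C^\infty(0,1)$ with compact support, with norm $\|\zeta\|_{\mathcal H^1}=(\|\zeta\|_{L^2[0,1]}^2+\|\partial_u\zeta\|_{L^2[0,1]}^2)^{1/2}$. $L^2(0,T;\mathcal H^1)$ is the space of measurable $\xi:[0,T]\to\mathcal H^1$ with $\int_0^T\|\xi_t\|_{\mathcal H^1}^2dt<\infty$ (as usual, $\xi_t\in\mathcal H^1$ for almost every $t$). For $\zeta\in\mathcal H^1$, $\zeta(0),\zeta(1)$ are the boundary values of its continuous representative. Weak solution of the heat equation with Robin's boundary conditions ($\partial_t\rho=\Delta\rho$ on $(0,1)$, $\partial_u\rho(t,0)=\partial_u\rho(t,1)=\alpha(\rho(t,0)-\rho(t,1))$, $\rho(0,\cdot)=\rho_0$): $\rho\in L^2(0,T;\mathcal H^1)$ with $\rho_t\in L^2[0,1]$ for every $t$, and for all $t\in[0,T]$, $H\in C^{1,2}([0,T]\times[0,1])$, $$\langle\rho_t,H_t\rangle-\langle\rho_0,H_0\rangle-\int_0^t\langle\rho_s,\partial_sH_s+\Delta H_s\rangle ds-\int_0^t(\rho_s(0)\partial_uH_s(0)-\rho_s(1)\partial_uH_s(1))ds+\int_0^t\alpha(\rho_s(0)-\rho_s(1))(H_s(0)-H_s(1))ds=0,$$ where $\rho_0$ is the given initial condition. Uniqueness is up to Lebesgue-null sets in $u$ for each $t$. *)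

(* Defs.v *)
From HB Require Import structures.
From mathcomp Require Import all_boot all_order all_algebra.
From mathcomp Require Import all_classical all_reals all_analysis.
Import Order.TTheory GRing.Theory Num.Theory.
Import numFieldNormedType.Exports.

Set Implicit Arguments.
Unset Strict Implicit.
Unset Printing Implicit Defensive.

Local Open Scope classical_set_scope.
Local Open Scope ring_scope.

(* Space-time functions are curried, time first: [f t u], so that [f t] is the
   function of u at time t.  The circle T = R/Z is rendered by 1-periodic
   functions on the line, integrated over the fundamental domain [0, 1[. *)

(* [derive_within A f x] is the limit of difference quotients taken in [A]; at
   an endpoint of a closed interval it is the one-sided derivative. *)
Definition derivable_within (R : realType) (A : set R) (f : R -> R) (x : R) :=
  cvg ((f y - f x) / (y - x) @[y --> within A x^']).

Definition derive_within (R : realType) (A : set R) (f : R -> R) (x : R) : R :=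
  lim ((f y - f x) / (y - x) @[y --> within A x^']).

Definition inner (R : realType) (f g : R -> R) : R :=
  \int[lebesgue_measure]_(u in `[0, 1]) (f u * g u).

(* The zero extension of [f] is square integrable on the line. *)
Definition L2_01 (R : realType) (f : R -> R) : Prop :=
  f \_ `[0, 1] \in Lfun (@lebesgue_measure R) 2%:E.

(* Elements of C_c^oo(0,1), extended by zero to the whole line. *)
Definition test_fun (R : realType) (G : R -> R) : Prop :=
  [/\ forall n x, derivable (derive1n n G) x 1,
      compact (closure [set x | G x != 0])
    & closure [set x | G x != 0] `<=` `]0, 1[].

Definition is_weak_deriv (R : realType) (zeta dzeta : R -> R) : Prop :=
  L2_01 dzeta /\
  forall G, test_fun G -> inner (derive1 G) zeta = - inner G dzeta.

Definition H1 (R : realType) (zeta : R -> R) : Prop :=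
  locally_integrable `]0, 1[ zeta /\ exists dzeta, is_weak_deriv zeta dzeta.

(* A weak derivative, unique up to null sets of [0, 1]. *)
Definition weak_deriv (R : realType) (zeta : R -> R) : R -> R :=
  get (is_weak_deriv zeta).

Definition H1norm (R : realType) (zeta : R -> R) : R :=
  Num.sqrt (inner zeta zeta + inner (weak_deriv zeta) (weak_deriv zeta)).

(* Open sets of H^1 for the norm topology, as sets of representatives. *)
Definition H1_open (R : realType) (U : set (R -> R)) : Prop :=
  U `<=` @H1 R /\
  forall zeta, U zeta -> exists2 r : R, 0 < r &
    forall eta, H1 eta -> H1norm (eta \- zeta) < r -> U eta.

(* Measurability is Lebesgue (not Borel) measurability of t |-> xi t as a map
   into H^1, defined almost everywhere: off a null set [N], preimages of open
   sets are Borel. *)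
Definition L2H1 (R : realType) (T : R) (xi : R -> R -> R) : Prop :=
  exists N : set R, let D := `[0, T] `\` N in
  [/\ measurable N,
      lebesgue_measure N = 0%E,
      forall t, D t -> H1 (xi t),
      forall U, H1_open U -> measurable (D `&` xi @^-1` U)
    & (\int[lebesgue_measure]_(t in D) (H1norm (xi t) ^+ 2)%:E < +oo)%E].

Definition is_cont_rep (R : realType) (zeta c : R -> R) : Prop :=
  {within `[0, 1], continuous c} /\
  {ae lebesgue_measure, forall u : R, u \in `[0, 1] -> zeta u = c u}.

(* For x = 0, 1: the value at x of the continuous representative on [0, 1]. *)
Definition bval (R : realType) (zeta : R -> R) (x : R) : R :=
  get (is_cont_rep zeta) x.

Definition dt (R : realType) (T : R) (H : R -> R -> R) : R -> R -> R :=
  fun t u => derive_within `[0, T] (H ^~ u) t.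

Definition du (R : realType) (H : R -> R -> R) : R -> R -> R :=
  fun t u => derive_within `[0, 1] (H t) u.

Definition cont_on (R : realType) (A B : set R) (H : R -> R -> R) : Prop :=
  {within A `*` B, continuous (fun p : R * R => H p.1 p.2)}.

Definition C12 (R : realType) (T : R) (H : R -> R -> R) : Prop :=
  (forall t u : R, t \in `[0, T] -> u \in `[0, 1] ->
    [/\ derivable_within `[0, T] (H ^~ u) t,
        derivable_within `[0, 1] (H t) u
      & derivable_within `[0, 1] (du H t) u]) /\
  [/\ cont_on `[0, T] `[0, 1] H,
      cont_on `[0, T] `[0, 1] (dt T H),
      cont_on `[0, T] `[0, 1] (du H)
    & cont_on `[0, T] `[0, 1] (du (du H))].

Definition C01_torus (R : realType) (T : R) (H : R -> R -> R) : Prop :=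
  [/\ forall t u : R, t \in `[0, T] -> H t (u + 1) = H t u,
      forall t u : R, t \in `[0, T] -> derivable (H t) u 1,
      cont_on `[0, T] setT H
    & cont_on `[0, T] setT (fun t => derive1 (H t))].

(* Finitely many discontinuities per period, all with finite one-sided limits *)
Definition piecewise_continuous_torus (R : realType) (f : R -> R) : Prop :=
  [/\ forall u, f (u + 1) = f u,
      finite_set [set u : R | 0 <= u < 1 /\ ~ (f @ u --> f u)]
    & forall u, cvg (f @ u^'-) /\ cvg (f @ u^'+)].

Definition Robin_weak_sol (R : realType) (T alpha : R) (rho0 : R -> R)
    (rho : R -> R -> R) : Prop :=
  [/\ L2H1 T rho,
      forall t : R, t \in `[0, T] -> L2_01 (rho t)
    & forall (t : R) H, t \in `[0, T] -> C12 T H ->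
      inner (rho t) (H t) - inner rho0 (H 0)
      - (\int[lebesgue_measure]_(s in `[0, t])
           inner (rho s) (dt T H s \+ du (du H) s))
      - (\int[lebesgue_measure]_(s in `[0, t])
           (bval (rho s) 0 * du H s 0 - bval (rho s) 1 * du H s 1))
      + (\int[lebesgue_measure]_(s in `[0, t])
           (alpha * (bval (rho s) 0 - bval (rho s) 1) * (H s 0 - H s 1)))
      = 0].

Definition W (R : realType) (alpha : {posnum R}) :
    set (measurableTypeR R) -> \bar R :=
  measure_add (@lebesgue_measure R)
    (mscale (alpha%:num^-1)%:nng \d_(0 : measurableTypeR R)).

Definition bracket (R : realType) (T : R) (f g : R -> R -> R) : R :=
  \int[lebesgue_measure]_(s in `[0, T])
    \int[lebesgue_measure]_(u in `[0, 1[) (f s u * g s u).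

Definition bracketW (R : realType) (T : R) (alpha : {posnum R})
    (f g : R -> R -> R) : R :=
  \int[lebesgue_measure]_(s in `[0, T])
    \int[W alpha]_(u in `[0, 1[) (f s u * g s u).

Definition energy (R : realType) (T : R) (alpha : {posnum R})
    (rho : R -> R -> R) : \bar R :=
  ereal_sup [set (bracket T rho (fun t => derive1 (H t))
                  - 2 * bracketW T alpha H H)%:E | H in C01_torus T].

(* Main.v *)
(* The Robin Laplacian has an explicit orthonormal family of eigenfunctions [e_k]
   with frequencies [k pi <= w_k < (k + 1) pi]. A function vanishing at the [M]
   nodes [(2j + 1)/(2M)] satisfies the Poincare inequality with any constant below
   [M pi]; interpolating the remainder of an eigenfunction expansion at the nodes
   then gives Parseval's identity for C^1 functions, hence completeness.

   Testing the weak formulation with [exp(w_k^2 s) e_k(u)] determines the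
   coefficients of a solution at each time, whence uniqueness. Conversely the
   series of [c_k exp(- w_k^2 t) e_k(u)] is smooth for [t > 0] and solves the weak
   formulation mode by mode; the sum over the modes and the time integral commute
   because the integrals of [exp(- w_k^2 s)] are summable.

   The bounds 0 and 1 are preserved by duality: the semigroup is symmetric, and it
   preserves nonnegativity of a C^1 datum [g] since the integral of a convex
   function of the solution does not increase.

   For the energy, an integration by parts in u and Young's inequality bound the
   integrand in time by one eighth of the Robin form
   [|d_u rho|^2 + alpha (rho(0) - rho(1))^2], whose time integral is at most
   [|rho0|^2 / 2 <= 1/2]; hence [K0 = 1/16], whatever [alpha]. *)

From HB Require Import structures.
Require Import Defs.
From mathcomp Require Import all_boot all_order all_algebra.
From mathcomp Require Import all_classical all_reals all_analysis.
From mathcomp Require Import measurable_realfun ring lra.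
Import Order.TTheory GRing.Theory Num.Theory.
Import numFieldNormedType.Exports.

Set Implicit Arguments.
Unset Strict Implicit.
Unset Printing Implicit Defensive.

Local Open Scope classical_set_scope.
Local Open Scope ring_scope.

(** The nodes work because [m + 1] modes face [m + 1] interpolation conditions and the gap
    [w_m < (m + 1) pi] is strict. For [K] inside the gap the Robin form is below [K^2] times the
    squared norm on the span of the modes, and at least that on functions vanishing at the nodes.
    This makes interpolation solvable and lets the interpolation error cancel from the remainder
    estimate.

    The datum is only square integrable, so Parseval asks for smoothness of one factor only; the
    other factor is a test function, a slice of [H], or an evolved function at positive time.

    The recurring obstacle is time 0. The series is smooth for [t > 0] only, with bounds that blow
    up as [t] tends to 0: hence majorants on [t >= d], integrals over []0, t]], and the datum
    inserted by hand at 0. It also explains the duality: the comparison argument starts from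
    convergence in L^2 to the datum, which Parseval provides for C^1 data.

    The energy constant is free of [alpha] because Young's inequality at the boundary trades [alpha]
    times the squared jump against [H(0)^2 / alpha], which is what the Dirac mass of [W]
    contributes. *)

Section dominated_series.
Context {R : realType}.
Implicit Types (a f M : nat -> R).

Lemma dominated_series_cvg a M :
  (forall n, `|a n| <= M n) -> cvgn (series M) -> cvgn (series a).
Proof.
move=> aM cM; apply: normed_cvg.
apply: (series_le_cvg _ _ _ cM) => n; rewrite /= ?normr_ge0 //.
exact: le_trans (aM n).
Qed.

Lemma dominated_series_tail a M N :
  (forall n, `|a n| <= M n) -> cvgn (series M) ->
  `|limn (series a) - series a N| <= limn (series M) - series M N.
Proof.
move=> aM cM; have ca := dominated_series_cvg aM cM.
have cvL : (fun n => `|series a n - series a N|) @ \oo -->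
    `|limn (series a) - series a N|.
  by apply: cvg_norm; apply: cvgB => //; exact: cvg_cst.
have cvR : (fun n => series M n - series M N) @ \oo -->
    limn (series M) - series M N.
  by apply: cvgB => //; exact: cvg_cst.
rewrite -(cvg_lim (@Rhausdorff R) cvL) -(cvg_lim (@Rhausdorff R) cvR).
apply: ler_lim; [by apply/cvg_ex; eexists; exact: cvL
  | by apply/cvg_ex; eexists; exact: cvR |].
near=> n; have Nn : (N <= n)%N by near: n; exact: nbhs_infty_ge.
rewrite !sub_series_geq //; apply: le_trans (ler_norm_sum _ _ _) _.
exact: ler_sum.
Unshelve. all: by end_near. Qed.

Lemma dominated_series_le a M :
  (forall n, `|a n| <= M n) -> cvgn (series M) ->
  `|limn (series a)| <= limn (series M).
Proof.
move=> aM cM; have := dominated_series_tail 0 aM cM.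
by rewrite /series /= !big_geq // !subr0.
Qed.

Lemma series_tail_lt M (e : R) : cvgn (series M) -> 0 < e ->
  exists N, `|limn (series M) - series M N| < e.
Proof.
move=> cM e0; have /cvgrPdist_lt /(_ e e0) [N _ HN] := cM.
by exists N; apply: HN => /=.
Qed.

(* Tannery's theorem. *)
Lemma series_cvg_dominated (T : Type) (F : set_system T) {FF : ProperFilter F}
    (a : nat -> T -> R) (l M : nat -> R) : cvgn (series M) ->
  (\forall y \near F, forall n, `|a n y| <= M n) ->
  (forall n, a n y @[y --> F] --> l n) ->
  limn (series (a ^~ y)) @[y --> F] --> limn (series l).
Proof.
move=> cM aM al.
have lM n : `|l n| <= M n.
  have cvn : `|a n y| @[y --> F] --> `|l n| by apply: cvg_norm; exact: al.
  rewrite -(cvg_lim (@Rhausdorff R) cvn).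
  apply: limr_le; first by apply/cvg_ex; eexists; exact: cvn.
  by apply: filterS aM => y; exact.
apply/cvgrPdist_lt => e e0.
have e3 : 0 < e / 3 by rewrite divr_gt0.
have [N HN] := series_tail_lt cM e3.
have cS : series (a ^~ y) N @[y --> F] --> series l N.
  by rewrite /series /=; apply: cvg_big => [|n _]; [exact: add_continuous|exact: al].
have /cvgrPdist_lt /(_ _ e3) cS' := cS.
near=> y.
have aMy : forall n, `|a n y| <= M n by near: y.
have h1 := dominated_series_tail N aMy cM.
have h2 := dominated_series_tail N lM cM.
have h3 : `|series l N - series (a ^~ y) N| < e / 3 by near: y.
have h4 := ler_norm (limn (series M) - series M N).
move: (limn (series (a ^~ y))) (limn (series l)) (limn (series M)) h1 h2 h3 h4 HN.
move: (series (a ^~ y) N) (series l N) (series M N) => x1 x2 x3 y1 y2 y3.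
rewrite !ler_norml !ltr_norml => /andP[? ?] /andP[? ?] /andP[? ?] ? /andP[? ?].
by apply/andP; split; lra.
Unshelve. all: by end_near. Qed.

(** By the mean value theorem every difference quotient of [f n] is a value of [df n] near [x], so
    [M] dominates the quotients uniformly in the increment and [series_cvg_dominated] lets it tend
    to 0 under the sum. *)
Lemma is_derive_series (f df : nat -> R -> R) M (x r : R) : 0 < r ->
  cvgn (series M) ->
  (forall n y, `|y - x| < r -> is_derive y 1 (f n) (df n y)) ->
  (forall n y, `|y - x| < r -> `|df n y| <= M n) ->
  (forall y, `|y - x| < r -> cvgn (series (f ^~ y))) ->
  is_derive x 1 (fun y => limn (series (f ^~ y))) (limn (series (df ^~ x))).
Proof.
move=> r0 cM fdf dfM cf.
have xr : `|x - x| < r by rewrite subrr normr0.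
pose q n (h : R) : R := h^-1 *: (f n (h *: 1 + x) - f n x).
have qM : \forall h \near 0^', forall n, `|q n h| <= M n.
  near=> h => n.
  have h0 : h != 0 by near: h; exact: nbhs_dnbhs_neq.
  have hr : `|h| < r.
    near: h; exact: dnbhs0_lt.
  rewrite /q (_ : h *: 1 + x = x + h); last by rewrite /GRing.scale /= mulr1 addrC.
  have D c : c \in `[Num.min x (x + h), Num.max x (x + h)] -> `|c - x| < r.
    rewrite in_itv /= ge_min le_max => /andP[/orP[] ? /orP[] ?];
    move: hr; rewrite !ltr_norml => /andP[? ?]; apply/andP; split; lra.
  have [le|le] := leP x (x + h).
    have [| |c cI ->] := @MVT_segment _ (f n) (df n) x (x + h) le.
    - move=> y yI; apply: fdf; apply: D.
      by rewrite min_l // max_r // ; exact: subset_itv_oo_cc yI.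
    - apply: derivable_within_continuous => y yI.
      have yr : `|y - x| < r by apply: D; rewrite min_l // max_r.
      have dy := fdf n y yr.
      exact: ex_derive.
    rewrite addrAC subrr add0r scalerAl [_ *: df n c]mulrC -mulrA.
    rewrite mulVf // mulr1; apply: dfM; apply: D.
    by rewrite min_l // max_r.
  have [| |c cI E] := @MVT_segment _ (f n) (df n) (x + h) x (ltW le).
  - move=> y yI; apply: fdf; apply: D.
    by rewrite min_r ?max_l ?ltW //; exact: subset_itv_oo_cc yI.
  - apply: derivable_within_continuous => y yI.
    have yr : `|y - x| < r by apply: D; rewrite min_r ?max_l ?ltW.
    have dy := fdf n y yr.
    exact: ex_derive.
  have -> : f n (x + h) - f n x = df n c * h by rewrite -opprB E; ring.
  rewrite scalerAl [_ *: df n c]mulrC -mulrA.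
  rewrite mulVf // mulr1; apply: dfM; apply: D.
  by rewrite min_r ?max_l ?ltW.
have qd n : q n h @[h --> 0^'] --> df n x.
  have dn := fdf n x xr.
  have <- : 'D_1 (f n) x = df n x by rewrite derive_val.
  exact: (@ex_derive _ _ _ _ _ _ _ dn).
have H : limn (series (q ^~ h)) @[h --> 0^'] --> limn (series (df ^~ x)).
  exact: series_cvg_dominated cM qM qd.
pose Q (h : R) : R :=
  h^-1 *: (limn (series (f ^~ (h *: 1 + x))) - limn (series (f ^~ x))).
have {}H : Q h @[h --> 0^'] --> limn (series (df ^~ x)).
  refine (cvg_trans (near_eq_cvg _) H).
  near=> h.
  have hr : `|h| < r.
    near: h; exact: dnbhs0_lt.
  have xh : `|h *: 1 + x - x| < r by rewrite /GRing.scale /= mulr1 addrK.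
  rewrite /Q -lim_seriesB; [|exact: cf|exact: cf].
  rewrite -(lim_seriesZ _ (is_cvg_seriesB (cf _ xh) (cf _ xr))).
  by congr (limn (series _)); apply/funext => n.
apply: DeriveDef.
  by apply/cvg_ex; eexists; exact: H.
by rewrite /derive; apply: cvg_lim => //; exact: H.
Unshelve. all: by end_near. Qed.

End dominated_series.

(** * Integrals of continuous functions on a segment, C^1 pairs, and Poincare inequalities from
    Riccati equations *)

Section calculus.
Context {R : realType}.
Implicit Types (a b c k : R) (f g h df dg dh r : R -> R).
Local Notation mu := (@lebesgue_measure R).
Local Notation itg a b := (Rintegral mu [set` `[a, b]%R]).
Local Notation wc a b f := ({within [set` `[a, b]%R], continuous f}).
Local Notation integ a b f := (mu.-integrable [set` `[a, b]%R] (EFin \o f)).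

Lemma within_continuousD a b f g : wc a b f -> wc a b g ->
  wc a b (fun x => f x + g x).
Proof. by move=> cf cg x; apply: continuousD; [exact: cf|exact: cg]. Qed.

Lemma within_continuousB a b f g : wc a b f -> wc a b g ->
  wc a b (fun x => f x - g x).
Proof. by move=> cf cg x; apply: continuousB; [exact: cf|exact: cg]. Qed.

Lemma within_continuousM a b f g : wc a b f -> wc a b g ->
  wc a b (fun x => f x * g x).
Proof. by move=> cf cg x; apply: continuousM; [exact: cf|exact: cg]. Qed.

Lemma within_continuousN a b f : wc a b f -> wc a b (fun x => - f x).
Proof. by move=> cf x; apply: continuousN; exact: cf. Qed.

Lemma within_continuous_cst a b k : wc a b (fun=> k).
Proof. by move=> x; exact: cst_continuous. Qed.

Lemma within_continuousZ a b k f : wc a b f -> wc a b (fun x => k * f x).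
Proof. by apply: within_continuousM; exact: within_continuous_cst. Qed.

Lemma within_continuousX2 a b f : wc a b f -> wc a b (fun x => f x ^+ 2).
Proof. by move=> cf; exact: within_continuousM. Qed.

Lemma within_continuousT a b f : continuous f -> wc a b f.
Proof. by move=> cf; exact: continuous_subspaceT. Qed.

Lemma is_derive_continuous f df :
  (forall x : R, is_derive x 1 f (df x)) -> continuous f.
Proof.
move=> fdf x; apply: differentiable_continuous; apply/derivable1_diffP.
exact: (@ex_derive _ _ _ _ _ _ _ (fdf x)).
Qed.

Lemma continuous_mul f g : continuous f -> continuous g ->
  continuous (fun x => f x * g x).
Proof. by move=> cf cg x; exact: continuousM (cf x) (cg x). Qed.

Lemma continuous_scale k f : continuous f -> continuous (fun x => k * f x).
Proof. by apply: continuous_mul => x; exact: cst_continuous. Qed.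

Lemma continuous_add f g : continuous f -> continuous g ->
  continuous (fun x => f x + g x).
Proof. by move=> cf cg x; exact: continuousD (cf x) (cg x). Qed.

Lemma continuous_sub f g : continuous f -> continuous g ->
  continuous (fun x => f x - g x).
Proof. by move=> cf cg x; exact: continuousB (cf x) (cg x). Qed.

Lemma within_continuousS a b c d f : a <= c -> d <= b ->
  wc a b f -> wc c d f.
Proof.
move=> ac db; apply: continuous_subspaceW => x /=.
by rewrite !in_itv /= => /andP[? ?]; apply/andP; split; lra.
Qed.

Lemma within_continuous_eq a b f g : (forall x, a <= x <= b -> f x = g x) ->
  wc a b f -> wc a b g.
Proof.
move=> fg cf; apply: (subspace_eq_continuous _ cf) => x.
by rewrite inE /= in_itv /= => xab; exact: fg.
Qed.

Lemma within_continuous_integrable a b f : wc a b f -> integ a b f.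
Proof.
by move=> cf; apply: continuous_compact_integrable => //; exact: segment_compact.
Qed.

Lemma integrable_itvS a b c d f : a <= c -> d <= b ->
  integ a b f -> integ c d f.
Proof.
move=> ac db; apply: integrableS => // x /=.
by rewrite !in_itv /= => /andP[? ?]; apply/andP; split; lra.
Qed.

Lemma eq_itg a b f g : (forall x, a <= x <= b -> f x = g x) ->
  itg a b f = itg a b g.
Proof.
by move=> fg; apply: eq_Rintegral => x; rewrite inE /= in_itv /=; exact: fg.
Qed.

Lemma itgD a b f g : wc a b f -> wc a b g ->
  itg a b (fun x => f x + g x) = itg a b f + itg a b g.
Proof.
move=> cf cg; apply: RintegralD => //; exact: within_continuous_integrable.
Qed.

Lemma itgB a b f g : wc a b f -> wc a b g ->
  itg a b (fun x => f x - g x) = itg a b f - itg a b g.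
Proof.
move=> cf cg; apply: RintegralB => //; exact: within_continuous_integrable.
Qed.

Lemma itgZ a b k f : wc a b f -> itg a b (fun x => k * f x) = k * itg a b f.
Proof.
move=> cf; apply: RintegralZl => //; exact: within_continuous_integrable.
Qed.

Lemma itg_sum a b (I : Type) (s : seq I) (P : pred I) (F : I -> R -> R) :
  (forall i, wc a b (F i)) ->
  wc a b (fun x => \sum_(i <- s | P i) F i x) /\
  itg a b (fun x => \sum_(i <- s | P i) F i x) =
  \sum_(i <- s | P i) itg a b (F i).
Proof.
move=> cF; elim: s => [|i s [IHc IH]].
  have -> : (fun x => \sum_(i <- [::] | P i) F i x) = fun=> 0.
    by apply/funext => x; rewrite big_nil.
  split; first exact: within_continuous_cst.
  by rewrite big_nil Rintegral_cst // mul0r.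
have -> : (fun x => \sum_(j <- i :: s | P j) F j x) =
    fun x => (if P i then F i x else 0) + \sum_(j <- s | P j) F j x.
  by apply/funext => x; rewrite big_cons; case: (P i); rewrite ?add0r.
have ci : wc a b (fun x => if P i then F i x else 0).
  by case: (P i) => //; exact: within_continuous_cst.
split; first exact: within_continuousD.
rewrite itgD // IH big_cons; case: (P i) => //.
by rewrite Rintegral_cst // mul0r add0r.
Qed.

Lemma itg_le a b f g : wc a b f -> wc a b g ->
  (forall x, a <= x <= b -> f x <= g x) -> itg a b f <= itg a b g.
Proof.
by move=> cf cg fg; apply: le_Rintegral => //; exact: within_continuous_integrable.
Qed.

Lemma itg_ge0 a b f : (forall x, a <= x <= b -> 0 <= f x) -> 0 <= itg a b f.
Proof.
by move=> f0; apply: Rintegral_ge0 => x /=; rewrite in_itv /=; exact: f0.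
Qed.

Lemma itg_cst a b k : a <= b -> itg a b (fun=> k) = k * (b - a).
Proof.
move=> ab; rewrite Rintegral_cst //= lebesgue_measure_itv /= lte_fin.
case: ltP => [//|ba]; have -> : b = a by apply/eqP; rewrite eq_le ba.
by rewrite subrr.
Qed.

Lemma normr_itg_le a b f k : a <= b -> wc a b f ->
  (forall x, a <= x <= b -> `|f x| <= k) -> `|itg a b f| <= k * (b - a).
Proof.
move=> ab cf fk.
rewrite -itg_cst //; apply: le_trans (le_normr_Rintegral _ _) _ => //.
  exact: within_continuous_integrable.
apply: itg_le => //; last exact: within_continuous_cst.
by move=> x; apply: continuous_comp; [exact: cf|exact: norm_continuous].
Qed.

Lemma itg_split a b c f : a <= c -> c <= b -> integ a b f ->
  itg a b f = itg a c f + itg c b f.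
Proof.
move=> ac cb fi; have := @Rintegral_itvB R f (BLeft a) (BRight b) c fi.
rewrite !bnd_simp => /(_ ac cb) E.
rewrite -(subrK (itg a c f) (itg a b f)) E addrC; congr (_ + _).
apply: (@Rintegral_itv_obnd_cbnd _ c (BRight b)).
apply: integrableS fi => // x /=.
by rewrite !in_itv /= => /andP[? ?]; apply/andP; split; lra.
Qed.

(** The derivative is carried as data and required only in the open interval, with continuity up to
    the ends: for functions such as the slices of a [C12] function only one-sided derivatives are
    known at the end points. *)
Definition C1on a b g dg := [/\ wc a b g, wc a b dg &
  forall x, a < x < b -> is_derive x 1 g (dg x)].

Lemma C1onT a b g dg : (forall x : R, is_derive x 1 g (dg x)) -> continuous dg ->
  C1on a b g dg.
Proof.
move=> gdg cdg; split => //; last exact: within_continuousT.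
by apply: within_continuousT; exact: is_derive_continuous gdg.
Qed.

Lemma C1onS a b c d g dg : a <= c -> d <= b -> C1on a b g dg -> C1on c d g dg.
Proof.
move=> ac db [cg cdg gdg]; split; try exact: (within_continuousS ac db).
by move=> x /andP[cx xd]; apply: gdg; apply/andP; split; lra.
Qed.

Lemma C1onD a b f df g dg : C1on a b f df -> C1on a b g dg ->
  C1on a b (fun x => f x + g x) (fun x => df x + dg x).
Proof.
move=> [cf cdf fdf] [cg cdg gdg]; split; try exact: within_continuousD.
by move=> x xab; have := fdf _ xab; have := gdg _ xab => ? ?; exact: is_deriveD.
Qed.

Lemma C1onB a b f df g dg : C1on a b f df -> C1on a b g dg ->
  C1on a b (fun x => f x - g x) (fun x => df x - dg x).
Proof.
move=> [cf cdf fdf] [cg cdg gdg]; split; try exact: within_continuousB.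
by move=> x xab; have := fdf _ xab; have := gdg _ xab => ? ?; exact: is_deriveB.
Qed.

Lemma C1onM a b f df g dg : C1on a b f df -> C1on a b g dg ->
  C1on a b (fun x => f x * g x) (fun x => df x * g x + f x * dg x).
Proof.
move=> [cf cdf fdf] [cg cdg gdg]; split.
- exact: within_continuousM.
- by apply: within_continuousD; exact: within_continuousM.
move=> x xab; have := fdf _ xab; have := gdg _ xab => ? ?.
by apply: is_derive_eq; rewrite /GRing.scale /= addrC (mulrC (df x)).
Qed.

Lemma C1on_cst a b k : C1on a b (fun=> k) (fun=> 0).
Proof. by apply: C1onT => // x; exact: cst_continuous. Qed.

Lemma C1onZ a b k f df : C1on a b f df ->
  C1on a b (fun x => k * f x) (fun x => k * df x).
Proof.
move=> [cf cdf fdf]; split; try exact: within_continuousZ.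
by move=> x xab; exact: (is_deriveZ k (fdf _ xab)).
Qed.

Lemma C1on_sum a b (I : Type) (s : seq I) (P : pred I) (F dF : I -> R -> R) :
  (forall i, C1on a b (F i) (dF i)) ->
  C1on a b (fun x => \sum_(i <- s | P i) F i x)
           (fun x => \sum_(i <- s | P i) dF i x).
Proof.
move=> CF; elim: s => [|i s IH].
  have N G : (fun x : R => \sum_(i <- [::] | P i) G i x) = fun=> 0 :> R.
    by apply/funext => x; rewrite big_nil.
  by rewrite !N; exact: C1on_cst.
have E G : (fun x : R => \sum_(j <- i :: s | P j) G j x) =
    fun x => (if P i then G i x else 0) + \sum_(j <- s | P j) G j x :> R.
  by apply/funext => x; rewrite big_cons; case: (P i); rewrite ?add0r.
rewrite !E; apply: C1onD => //; case: (P i) => //; exact: C1on_cst.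
Qed.

Lemma C1on_FTC a b g dg : a <= b -> C1on a b g dg -> itg a b dg = g b - g a.
Proof.
rewrite le_eqVlt => /predU1P[<- _|ab [cg cdg gdg]].
  by rewrite set_itv1 Rintegral_set1 subrr.
have /(continuous_within_itvP _ ab)[cgo cga cgb] := cg.
rewrite /Rintegral (@continuous_FTC2 R dg g a b ab) //.
  split => // x; rewrite in_itv /= => xab; exact: (@ex_derive _ _ _ _ _ _ _ (gdg x xab)).
move=> x; rewrite in_itv /= => xab; have := gdg x xab => ?.
by rewrite derive1E derive_val.
Qed.

Lemma C1on_parts a b f df g dg : a <= b -> C1on a b f df -> C1on a b g dg ->
  itg a b (fun x => f x * dg x) =
  f b * g b - f a * g a - itg a b (fun x => df x * g x).
Proof.
move=> ab Cf Cg; have := C1on_FTC ab (C1onM Cf Cg).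
case: Cf Cg => [cf cdf _] [cg cdg _].
by rewrite itgD; [lra|exact: within_continuousM|exact: within_continuousM].
Qed.

(* Picone's identity: [h^2 r] has derivative
   [h'^2 - k^2 h^2 - (h' - r h)^2] when [r' = - (k^2 + r^2)]. *)
Lemma riccati_poincare a b k h dh r : a <= b -> C1on a b h dh ->
  C1on a b r (fun u => - (k ^+ 2 + r u ^+ 2)) ->
  h a ^+ 2 * r a <= h b ^+ 2 * r b ->
  k ^+ 2 * itg a b (fun u => h u ^+ 2) <= itg a b (fun u => dh u ^+ 2).
Proof.
move=> ab Ch Cr hab.
have CF := C1onM (C1onM Ch Ch) Cr.
have E := C1on_FTC ab CF; case: Ch => ch cdh _; case: Cr => cr cdr _.
have h0 : 0 <= itg a b (fun x => (dh x * h x + h x * dh x) * r x +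
    h x * h x * (- (k ^+ 2 + r x ^+ 2))).
  by rewrite E -!expr2 subr_ge0.
rewrite -itgZ; last exact: within_continuousX2.
rewrite -subr_ge0 -itgB; last 2 first.
- exact: within_continuousX2.
- by apply: within_continuousZ; exact: within_continuousX2.
apply: (le_trans h0); apply: itg_le.
- by case: CF.
- apply: within_continuousB; first exact: within_continuousX2.
  by apply: within_continuousZ; exact: within_continuousX2.
move=> x _; rewrite -subr_ge0.
have -> : dh x ^+ 2 - k ^+ 2 * h x ^+ 2 - ((dh x * h x + h x * dh x) * r x +
  h x * h x * - (k ^+ 2 + r x ^+ 2)) = (dh x - h x * r x) ^+ 2 by ring.
exact: sqr_ge0.
Qed.

Lemma is_derive_affine k c (x : R) : is_derive x 1 (fun u => k * u + c) k.
Proof.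
have d := is_deriveZ k (is_derive_id x (1 : R)).
have := is_deriveD d (is_derive_cst c x (1 : R)).
by rewrite addr0 /GRing.scale /= mulr1.
Qed.

(** [r] is the logarithmic derivative of [sin (k u + c)], a solution of [y'' = - k^2 y]; where that
    solution has no zero, [r] solves the Riccati equation asked for by [riccati_poincare]. *)
Lemma is_derive_cot k c x : sin (k * x + c) != 0 ->
  let r u := k * (cos (k * u + c) / sin (k * u + c)) in
  is_derive x 1 r (- (k ^+ 2 + r x ^+ 2)).
Proof.
move=> s0 r; rewrite /r.
have d1 : is_derive x 1 (fun u => k * u + c) k.
  exact: is_derive_affine.
have ds : is_derive x 1 (fun u => sin (k * u + c)) (cos (k * x + c) * k).
  by apply: (@is_derive1_comp _ sin (fun u => k * u + c)).
have dc : is_derive x 1 (fun u => cos (k * u + c)) (- sin (k * x + c) * k).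
  by apply: (@is_derive1_comp _ cos (fun u => k * u + c)).
have dv := is_deriveV s0 ds.
apply: (is_derive_eq (is_deriveZ k (is_deriveM dc dv))).
move: (cos _) (sin _) s0 => C S S0; rewrite /GRing.scale /=.
by field.
Qed.

Lemma C1on_cot a b k c : (forall u, a <= u <= b -> sin (k * u + c) != 0) ->
  let r u := k * (cos (k * u + c) / sin (k * u + c)) in
  C1on a b r (fun u => - (k ^+ 2 + r u ^+ 2)).
Proof.
move=> s0 r.
have cr : wc a b r.
  apply: derivable_within_continuous => x; rewrite in_itv /= => /s0 sx.
  exact: (@ex_derive _ _ _ _ _ _ _ (is_derive_cot sx)).
split => //.
- apply: within_continuousN; apply: within_continuousD.
    exact: within_continuous_cst.
  exact: within_continuousX2.
move=> x /andP[ax xb]; apply: is_derive_cot; apply: s0.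
by apply/andP; split; lra.
Qed.

(** The Dirichlet-Neumann problem has first frequency [pi / (2 (b - a))]. As [k] is strictly below
    it, the sine can be shifted so as to be positive up to the Dirichlet end included while its
    cotangent stays positive at the free end. *)
Lemma poincare_left a b k h dh : a <= b -> 0 < k -> k * (b - a) < pi / 2 ->
  C1on a b h dh -> h a = 0 ->
  k ^+ 2 * itg a b (fun u => h u ^+ 2) <= itg a b (fun u => dh u ^+ 2).
Proof.
move=> ab k0 kab Ch ha.
(* Half of the slack: [k (u - a) + e] stays inside []0, pi / 2[] on the whole segment. *)
pose e := (pi / 2 - k * (b - a)) / 2.
have I u : a <= u <= b -> 0 < k * u + (e - k * a) < pi / 2.
  move=> /andP[au ub].
  have : 0 <= k * (u - a) by rewrite mulr_ge0 ?subr_ge0 // ltW.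
  have : 0 <= k * (b - u) by rewrite mulr_ge0 ?subr_ge0 // ltW.
  by rewrite /e; move=> ? ?; apply/andP; split; lra.
have sp u : a <= u <= b -> 0 < sin (k * u + (e - k * a)).
  move=> /I /andP[? ?]; apply: sin_gt0_pi; rewrite ?in_itv /=.
  by apply/andP; split => //; have := pi_gt0 R; lra.
apply: (riccati_poincare ab Ch (r := _) (C1on_cot (c := e - k * a) _)).
  by move=> u /sp; rewrite lt0r => /andP[].
rewrite ha expr0n /= mul0r mulr_ge0 ?sqr_ge0 // mulr_ge0 ?(ltW k0) //.
have bI : a <= b <= b by rewrite ab lexx.
rewrite divr_ge0 // ?ltW ?sp //.
apply: cos_gt0_pihalf; move: (I _ bI) => /andP[? ?].
by apply/andP; split => //; have := pi_gt0 R; lra.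
Qed.

(** Mirror image of [poincare_left]: the argument now runs in []- pi / 2, 0[], where the cotangent
    is negative, as the boundary condition at the free end [a] demands. *)
Lemma poincare_right a b k h dh : a <= b -> 0 < k -> k * (b - a) < pi / 2 ->
  C1on a b h dh -> h b = 0 ->
  k ^+ 2 * itg a b (fun u => h u ^+ 2) <= itg a b (fun u => dh u ^+ 2).
Proof.
move=> ab k0 kab Ch hb.
pose e := (pi / 2 - k * (b - a)) / 2.
have I u : a <= u <= b -> - (pi / 2) < k * u + (- e - k * b) < 0.
  move=> /andP[au ub].
  have : 0 <= k * (u - a) by rewrite mulr_ge0 ?subr_ge0 // ltW.
  have : 0 <= k * (b - u) by rewrite mulr_ge0 ?subr_ge0 // ltW.
  by rewrite /e; move=> ? ?; apply/andP; split; lra.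
have sp u : a <= u <= b -> sin (k * u + (- e - k * b)) < 0.
  move=> /I /andP[? ?]; rewrite -oppr_gt0 -sinN.
  by apply: sin_gt0_pi; rewrite ?in_itv /=; apply/andP; split => //; have := pi_gt0 R; lra.
apply: (riccati_poincare ab Ch (r := _) (C1on_cot (c := - e - k * b) _)).
  by move=> u /sp; rewrite lt_neqAle => /andP[].
rewrite hb expr0n /= mul0r mulr_ge0_le0 ?sqr_ge0 //.
rewrite mulr_ge0_le0 ?(ltW k0) //.
have aI : a <= a <= b by rewrite ab lexx.
rewrite mulr_ge0_le0 // ?invr_le0 ?ltW ?sp //.
apply: cos_gt0_pihalf; move: (I _ aI) => /andP[? ?].
by apply/andP; split => //; have := pi_gt0 R; lra.
Qed.

End calculus.

(** * Eigenfunctions of the Robin Laplacian *)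

Section robin_modes.
Context {R : realType} (alpha : R).
Hypothesis alpha_gt0 : 0 < alpha.
Local Notation mu := (@lebesgue_measure R).
Local Notation itg a b := (Rintegral mu [set` `[a, b]%R]).
Local Notation wc a b f := ({within [set` `[a, b]%R], continuous f}).

Lemma cosDnpi k (s : R) : cos (k%:R * pi + s) = (-1) ^+ k * cos s.
Proof.
elim: k s => [|k IH] s; first by rewrite mul0r add0r expr0 mul1r.
rewrite -natr1 mulrDl mul1r -addrA IH addrC cosDpi exprSr.
by rewrite mulrN mulrN1 mulNr.
Qed.

Lemma sinDnpi k (s : R) : sin (k%:R * pi + s) = (-1) ^+ k * sin s.
Proof.
elim: k s => [|k IH] s; first by rewrite mul0r add0r expr0 mul1r.
rewrite -natr1 mulrDl mul1r -addrA IH addrC sinDpi exprSr.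
by rewrite mulrN mulrN1 mulNr.
Qed.

(* For odd [k] the mode is a multiple of [sin (w (u - 1/2))], and the Robin
   conditions read [w cos (w/2) = - 2 alpha sin (w/2)]; with [w = k pi + 2 s] this
   is the equation below. For even [k] the mode is [cos (k pi (u - 1/2))] up to
   scaling, and [s = 0]. *)
Definition robin_root (k : nat) : set R := [set s : R |
  0 <= s < pi / 2 /\ (k%:R * pi + 2 * s) * sin s = 2 * alpha * cos s].

Lemma robin_root_ex k : exists s, robin_root k s.
Proof.
pose g s : R := (k%:R * pi + 2 * s) * sin s - 2 * alpha * cos s.
have p0 := pi_gt0 R.
have p2 : 0 <= pi / 2 :> R by rewrite divr_ge0 // ltW.
have cg : wc 0 (pi / 2) g.
  apply: within_continuousT; apply: continuous_sub; last first.
    by apply: continuous_scale; exact: continuous_cos.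
  apply: continuous_mul; last exact: continuous_sin.
  apply: continuous_add; first by move=> x; exact: cst_continuous.
  by apply: continuous_scale => x; exact: cvg_id.
have g0 : g 0 < 0 by rewrite /g sin0 cos0 mulr0 mulr1 sub0r oppr_lt0 mulr_gt0.
have g1 : 0 < g (pi / 2).
  rewrite /g sin_pihalf cos_pihalf mulr0 mulr1 subr0.
  by rewrite addrC ltr_wpDr ?mulr_gt0 ?divr_gt0 // mulr_ge0 ?ler0n // ltW.
have [|s] := IVT p2 cg (v := 0).
  by rewrite ge_min le_max (ltW g0) (ltW g1) orbT.
rewrite in_itv /= => /andP[s0 s2] gs; exists s; split; last first.
  by apply/eqP; rewrite -subr_eq0; apply/eqP.
rewrite s0 lt_neqAle s2 andbT; apply/eqP => E.
by move: g1; rewrite -E gs ltxx.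
Qed.

(** By [robin_root_ex] the default 0 of [xget] is never the result of a failed choice. A shift in
    [[0, pi / 2[] is what places the frequency [k pi + 2 s] in [[k pi, (k + 1) pi[]. *)
Definition robin_shift (k : nat) : R := if odd k then xget 0 (robin_root k) else 0.

Definition robin_freq (k : nat) : R := k%:R * pi + 2 * robin_shift k.

Let w := robin_freq.
(** This is [w (u - 1/2) - k pi / 2], so that one cosine gives, up to sign, the symmetric modes for
    even [k] and the antisymmetric ones for odd [k]. *)
Let phase (k : nat) (u : R) : R := w k * u + - (k%:R * pi + robin_shift k).

Lemma robin_shift_itv k : 0 <= robin_shift k < pi / 2.
Proof.
rewrite /robin_shift; case: ifP => _; last by rewrite lexx divr_gt0 // pi_gt0.
by have [[]] := xgetPex 0 (robin_root_ex k).
Qed.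

Lemma robin_freq_ge k : k%:R * pi <= robin_freq k.
Proof.
by have /andP[s0 _] := robin_shift_itv k; rewrite /robin_freq lerDl mulr_ge0.
Qed.

Lemma robin_freq_lt k : robin_freq k < k.+1%:R * pi.
Proof.
have /andP[_ s2] := robin_shift_itv k.
by rewrite /robin_freq -[k.+1%:R]natr1 mulrDl mul1r; lra.
Qed.

Lemma robin_freq_ge0 k : 0 <= robin_freq k.
Proof.
by apply: le_trans (robin_freq_ge k); rewrite mulr_ge0 ?ler0n // pi_ge0.
Qed.

Lemma robin_freq_mono j k : (j < k)%N -> robin_freq j < robin_freq k.
Proof.
move=> jk; apply: lt_le_trans (robin_freq_lt j) _.
apply: le_trans (robin_freq_ge k).
by rewrite ler_wpM2r ?pi_ge0 // ler_nat.
Qed.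

Lemma robin_freq_gt0 k : (0 < k)%N -> 0 < robin_freq k.
Proof.
by move=> k0; apply: le_lt_trans (robin_freq_mono k0); exact: robin_freq_ge0.
Qed.

Definition robin_norm2 k := itg 0 1 (fun u => cos (phase k u) ^+ 2).
Definition robin_mode k u := (Num.sqrt (robin_norm2 k))^-1 * cos (phase k u).
Definition robin_dmode k u :=
  - (Num.sqrt (robin_norm2 k))^-1 * w k * sin (phase k u).

Local Notation e := robin_mode.
Local Notation de := robin_dmode.

Let is_derive_phase k (u : R) : is_derive u 1 (phase k) (w k).
Proof. exact: is_derive_affine. Qed.

Lemma is_derive_mode k (u : R) : is_derive u 1 (e k) (de k u).
Proof.
have d := is_derive1_comp (is_derive_cos (phase k u)) (is_derive_phase k u).
apply: (is_derive_eq (is_deriveZ (Num.sqrt (robin_norm2 k))^-1 d)).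
by rewrite /GRing.scale /= /robin_dmode; ring.
Qed.

Lemma is_derive_dmode k (u : R) : is_derive u 1 (de k) (- w k ^+ 2 * e k u).
Proof.
have d := is_derive1_comp (is_derive_sin (phase k u)) (is_derive_phase k u).
apply: (is_derive_eq (is_deriveZ (- (Num.sqrt (robin_norm2 k))^-1 * w k) d)).
by rewrite /GRing.scale /= /robin_mode; ring.
Qed.

Lemma continuous_mode k : continuous (e k).
Proof.
exact: is_derive_continuous (is_derive_mode k).
Qed.

Lemma continuous_dmode k : continuous (de k).
Proof.
exact: is_derive_continuous (is_derive_dmode k).
Qed.

Lemma C1on_mode a b k : C1on a b (e k) (de k).
Proof.
apply: C1onT; [exact: is_derive_mode|exact: continuous_dmode].
Qed.

Lemma C1on_dmode a b k : C1on a b (de k) (fun u => - w k ^+ 2 * e k u).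
Proof.
apply: C1onT; first exact: is_derive_dmode.
by apply: continuous_scale; exact: continuous_mode.
Qed.

Let phase0 k : phase k 0 = - (k%:R * pi + robin_shift k).
Proof. by rewrite /phase mulr0 add0r. Qed.

Let phase1 k : phase k 1 = robin_shift k.
Proof. by rewrite /phase /w /robin_freq mulr1; ring. Qed.

(** The Robin conditions of [cos (phase k u)] at 0 and at 1. For odd [k] both are the equation of
    [robin_root]; for even [k] the fluxes and the jump all vanish. *)
Let robin_bc k : w k * ((-1) ^+ k * sin (robin_shift k)) =
    alpha * (((-1) ^+ k - 1) * cos (robin_shift k)) /\
  - (w k * sin (robin_shift k)) =
    alpha * (((-1) ^+ k - 1) * cos (robin_shift k)).
Proof.
rewrite -signr_odd; case/boolP: (odd k) => ok.
  have [_ E] := xgetPex 0 (robin_root_ex k).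
  have {}E : w k * sin (robin_shift k) = 2 * alpha * cos (robin_shift k).
    by move: E; rewrite /w /robin_freq /robin_shift ok.
  rewrite expr1; split; last by rewrite E; ring.
  by rewrite mulN1r mulrN E; ring.
have -> : robin_shift k = 0 by rewrite /robin_shift (negbTE ok).
by rewrite expr0 subrr sin0 !mulr0 mul0r oppr0 mulr0.
Qed.

Lemma mode_bc0 k : de k 0 = alpha * (e k 0 - e k 1).
Proof.
rewrite /robin_dmode /robin_mode phase0 phase1 sinN cosN cosDnpi sinDnpi.
have [E _] := robin_bc k.
transitivity ((Num.sqrt (robin_norm2 k))^-1 *
  (w k * ((-1) ^+ k * sin (robin_shift k)))); first by ring.
by rewrite E; ring.
Qed.

Lemma mode_bc1 k : de k 1 = alpha * (e k 0 - e k 1).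
Proof.
rewrite /robin_dmode /robin_mode phase0 phase1 cosN cosDnpi.
have [_ E] := robin_bc k.
transitivity ((Num.sqrt (robin_norm2 k))^-1 *
  - (w k * sin (robin_shift k))); first by ring.
by rewrite E; ring.
Qed.

(* The Robin conditions on [e k] make the boundary terms of the integration by
   parts equal to [alpha] times the product of the jumps. *)
Lemma mode_form g dg k : C1on 0 1 g dg ->
  itg 0 1 (fun u => dg u * de k u) +
    alpha * (g 0 - g 1) * (e k 0 - e k 1) =
  w k ^+ 2 * itg 0 1 (fun u => g u * e k u).
Proof.
move=> Cg.
have P := C1on_parts (@ler01 R) Cg (C1on_dmode 0 1 k).
have cge : wc 0 1 (fun u => g u * e k u).
  by apply: within_continuousM; [case: Cg|case: (C1on_mode 0 1 k)].
have E : itg 0 1 (fun u => g u * (- w k ^+ 2 * e k u)) =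
    - w k ^+ 2 * itg 0 1 (fun u => g u * e k u).
  by rewrite -itgZ //; apply: eq_itg => x _; ring.
move: P; rewrite E mode_bc0 mode_bc1 => P.
apply/eqP; rewrite -subr_eq0; apply/eqP.
transitivity ((itg 0 1 (fun u => dg u * de k u) +
  (- w k ^+ 2 * itg 0 1 (fun u => g u * e k u))) +
  alpha * (g 0 - g 1) * (e k 0 - e k 1)); first by ring.
by rewrite P; ring.
Qed.

(** Integrating the cosine against its second derivative gives [w^2] times the difference of the
    integrals of [cos^2] and [sin^2] as [alpha] times the squared jump. The difference is thus
    nonnegative, and the two integrals add up to 1. Mode 0 is constant and treated apart, its
    frequency being 0. *)
Lemma robin_norm2_ge k : 1 / 2 <= robin_norm2 k.
Proof.
case: k => [|k].
  have -> : robin_norm2 0 = itg 0 1 (fun=> 1).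
    apply: eq_itg => u _; have s0 : robin_shift 0 = 0 by [].
    by rewrite /phase /w /robin_freq s0 !mul0r mulr0 !addr0 mul0r oppr0 addr0 cos0 expr1n.
  by rewrite itg_cst //; lra.
have w0 : 0 < w k.+1 by exact: robin_freq_gt0.
pose f u := cos (phase k.+1 u); pose df u := - w k.+1 * sin (phase k.+1 u).
have cos_d (u : R) : is_derive u 1 f (df u).
  apply: (is_derive_eq (is_derive1_comp (is_derive_cos _) (is_derive_phase k.+1 u))).
  by rewrite /df; ring.
have sin_d (u : R) : is_derive u 1 df (- w k.+1 ^+ 2 * f u).
  apply: (is_derive_eq (is_deriveZ (- w k.+1)
    (is_derive1_comp (is_derive_sin _) (is_derive_phase k.+1 u)))).
  by rewrite /GRing.scale /= /f; ring.
have contf := is_derive_continuous cos_d.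
have contdf := is_derive_continuous sin_d.
have Cf : C1on 0 1 f df by exact: C1onT.
have Cdf : C1on 0 1 df (fun u => - w k.+1 ^+ 2 * f u).
  by apply: C1onT => //; exact: continuous_scale.
have cf := within_continuousT (a := 0) (b := 1) contf.
have cdf := within_continuousT (a := 0) (b := 1) contdf.
have P := C1on_parts (@ler01 R) Cf Cdf.
have E1 : itg 0 1 (fun u => f u * (- w k.+1 ^+ 2 * f u)) =
    - w k.+1 ^+ 2 * robin_norm2 k.+1.
  rewrite -itgZ; last exact: within_continuousX2.
  by apply: eq_itg => x _; rewrite /f; ring.
have E2 : itg 0 1 (fun u => df u * df u) = w k.+1 ^+ 2 * (1 - robin_norm2 k.+1).
  transitivity (itg 0 1 (fun u => w k.+1 ^+ 2 * (1 - f u ^+ 2))).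
    apply: eq_itg => x _; rewrite /df /f.
    have := cos2Dsin2 (phase k.+1 x); move: (cos _) (sin _) => C S CS.
    by rewrite -CS; ring.
  rewrite itgZ; last first.
    apply: within_continuousB; first exact: within_continuous_cst.
    exact: within_continuousX2.
  rewrite itgB; [|exact: within_continuous_cst|exact: within_continuousX2].
  by rewrite itg_cst // subr0 mulr1.
move: P; rewrite E1 E2.
have -> : f 1 * df 1 - f 0 * df 0 = - (alpha * ((f 0 - f 1) ^+ 2)).
  rewrite /f /df phase0 phase1 sinN !cosN cosDnpi sinDnpi.
  have [E3 E4] := robin_bc k.+1.
  move: E3 E4; set C := cos _; set S := sin _; set m := (-1) ^+ _; set W := w _.
  move=> E3 E4.
  transitivity (C * - (W * S) - m * C * (W * (m * S))); first by ring.
  by rewrite E3 E4; ring.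
move=> P; rewrite -subr_ge0 -(pmulr_rge0 _ (exprn_gt0 2 w0)).
have : 0 <= alpha * (f 0 - f 1) ^+ 2 by rewrite mulr_ge0 ?sqr_ge0 // ltW.
lra.
Qed.

Lemma robin_norm2_gt0 k : 0 < robin_norm2 k.
Proof. by apply: lt_le_trans (robin_norm2_ge k); rewrite divr_gt0. Qed.

Lemma mode_le2 k u : `|e k u| <= 2.
Proof.
rewrite /robin_mode normrM -[2]mulr1 ler_pM //; last first.
  by rewrite ler_norml cos_geN1 cos_le1.
have n0 : 0 < Num.sqrt (robin_norm2 k) by rewrite sqrtr_gt0 robin_norm2_gt0.
rewrite ger0_norm ?invr_ge0 ?(ltW n0) // invf_ple ?posrE //.
rewrite -(ler_pXn2r (n := 2)) ?nnegrE ?invr_ge0 ?(ltW n0) //.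
rewrite sqr_sqrtr ?ltW ?robin_norm2_gt0 //.
by apply: lt_le_trans (robin_norm2_ge k); lra.
Qed.

Lemma dmode_le2 k u : `|de k u| <= 2 * w k.
Proof.
have n0 : 0 < Num.sqrt (robin_norm2 k) by rewrite sqrtr_gt0 robin_norm2_gt0.
rewrite /robin_dmode !normrM normrN -[leRHS]mulr1 ler_pM //; last first.
  by rewrite ler_norml sin_geN1 sin_le1.
rewrite (ger0_norm (robin_freq_ge0 k)) ler_wpM2r ?robin_freq_ge0 //.
rewrite ger0_norm ?invr_ge0 ?(ltW n0) // invf_ple ?posrE //.
rewrite -(ler_pXn2r (n := 2)) ?nnegrE ?invr_ge0 ?(ltW n0) //.
rewrite sqr_sqrtr ?ltW ?robin_norm2_gt0 //.
by apply: lt_le_trans (robin_norm2_ge k); lra.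
Qed.

(** Off the diagonal, [mode_form] with the roles of the two modes exchanged evaluates one symmetric
    form twice, whence [(w_k^2 - w_j^2) <e_j, e_k> = 0]; the frequencies are strictly increasing. *)
Lemma mode_orthonormal j k : itg 0 1 (fun u => e j u * e k u) = (j == k)%:R.
Proof.
have [<-|jk] := eqVneq j k.
  have n0 := robin_norm2_gt0 j.
  transitivity ((robin_norm2 j)^-1 * robin_norm2 j); last first.
    by rewrite mulVf // gt_eqF.
  rewrite -itgZ; last first.
    apply: within_continuousX2; apply: within_continuousT.
    exact: is_derive_continuous (fun u =>
      is_derive1_comp (is_derive_cos _) (is_derive_phase j u)).
  apply: eq_itg => u _; rewrite /robin_mode.
  rewrite -{3}(sqr_sqrtr (ltW n0)).
  have : Num.sqrt (robin_norm2 j) != 0 by rewrite gt_eqF // sqrtr_gt0.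
  by move: (Num.sqrt _) (cos _) => x y x0; field.
have Ej := mode_form k (C1on_mode 0 1 j).
have Ek := mode_form j (C1on_mode 0 1 k).
have S1 : itg 0 1 (fun u => e k u * e j u) = itg 0 1 (fun u => e j u * e k u).
  by apply: eq_itg => u _; rewrite mulrC.
have S2 : itg 0 1 (fun u => de k u * de j u) = itg 0 1 (fun u => de j u * de k u).
  by apply: eq_itg => u _; rewrite mulrC.
rewrite S1 S2 in Ek.
have : (w k ^+ 2 - w j ^+ 2) * itg 0 1 (fun u => e j u * e k u) = 0.
  by rewrite mulrBl -Ej -Ek; ring.
move=> /eqP; rewrite mulf_eq0 => /orP[|/eqP //].
rewrite subr_eq0 eqrXn2 ?robin_freq_ge0 // => /eqP E.
by move: jk; rewrite neq_ltn => /orP[] /robin_freq_mono; rewrite /w in E; rewrite E ltxx.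
Qed.

End robin_modes.

(** * Square integrable functions on the unit interval *)

Section square_integrable.
Context {R : realType}.
Local Notation mu := (@lebesgue_measure R).
Local Notation itg a b := (Rintegral mu [set` `[a, b]%R]).
Local Notation wc a b f := ({within [set` `[a, b]%R], continuous f}).
Local Notation integ a b f := (mu.-integrable [set` `[a, b]%R] (EFin \o f)).
Implicit Types f g h : R -> R.

(** The first clause carries the measurability of [f], which cannot be recovered from that of its
    square. *)
Definition sqint f := integ 0 1 f /\ integ 0 1 (fun u => f u ^+ 2).

Lemma within_continuous_sqint f : wc 0 1 f -> sqint f.
Proof.
move=> cf; split; apply: within_continuous_integrable => //.
exact: within_continuousX2.
Qed.

Lemma within_continuous_bounded a b f : wc a b f ->
  exists M, forall x, a <= x <= b -> `|f x| <= M.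
Proof.
move=> cf; have [ab|ba] := leP a b; last first.
  exists 0 => x /andP[ax xb]; have := lt_le_trans ba (le_trans ax xb).
  by rewrite ltxx.
have cnf : wc a b (fun x => `|f x|).
  by move=> x; apply: continuous_comp; [exact: cf|exact: norm_continuous].
have [c _ fc] := EVT_max ab cnf.
by exists `|f c| => x xab; apply: fc; rewrite in_itv.
Qed.

Lemma integrable_itvM a b f g : integ a b f -> wc a b g ->
  integ a b (fun u => f u * g u).
Proof.
move=> fi cg; have [M Mg] := within_continuous_bounded cg.
have -> : EFin \o (fun u => f u * g u) = ((EFin \o f) \* (EFin \o g))%E.
  by apply/funext => u /=; rewrite EFinM.
apply: integrableMl => //.
  have /integrableP[] := within_continuous_integrable cg.
  by move=> /measurable_EFinP ?.
exists M; split; first by rewrite num_real.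
move=> N MN x /=; rewrite in_itv /= => xab.
by apply: ltW; apply: le_lt_trans MN; exact: Mg.
Qed.

Lemma integrable_itvD a b f g : integ a b f -> integ a b g ->
  integ a b (fun u => f u + g u).
Proof.
move=> fi gi.
have -> : EFin \o (fun u => f u + g u) = ((EFin \o f) \+ (EFin \o g))%E.
  by apply/funext => u /=; rewrite EFinD.
exact: integrableD.
Qed.

Lemma integrable_itvB a b f g : integ a b f -> integ a b g ->
  integ a b (fun u => f u - g u).
Proof.
move=> fi gi.
have -> : EFin \o (fun u => f u - g u) = ((EFin \o f) \- (EFin \o g))%E.
  by apply/funext => u /=; rewrite EFinB.
exact: integrableB.
Qed.

Lemma integrable_itvZ a b k f : integ a b f -> integ a b (fun u => k * f u).
Proof.
move=> fi.
have -> : EFin \o (fun u => k * f u) = (fun x => k%:E * (EFin \o f) x)%E.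
  by apply/funext => u /=; rewrite EFinM.
exact: integrableZl.
Qed.

Lemma sqint_mul f g : sqint f -> wc 0 1 g -> integ 0 1 (fun u => f u * g u).
Proof. by case=> fi _; exact: integrable_itvM. Qed.

Lemma sqint_subZ f g (s : R) : sqint f -> wc 0 1 g ->
  itg 0 1 (fun u => (f u - s * g u) ^+ 2) =
  itg 0 1 (fun u => f u ^+ 2) - 2 * s * itg 0 1 (fun u => f u * g u)
  + s ^+ 2 * itg 0 1 (fun u => g u ^+ 2).
Proof.
move=> sf cg; have i1 := sqint_mul sf cg; case: sf => fi f2i.
have i2 := within_continuous_integrable (within_continuousX2 cg).
transitivity (itg 0 1 (fun u => f u ^+ 2 + (- (2 * s)) * (f u * g u) +
  s ^+ 2 * g u ^+ 2)); first by apply: eq_itg => u _; ring.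
rewrite RintegralD //; last 2 first.
- by apply: integrable_itvD => //; exact: integrable_itvZ.
- exact: integrable_itvZ.
rewrite RintegralD //; last exact: integrable_itvZ.
by rewrite !RintegralZl //; ring.
Qed.

Lemma sqint_cauchy_schwarz f g : sqint f -> wc 0 1 g ->
  itg 0 1 (fun u => f u * g u) ^+ 2 <=
  itg 0 1 (fun u => f u ^+ 2) * itg 0 1 (fun u => g u ^+ 2).
Proof.
move=> sf cg.
have P s : 0 <= itg 0 1 (fun u => f u ^+ 2)
    - 2 * s * itg 0 1 (fun u => f u * g u) + s ^+ 2 * itg 0 1 (fun u => g u ^+ 2).
  by rewrite -sqint_subZ //; apply: itg_ge0 => u _; exact: sqr_ge0.
have : 0 <= itg 0 1 (fun u => g u ^+ 2) by apply: itg_ge0 => u _; exact: sqr_ge0.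
move: (itg 0 1 (fun u => f u ^+ 2)) (itg 0 1 (fun u => g u ^+ 2)) P.
move: (itg 0 1 (fun u => f u * g u)) => x F G P; rewrite le_eqVlt => /predU1P[G0|G0].
  rewrite -G0 mulr0; have [->|x0] := eqVneq x 0; first by rewrite expr0n.
  (* When [g] has norm 0 the quadratic in [s] is affine; at this [s] it equals [-1], contradicting
     its nonnegativity. *)
  have := P ((F + 1) / (2 * x)); rewrite -G0 mulr0 addr0.
  have -> : 2 * ((F + 1) / (2 * x)) * x = F + 1 by field; rewrite x0.
  lra.
have := P (x / G).
have -> : F - 2 * (x / G) * x + (x / G) ^+ 2 * G = (F * G - x ^+ 2) / G.
  by field; rewrite gt_eqF.
by rewrite pmulr_lge0 ?invr_gt0 // subr_ge0.
Qed.

End square_integrable.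

(** * Bessel's inequality, the remainder estimate and Parseval's identity *)

Section parseval.
Context {R : realType} (alpha : R).
Hypothesis alpha_gt0 : 0 < alpha.
Local Notation mu := (@lebesgue_measure R).
Local Notation itg a b := (Rintegral mu [set` `[a, b]%R]).
Local Notation wc a b f := ({within [set` `[a, b]%R], continuous f}).
Local Notation integ a b f := (mu.-integrable [set` `[a, b]%R] (EFin \o f)).
Implicit Types f g h : R -> R.
Local Notation w := (robin_freq alpha).
Local Notation e := (robin_mode alpha).
Local Notation de := (robin_dmode alpha).

Definition coef f k := itg 0 1 (fun u => f u * e k u).
Definition comb M (a : nat -> R) u := \sum_(k < M) a k * e k u.
Definition dcomb M (a : nat -> R) u := \sum_(k < M) a k * de k u.

Lemma C1on_comb x y M a : C1on x y (comb M a) (dcomb M a).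
Proof. by apply: C1on_sum => k; apply: C1onZ; exact: C1on_mode. Qed.

Lemma within_continuous_mode x y k : wc x y (e k).
Proof. by case: (C1on_mode alpha x y k). Qed.

Lemma within_continuous_comb x y M a : wc x y (comb M a).
Proof. by case: (C1on_comb x y M a). Qed.

Lemma itg_comb f M a : sqint f ->
  itg 0 1 (fun u => f u * comb M a u) = \sum_(k < M) a k * coef f k.
Proof.
move=> sf.
suff [] : integ 0 1 (fun u => f u * comb M a u) /\
  itg 0 1 (fun u => f u * comb M a u) = \sum_(k < M) a k * coef f k by [].
elim: M => [|M [IHi IHe]].
  have -> : (fun u => f u * comb 0 a u) = fun=> 0.
    by apply/funext => u; rewrite /comb big_ord0 mulr0.
  split; last by rewrite big_ord0 itg_cst // mul0r.
  by apply: within_continuous_integrable; exact: within_continuous_cst.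
have -> : (fun u => f u * comb M.+1 a u) =
    fun u => f u * comb M a u + a M * (f u * e M u).
  by apply/funext => u; rewrite /comb big_ord_recr /=; ring.
have i1 := sqint_mul sf (@within_continuous_mode 0 1 M).
split; first by apply: integrable_itvD => //; exact: integrable_itvZ.
rewrite RintegralD //; last exact: integrable_itvZ.
by rewrite IHe big_ord_recr /= RintegralZl.
Qed.

Lemma coef_comb M a j : (j < M)%N -> coef (comb M a) j = a j.
Proof.
move=> jM.
rewrite /coef; transitivity (itg 0 1 (fun u => e j u * comb M a u)).
  by apply: eq_itg => u _; rewrite mulrC.
rewrite itg_comb; last exact/within_continuous_sqint/within_continuous_mode.
rewrite (bigD1 (Ordinal jM)) //= big1 => [|i ij].
  by rewrite /coef mode_orthonormal // eqxx mulr1 addr0.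
rewrite /coef mode_orthonormal //.
case: eqP => [E|]; last by rewrite mulr0.
by move: ij; rewrite -val_eqE /= E eqxx.
Qed.

Lemma itg_comb2 M a :
  itg 0 1 (fun u => comb M a u ^+ 2) = \sum_(k < M) a k ^+ 2.
Proof.
transitivity (itg 0 1 (fun u => comb M a u * comb M a u)).
  by apply: eq_itg => u _; rewrite expr2.
rewrite itg_comb; last exact/within_continuous_sqint/within_continuous_comb.
by apply: eq_bigr => k _; rewrite coef_comb // expr2.
Qed.

Lemma itg_sub_comb2 f M a : sqint f ->
  itg 0 1 (fun u => (f u - comb M a u) ^+ 2) =
  itg 0 1 (fun u => f u ^+ 2) - \sum_(k < M) coef f k ^+ 2
  + \sum_(k < M) (a k - coef f k) ^+ 2.
Proof.
move=> sf; have := sqint_subZ 1 sf (@within_continuous_comb 0 1 M a).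
under eq_itg do rewrite mul1r.
move=> ->; rewrite itg_comb // itg_comb2 mulr1 expr1n mul1r -!addrA; congr (_ + _).
rewrite mulr_sumr -!sumrN -!big_split /=; apply: eq_bigr => k _.
by ring.
Qed.

Lemma bessel f M : sqint f ->
  \sum_(k < M) coef f k ^+ 2 <= itg 0 1 (fun u => f u ^+ 2).
Proof.
move=> sf; have := itg_sub_comb2 M (coef f) sf.
rewrite (_ : \sum_(k < M) (coef f k - coef f k) ^+ 2 = 0); last first.
  by apply: big1 => k _; rewrite subrr expr0n.
rewrite addr0 => E; rewrite -subr_ge0 -E.
by apply: itg_ge0 => u _; exact: sqr_ge0.
Qed.

(** The quadratic form of the Robin Laplacian: the jump term encodes the boundary conditions, so
    that [g] itself need not satisfy them. *)
Definition robin_form g dg :=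
  itg 0 1 (fun u => dg u ^+ 2) + alpha * (g 0 - g 1) ^+ 2.

Lemma robin_form_ge0 g dg : 0 <= robin_form g dg.
Proof.
apply: addr_ge0; first by apply: itg_ge0 => u _; exact: sqr_ge0.
by apply: mulr_ge0; [exact: ltW|exact: sqr_ge0].
Qed.

Lemma mixed_form_comb g dg M a : C1on 0 1 g dg ->
  itg 0 1 (fun u => dg u * dcomb M a u) +
    alpha * (g 0 - g 1) * (comb M a 0 - comb M a 1) =
  \sum_(k < M) a k * (w k ^+ 2 * coef g k).
Proof.
move=> Cg; have [cg cdg _] := Cg.
transitivity (\sum_(k < M) a k * (itg 0 1 (fun u => dg u * de k u) +
    alpha * (g 0 - g 1) * (e k 0 - e k 1))); last first.
  by apply: eq_bigr => k _; rewrite mode_form.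
have cde k : wc 0 1 (fun u => dg u * de k u).
  by apply: within_continuousM => //; case: (C1on_mode alpha 0 1 k).
have [_ E] := @itg_sum R 0 1 _ (index_enum 'I_M) predT
  (fun k u => a k * (dg u * de k u)) (fun k => within_continuousZ (cde k)).
have -> : itg 0 1 (fun u => dg u * dcomb M a u) =
    \sum_(k < M) itg 0 1 (fun u => a k * (dg u * de k u)).
  rewrite -E; apply: eq_itg => u _; rewrite /dcomb mulr_sumr.
  by apply: eq_bigr => k _; ring.
rewrite /comb -sumrB mulr_sumr -big_split /=.
by apply: eq_bigr => k _; rewrite itgZ //; ring.
Qed.

Lemma robin_form_comb M a :
  robin_form (comb M a) (dcomb M a) = \sum_(k < M) w k ^+ 2 * a k ^+ 2.
Proof.
have := mixed_form_comb M a (C1on_comb 0 1 M a).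
rewrite /robin_form => E.
transitivity (\sum_(k < M) a k * (w k ^+ 2 * coef (comb M a) k)).
  rewrite -E (_ : itg 0 1 (fun u => dcomb M a u ^+ 2) =
    itg 0 1 (fun u => dcomb M a u * dcomb M a u)); first by ring.
  by apply: eq_itg => u _; rewrite expr2.
by apply: eq_bigr => k _; rewrite coef_comb //; ring.
Qed.

Lemma robin_form_sub_comb g dg M a : C1on 0 1 g dg ->
  robin_form (fun u => g u - comb M a u) (fun u => dg u - dcomb M a u) =
  robin_form g dg - \sum_(k < M) w k ^+ 2 * coef g k ^+ 2
  + \sum_(k < M) w k ^+ 2 * (a k - coef g k) ^+ 2.
Proof.
move=> Cg; have [cg cdg _] := Cg.
have [_ cdc _] := C1on_comb 0 1 M a.
have E1 := mixed_form_comb M a Cg.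
have E2 := robin_form_comb M a.
have E3 := sqint_subZ 1 (within_continuous_sqint cdg) cdc.
have E4 : itg 0 1 (fun u => (dg u - dcomb M a u) ^+ 2) =
    itg 0 1 (fun u => (dg u - 1 * dcomb M a u) ^+ 2).
  by apply: eq_itg => u _; rewrite mul1r.
rewrite {1}/robin_form E4 E3.
transitivity (robin_form g dg - 2 * \sum_(k < M) a k * (w k ^+ 2 * coef g k)
   + \sum_(k < M) w k ^+ 2 * a k ^+ 2).
  by rewrite -E1 -E2 /robin_form; ring.
rewrite -!addrA; congr (_ + _); rewrite mulr_sumr -!sumrN -!big_split /=.
by congr (_ + _); apply: eq_bigr => k _; ring.
Qed.

(* Each half-cell [[i/2M, (i+1)/2M]] has one endpoint among the zeros
   [(2j+1)/2M], and [k] is below the first eigenvalue of the mixed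
   Dirichlet-Neumann problem there. *)
Lemma poincare_nodes h dh M k : (0 < M)%N -> 0 < k -> k < M%:R * pi ->
  C1on 0 1 h dh -> (forall j, (j < M)%N -> h (j.*2.+1%:R / M.*2%:R) = 0) ->
  k ^+ 2 * itg 0 1 (fun u => h u ^+ 2) <= itg 0 1 (fun u => dh u ^+ 2).
Proof.
move=> M0 k0 kM Ch hz; have [ch cdh _] := Ch.
have N0 : 0 < M.*2%:R :> R by rewrite ltr0n double_gt0.
pose z i : R := i%:R / M.*2%:R.
have zle i j : (i <= j)%N -> z i <= z j.
  by move=> ij; rewrite /z ler_pM2r ?invr_gt0 // ler_nat.
have z0 : z 0 = 0 by rewrite /z mul0r.
have z1 : z M.*2 = 1 by rewrite /z divff // gt_eqF.
have zS i : k * (z i.+1 - z i) < pi / 2.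
  rewrite /z -mulrBl -natrB // subSnn mulrA mulr1 ltr_pdivrMr //.
  by rewrite -muln2 natrM (_ : pi / 2 * (M%:R * 2) = M%:R * pi) //; field.
suff H i : (i <= M.*2)%N -> k ^+ 2 * itg 0 (z i) (fun u => h u ^+ 2) <=
    itg 0 (z i) (fun u => dh u ^+ 2).
  by have := H _ (leqnn _); rewrite z1.
elim: i => [_|i IH iM].
  by rewrite z0 set_itv1 !Rintegral_set1 mulr0.
have zi0 : 0 <= z i by rewrite -z0 zle.
have zi1 : z i.+1 <= 1 by rewrite -z1 zle.
have split f : wc 0 1 f -> itg 0 (z i.+1) f = itg 0 (z i) f + itg (z i) (z i.+1) f.
  move=> cf; apply: itg_split => //; first exact: zle.
  by apply: within_continuous_integrable; exact: within_continuousS cf.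
rewrite !split; try exact: within_continuousX2.
rewrite mulrDr; apply: lerD; first by apply: IH; exact: ltnW.
have Chi : C1on (z i) (z i.+1) h dh by exact: C1onS Ch.
have zl : z i <= z i.+1 by exact: zle.
(* With [i = 2j + 1] the node is the left end [z i]; with [i = 2j] it is the right end [z i.+1]. *)
case/boolP: (odd i) => oi.
  apply: (poincare_left zl k0 (zS i) Chi).
  rewrite -(odd_double_half i) oi add1n hz //.
  by rewrite ltn_half_double.
apply: (poincare_right zl k0 (zS i) Chi).
rewrite -(odd_double_half i) (negbTE oi) add0n hz //.
by rewrite ltn_half_double.
Qed.

(** Let [comb M a] interpolate [g] at the nodes. Poincare's inequality for the error, expanded in
    coefficients, bounds [K^2] times the remainder plus [K^2] times the sum of [(a_k - c_k)^2] by
    the form of [g], minus the sum of [w_k^2 c_k^2], plus the sum of [w_k^2 (a_k - c_k)^2]. Since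
    [w_k < K] the last sum is absorbed on the left, and [K >= m pi]. *)
Lemma robin_remainder g dg m : C1on 0 1 g dg ->
  (m%:R * pi) ^+ 2 *
    (itg 0 1 (fun u => g u ^+ 2) - \sum_(k < m.+1) coef g k ^+ 2) <=
  robin_form g dg.
Proof.
move=> Cg; have [cg cdg _] := Cg.
set M := m.+1; pose z (j : nat) : R := j.*2.+1%:R / M.*2%:R.
(* Strictly above all frequencies of the span, for the invertibility of [A], and strictly below
   [M pi], for [poincare_nodes]. *)
pose K := (w m + M%:R * pi) / 2.
have wmM : w m < M%:R * pi by exact: robin_freq_lt.
have Kw (k : 'I_M) : w k < K.
  apply: (@le_lt_trans _ _ (w m)); last by rewrite /K; lra.
  have := ltn_ord k; rewrite ltnS leq_eqVlt => /predU1P[->//|km].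
  by apply: ltW; apply: robin_freq_mono.
have Kpi : K < M%:R * pi by rewrite /K; lra.
have w0 k : 0 <= w k by exact: robin_freq_ge0.
have K0 : 0 < K by apply: le_lt_trans (Kw ord0); exact: w0.
have Km : m%:R * pi <= K.
  by apply: le_trans (ltW (Kw ord_max)); exact: robin_freq_ge.
have Kw2 (k : 'I_M) : w k ^+ 2 < K ^+ 2.
  by rewrite ltr_pXn2r ?nnegrE // ltW.
have pn h dh (Ch : C1on 0 1 h dh) := poincare_nodes (isT : (0 < M)%N) K0 Kpi Ch.
pose A : 'M[R]_M := \matrix_(i, j) e i (z j).
pose coefs (v : 'rV[R]_M) k : R := if insub k is Some i then v 0 i else 0.
have coefsE v (k : 'I_M) : coefs v k = v 0 k by rewrite /coefs valK.
have combE v (j : 'I_M) : comb M (coefs v) (z j) = (v *m A) 0 j.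
  by rewrite mxE; apply: eq_bigr => k _; rewrite coefsE !mxE.
(* A nonzero combination vanishing at every node would have Robin form at least [K^2] times its
   squared norm, whereas each of its modes contributes with a factor [w_k^2 < K^2]. *)
have Au : A \in unitmx.
  rewrite unitmxE unitfE; apply/negP => /det0P [v v0 vA].
  have := pn _ _ (C1on_comb 0 1 M (coefs v)) _.
  have cz j : (j < M)%N -> comb M (coefs v) (j.*2.+1%:R / M.*2%:R) = 0.
    by move=> jM; have := combE v (Ordinal jM); rewrite vA mxE.
  move=> /(_ cz); rewrite itg_comb2 => H.
  have {}H : K ^+ 2 * (\sum_(k < M) coefs v k ^+ 2) <=
      \sum_(k < M) w k ^+ 2 * coefs v k ^+ 2.
    rewrite -robin_form_comb; apply: (le_trans H).
    by rewrite /robin_form lerDl mulr_ge0 ?sqr_ge0 // ltW.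
  move: H; rewrite mulr_sumr -subr_ge0 -sumrB.
  have [k vk] : exists k, v 0 k != 0.
    by apply/rV0Pn.
  rewrite (bigD1 k) //= -mulrBl coefsE => H.
  have : (w k ^+ 2 - K ^+ 2) * v 0 k ^+ 2 < 0.
    by rewrite pmulr_llt0 ?subr_lt0 // exprn_even_gt0.
  have : \sum_(i < M | i != k) (w i ^+ 2 * coefs v i ^+ 2 - K ^+ 2 * coefs v i ^+ 2) <= 0.
    apply: sumr_le0 => i _; rewrite -mulrBl mulr_le0_ge0 ?sqr_ge0 //.
    by rewrite subr_le0 ltW.
  by move: H; lra.
pose a := coefs ((\row_j g (z j)) *m invmx A).
have az j : (j < M)%N -> g (j.*2.+1%:R / M.*2%:R) - comb M a (j.*2.+1%:R / M.*2%:R) = 0.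
  move=> jM; have := combE (\row_j g (z j) *m invmx A) (Ordinal jM).
  by rewrite mulmxKV // mxE /a => ->; rewrite subrr.
have H := pn _ _ (C1onB Cg (C1on_comb 0 1 M a)) az.
rewrite /= itg_sub_comb2 in H; last exact: within_continuous_sqint.
have {}H : K ^+ 2 * (itg 0 1 (fun u => g u ^+ 2) - \sum_(k < M) coef g k ^+ 2 +
       \sum_(k < M) (a k - coef g k) ^+ 2) <= robin_form g dg -
       \sum_(k < M) w k ^+ 2 * coef g k ^+ 2 +
       \sum_(k < M) w k ^+ 2 * (a k - coef g k) ^+ 2.
  rewrite -robin_form_sub_comb //; apply: (le_trans H).
  by rewrite /robin_form lerDl mulr_ge0 ?sqr_ge0 // ltW.
have S1 : 0 <= \sum_(k < M) w k ^+ 2 * coef g k ^+ 2.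
  by apply: sumr_ge0 => k _; rewrite mulr_ge0 ?sqr_ge0.
have S2 : \sum_(k < M) w k ^+ 2 * (a k - coef g k) ^+ 2 <=
    K ^+ 2 * \sum_(k < M) (a k - coef g k) ^+ 2.
  by rewrite mulr_sumr; apply: ler_sum => k _; rewrite ler_wpM2r ?sqr_ge0 // ltW.
have B := bessel M (within_continuous_sqint cg).
have : (m%:R * pi) ^+ 2 * (itg 0 1 (fun u => g u ^+ 2) - \sum_(k < M) coef g k ^+ 2)
  <= K ^+ 2 * (itg 0 1 (fun u => g u ^+ 2) - \sum_(k < M) coef g k ^+ 2).
  rewrite ler_wpM2r ?subr_ge0 // ler_pXn2r // ?nnegrE ?(ltW K0) //.
  by rewrite mulr_ge0 ?ler0n ?pi_ge0.
by move: H; rewrite mulrDr; lra.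
Qed.

(** The error after [m + 1] terms is the inner product of [f] with the remainder of [g];
    Cauchy-Schwarz and [robin_remainder] make it of order [1 / m], with the smoothness asked of [g]
    alone. *)
Lemma parseval f g dg : sqint f -> C1on 0 1 g dg ->
  series (fun k => coef f k * coef g k) @ \oo --> itg 0 1 (fun u => f u * g u).
Proof.
move=> sf Cg; have [cg _ _] := Cg.
have E M : itg 0 1 (fun u => f u * g u) - series (fun k => coef f k * coef g k) M =
    itg 0 1 (fun u => f u * (g u - comb M (coef g) u)).
  transitivity (itg 0 1 (fun u => f u * g u - f u * comb M (coef g) u)); last first.
    by apply: eq_itg => u _; rewrite mulrBr.
  rewrite RintegralB //; last 2 first.
  - exact: sqint_mul.
  - by apply: sqint_mul => //; exact: within_continuous_comb.
  rewrite itg_comb // seriesEord; congr (_ - _); apply: eq_bigr => k _.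
  by rewrite mulrC.
pose F := itg 0 1 (fun u => f u ^+ 2).
have F0 : 0 <= F by apply: itg_ge0 => u _; exact: sqr_ge0.
pose Q := robin_form g dg.
have Q0 : 0 <= Q by exact: robin_form_ge0.
have B m : (m%:R * pi) ^+ 2 * (itg 0 1 (fun u => f u * g u) -
    series (fun k => coef f k * coef g k) m.+1) ^+ 2 <= F * Q.
  rewrite E.
  have cr : wc 0 1 (fun u => g u - comb m.+1 (coef g) u).
    by apply: within_continuousB => //; exact: within_continuous_comb.
  have CS := sqint_cauchy_schwarz sf cr.
  have m0 : 0 <= (m%:R * pi : R) ^+ 2 by exact: sqr_ge0.
  apply: le_trans (ler_wpM2l m0 CS) _; rewrite mulrCA ler_wpM2l //.
  rewrite itg_sub_comb2; last exact: within_continuous_sqint.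
  rewrite (_ : \sum_(k < m.+1) (coef g k - coef g k) ^+ 2 = 0); last first.
    by apply: big1 => k _; rewrite subrr expr0n.
  by rewrite addr0; exact: robin_remainder.
rewrite -cvg_shiftS; apply/cvgrPdist_lt => eps eps0.
(* It is enough that [n pi eps] exceeds [F Q + 1], because [(F Q + 1)^2 > F Q]. *)
have [n Hn] : exists n : nat, F * Q < (n%:R * pi * eps) ^+ 2.
  have [n Hn] : exists n : nat, (F * Q + 1) / (pi * eps) < n%:R.
    exists (Num.bound ((F * Q + 1) / (pi * eps))).
    by apply: le_lt_trans (archi_boundP _) => //; rewrite ?divr_ge0 ?addr_ge0 ?mulr_ge0 ?pi_ge0 // ltW.
  exists n; have FQ : 0 <= F * Q by rewrite mulr_ge0.
  have : F * Q + 1 < n%:R * pi * eps.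
    by rewrite -mulrA -ltr_pdivrMr // mulr_gt0 ?pi_gt0.
  by nra.
near=> m.
have nm : (n <= m)%N by near: m; exact: nbhs_infty_ge.
have Bm := B m; set D := (_ - _) in Bm *.
rewrite ltNge; apply/negP => De.
suff : (n%:R * pi * eps) ^+ 2 <= F * Q by rewrite leNgt Hn.
apply: le_trans Bm; rewrite -exprMn -[leRHS]real_normK ?num_real // ler_pXn2r ?nnegrE //; last first.
  by rewrite !mulr_ge0 ?ler0n ?pi_ge0 // ltW.
rewrite !normrM (ger0_norm (pi_ge0 R)) ger0_norm ?ler0n //.
by rewrite !ler_pM ?mulr_ge0 ?ler0n ?pi_ge0 ?(ltW eps0) // ler_nat.
Unshelve. all: by end_near. Qed.

End parseval.

(** * Dominated convergence for real-valued integrals *)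

Section dominated_Rintegral.
Context d {T : measurableType d} {R : realType} (mu : {measure set T -> \bar R}).

Lemma Rintegral_dominated_cvg (D : set T) (f_ : nat -> T -> R) (f g : T -> R) :
  measurable D -> (forall n, measurable_fun D (f_ n)) ->
  (forall x, D x -> f_ n x @[n --> \oo] --> f x) ->
  mu.-integrable D (EFin \o g) ->
  (forall n x, D x -> `|f_ n x| <= g x) ->
  mu.-integrable D (EFin \o f) /\
  Rintegral mu D (f_ n) @[n --> \oo] --> Rintegral mu D f.
Proof.
move=> mD mf ff gi fg.
have mlim : measurable_fun D f by apply: measurable_fun_cvg mf _ => x; exact: ff.
have [] := @dominated_convergence _ T R mu D mD (fun n => EFin \o f_ n)
  (EFin \o f) (EFin \o g).
- by move=> n; apply/measurable_EFinP.
- exact/measurable_EFinP.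
- by apply/aeW => x Dx; apply/fine_cvgP; split; [exact: nearW|exact: ff].
- by [].
- by apply/aeW => x n Dx; rewrite lee_fin fg.
move=> fi _ cv; split => //.
by rewrite -(fineK (integrable_fin_num mD fi)) in cv; exact: fine_cvg cv.
Qed.

End dominated_Rintegral.

(** * Smooth bumps and the fundamental lemma of the calculus of variations *)

Section bump.
Context {R : realType}.
Local Notation mu := (@lebesgue_measure R).
Local Notation integ a b f := (mu.-integrable [set` `[a, b]%R] (EFin \o f)).

(* These functions are stable under differentiation. *)
Definition flat (c : R) (p : {poly R}) (x : R) : R :=
  if 0 < x then p.[x^-1] * expR (- (c / x)) else 0.

(** Raise [y <= 1 + y <= exp y] at [y = c / (k x)] to the power [k]. *)
Lemma expR_inv_le (c x : R) k : 0 < c -> 0 < x ->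
  expR (- (c / x)) <= (k%:R / c) ^+ k * x ^+ k.
Proof.
move=> c0 x0; case: k => [|k].
  rewrite !expr0 mulr1 -expR0 ler_expR oppr_le0.
  by rewrite divr_ge0 // ltW.
have k0 : 0 < k.+1%:R :> R by rewrite ltr0n.
have y0 : 0 < c / x / k.+1%:R by rewrite !divr_gt0.
rewrite expRN -exprMn -[leRHS]invrK lef_pV2 ?posrE ?expR_gt0 //; last first.
  by rewrite invr_gt0 exprn_gt0 // mulr_gt0 // divr_gt0.
have -> : c / x = c / x / k.+1%:R * k.+1%:R by rewrite divfK // gt_eqF.
rewrite expRM_natr -exprVn.
rewrite ler_pXn2r ?nnegrE ?expR_ge0 //; last first.
  by rewrite invr_ge0 ltW // mulr_gt0 // divr_gt0.
apply: le_trans (expR_ge1Dx _).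
have -> : (k.+1%:R / c * x)^-1 = c / x / k.+1%:R.
  by field; rewrite !gt_eqF.
by rewrite lerDr.
Qed.

(** Flatness to every order at 0. Multiplying the polynomial by its variable divides by [x] and
    costs one order, so the induction on [p] must keep [k] arbitrary. *)
Lemma flat_decay c p k : 0 < c ->
  exists C, forall x, 0 < x <= 1 -> `|flat c p x| <= C * x ^+ k.
Proof.
move=> c0; elim/poly_ind: p k => [|p a IH] k.
  by exists 0 => x /andP[x0 _]; rewrite /flat x0 horner0 !mul0r normr0.
have [C HC] := IH k.+1.
exists (C + `|a| * (k%:R / c) ^+ k) => x /[dup] xI /andP[x0 x1].
have {}HC := HC x xI; move: HC; rewrite /flat x0 => HC.
rewrite hornerMXaddC mulrDl; apply: le_trans (ler_normD _ _) _.
rewrite mulrDl; apply: lerD.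
  have -> : p.[x^-1] / x * expR (- (c / x)) = p.[x^-1] * expR (- (c / x)) / x.
    by rewrite mulrAC.
  rewrite normrM (@ger0_norm _ x^-1) ?invr_ge0 ?(ltW x0) // ler_pdivrMr //.
  by rewrite -mulrA -exprSr.
rewrite normrM -mulrA ler_wpM2l //.
by rewrite ger0_norm ?expR_ge0 // expR_inv_le.
Qed.

(** In the variable [y = 1 / x], where [dy/dx = - y^2], the derivative of [p(y) exp(- c y)] in [x]
    is [y^2 (c p - p')(y) exp(- c y)]. *)
Definition dflat c (p : {poly R}) : {poly R} := 'X^2 * (c *: p - p^`()).

Lemma is_derive_flat0 (f : R -> R) (a C : R) : f a = 0 ->
  (forall x, `|x - a| <= 1 -> `|f x| <= C * (x - a) ^+ 2) -> is_derive a 1 f 0.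
Proof.
move=> fa fC; suff cv : h^-1 *: (f (h *: 1 + a) - f a) @[h --> 0^'] --> (0 : R).
  apply: DeriveDef; first by apply/cvg_ex; exists 0; exact: cv.
  by apply: cvg_lim => //; exact: cv.
have C0 : 0 <= C.
  have /= := fC (a + 1); rewrite addrAC subrr add0r normr1 lexx expr1n mulr1.
  by move=> /(_ isT); exact: le_trans.
apply/cvgr0Pnorm_lt => e e0; near=> h.
have h0 : h != 0 by near: h; exact: nbhs_dnbhs_neq.
have h1 : `|h| < 1 by near: h; exact: dnbhs0_lt.
have hC : `|h| < e / (C + 1).
  by near: h; apply: dnbhs0_lt; apply: divr_gt0 => //; lra.
rewrite fa subr0 /GRing.scale /= mulr1 normrM normfV.
rewrite mulrC ltr_pdivrMr ?normr_gt0 //.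
apply: le_lt_trans (fC _ _) _; first by rewrite addrK ltW.
rewrite addrK -real_normK ?num_real // expr2 mulrA ltr_pM2r ?normr_gt0 //.
apply: le_lt_trans (_ : (C + 1) * `|h| < e); first by rewrite ler_wpM2r // lerDl.
by rewrite mulrC -ltr_pdivlMr //; lra.
Unshelve. all: by end_near. Qed.

Lemma is_derive_flat c p (x : R) : 0 < c ->
  is_derive x 1 (flat c p) (flat c (dflat c p) x).
Proof.
move=> c0; have [x0|x0|->] := ltgtP x 0.
- rewrite {2}/flat ltNge (ltW x0) /=.
  apply: near_eq_is_derive (is_derive_cst (0 : R) x (1 : R)).
  near=> y; rewrite /flat ltNge ltW //.
  by near: y; exact: lt_nbhsl.
- have dV : is_derive x 1 (fun y : R => y^-1) (- x ^- 2 *: 1).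
    by apply: is_deriveV; rewrite gt_eqF.
  have d1 := is_derive1_comp (is_derive_poly p x^-1) dV.
  have dL : is_derive x 1 (fun y : R => - c * y^-1) (- c * (- x ^- 2 *: 1)).
    exact: (is_deriveZ (- c) dV).
  have d2 := @is_derive1_comp R expR (fun y => - c * y^-1) x _ _
    (is_derive_expR _) dL.
  have d3 := is_deriveM d1 d2.
  have E : \forall y \near x, ((horner p \o (fun y : R => y^-1)) *
      (expR \o (fun y : R => - c * y^-1))) y = flat c p y.
    near=> y; have y0 : 0 < y by near: y; exact: lt_nbhsr.
    transitivity (p.[y^-1] * expR (- c / y)); first by [].
    by rewrite /flat y0 mulNr.
  apply: is_derive_eq (near_eq_is_derive E d3) _.
  rewrite /flat x0 /dflat hornerM hornerXn hornerD hornerN hornerZ /GRing.scale /=.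
  by rewrite mulNr; field; rewrite gt_eqF.
- have [C HC] := flat_decay p 2 c0.
  have f0 q : flat c q 0 = 0 by rewrite /flat ltxx.
  rewrite f0; apply: (@is_derive_flat0 _ _ `|C|); first exact: f0.
  move=> y; rewrite subr0 => y1; have [y0|y0] := leP y 0.
    by rewrite /flat ltNge y0 normr0 mulr_ge0 ?sqr_ge0.
  apply: le_trans (HC _ _) _.
    by rewrite y0 /= (le_trans (ler_norm _)).
  by rewrite ler_wpM2r ?sqr_ge0 ?ler_norm.
Unshelve. all: by end_near. Qed.

(** By Leibniz's rule this class of sums is closed under differentiation, which yields derivatives
    of all orders of [bump] by induction. *)
Definition bumps c a b (s : seq ({poly R} * {poly R})) (x : R) : R :=
  \sum_(pq <- s) flat c pq.1 (x - a) * flat c pq.2 (b - x).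

Lemma is_derive_bumps c a b s : 0 < c ->
  exists s', forall x : R, is_derive x 1 (bumps c a b s) (bumps c a b s' x).
Proof.
move=> c0; elim: s => [|[p q] s [s' IH]].
  exists [::] => x; rewrite /bumps big_nil.
  have -> : (fun x => \sum_(pq <- [::]) flat c pq.1 (x - a) * flat c pq.2 (b - x))
     = fun=> (0:R) by apply/funext => y; rewrite big_nil.
  exact: is_derive_cst.
exists [:: (dflat c p, q), (p, - dflat c q) & s'] => x.
have -> : bumps c a b ((p, q) :: s) = fun x =>
    flat c p (x - a) * flat c q (b - x) + bumps c a b s x.
  by apply/funext => y; rewrite /bumps big_cons.
rewrite /bumps !big_cons /= -/(bumps c a b s' x).
have d1 : is_derive x 1 (fun y : R => y - a) 1.
  by have := is_deriveB (is_derive_id x 1) (is_derive_cst a x (1:R)); rewrite subr0.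
have d2 : is_derive x 1 (fun y : R => b - y) (-1).
  by have := is_deriveB (is_derive_cst b x (1:R)) (is_derive_id x 1); rewrite sub0r.
have e1 := @is_derive1_comp R (flat c p) (fun y => y - a) x _ _
  (is_derive_flat p (x - a) c0) d1.
have e2 := @is_derive1_comp R (flat c q) (fun y => b - y) x _ _
  (is_derive_flat q (b - x) c0) d2.
apply: is_derive_eq (is_deriveD (is_deriveM e1 e2) (IH x)) _.
rewrite addrA; congr (_ + _).
have -> : flat c (- dflat c q) (b - x) = - flat c (dflat c q) (b - x).
  by rewrite /flat; case: ifP => _; rewrite ?oppr0 // hornerN mulNr.
by rewrite /GRing.scale /=; ring.
Qed.

(** Supported in [[a, b]] with values in [[0, 1]]; as [c] tends to 0 from above it converges
    pointwise to the indicator of []a, b[]. *)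
Definition bump c a b (x : R) : R := flat c 1 (x - a) * flat c 1 (b - x).

Lemma bump_gt0 c a b x : a < x < b -> 0 < bump c a b x.
Proof.
move=> /andP[ax xb]; rewrite /bump /flat !subr_gt0 ax xb.
by rewrite !hornerC !mul1r mulr_gt0 // expR_gt0.
Qed.

Lemma bump_out c a b x : ~~ (a < x < b) -> bump c a b x = 0.
Proof.
rewrite negb_and /bump /flat !subr_gt0.
by move=> /orP[] /negbTE ->; rewrite ?mul0r ?mulr0.
Qed.

Lemma bump_ge0 c a b x : 0 <= bump c a b x.
Proof.
have [/bump_gt0 h|/bump_out ->] := boolP (a < x < b) => //.
exact: ltW.
Qed.

Lemma bump_le1 c a b x : 0 < c -> bump c a b x <= 1.
Proof.
move=> c0; have [/andP[ax xb]|/bump_out -> //] := boolP (a < x < b).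
rewrite /bump /flat !subr_gt0 ax xb !hornerC !mul1r.
by rewrite mulr_ile1 ?expR_ge0 // -expR0 ler_expR oppr_le0 divr_ge0 ?subr_ge0 ?(ltW c0) ?(ltW ax) ?(ltW xb).
Qed.

Lemma bump_derivable_n c a b n : 0 < c ->
  exists s, derive1n n (bump c a b) = bumps c a b s.
Proof.
move=> c0; elim: n => [|n [s IH]].
  by exists [:: (1, 1)]; apply/funext => x; rewrite derive1n0 /bumps big_seq1.
have [s' Hs'] := is_derive_bumps a b s c0; exists s'.
rewrite derive1nS IH; apply/funext => x; rewrite derive1E.
have := Hs' x => ?; exact: derive_val.
Qed.

Lemma test_fun_bump c a b : 0 < c -> 0 < a -> b < 1 -> test_fun (bump c a b).
Proof.
move=> c0 a0 b1.
have sub : closure [set x | bump c a b x != 0] `<=` `[a, b].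
  have /closure_id E : closed [set` `[a, b]%R] by exact: interval_closed.
  rewrite [X in _ `<=` X]E.
  apply: closure_subset => x /= /eqP; apply: contra_notP => /negP xab.
  apply: bump_out; apply: contra xab => /andP[ax xb].
  by rewrite in_itv /= !ltW.
split.
- move=> n x; have [s ->] := bump_derivable_n a b n c0.
  have [s' Hs'] := is_derive_bumps a b s c0.
  exact: (@ex_derive _ _ _ _ _ _ _ (Hs' x)).
- apply: (subclosed_compact _ (@segment_compact _ a b) sub).
  exact: closed_closure.
apply: (subset_trans sub) => x /=; rewrite !in_itv /= => /andP[ax xb].
by rewrite (lt_le_trans a0 ax) (le_lt_trans xb b1).
Qed.

Lemma bump_C2 c a b : 0 < c -> exists dg ddg : R -> R,
  [/\ forall x : R, is_derive x 1 (bump c a b) (dg x),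
      forall x : R, is_derive x 1 dg (ddg x) & continuous ddg].
Proof.
move=> c0.
have -> : bump c a b = bumps c a b [:: (1, 1)].
  by apply/funext => x; rewrite /bumps big_seq1.
have [s1 H1] := is_derive_bumps a b [:: (1, 1)] c0.
have [s2 H2] := is_derive_bumps a b s1 c0.
have [s3 H3] := is_derive_bumps a b s2 c0.
exists (bumps c a b s1), (bumps c a b s2); split => //.
exact: is_derive_continuous H3.
Qed.

Lemma continuous_bump c a b : 0 < c -> continuous (bump c a b).
Proof.
by move=> /(bump_C2 a b) [dg [_ [H _ _]]]; exact: is_derive_continuous H.
Qed.

(** Dominated convergence along the bumps with [c = 1 / (n + 1)], the dominating function being the
    absolute value of [h]. *)
Lemma orthogonal_bump_itv h a b : integ 0 1 h -> 0 < a -> b < 1 ->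
  (forall G, test_fun G -> inner G h = 0) -> Rintegral mu [set` `]a, b[%R] h = 0.
Proof.
move=> hi a0 b1 hG.
have sub : [set` `]a, b[%R] `<=` [set` `[0, 1]%R].
  move=> x /=; rewrite !in_itv /= => /andP[ax xb].
  by rewrite (ltW (lt_trans a0 ax)) (ltW (lt_trans xb b1)).
have hi' : mu.-integrable `]a, b[ (EFin \o h) by exact: integrableS hi.
pose c n : R := n.+1%:R^-1.
have c0 n : 0 < c n by rewrite invr_gt0 ltr0n.
have cc0 : c n @[n --> \oo] --> (0:R) by exact: cvg_harmonic.
have mh : measurable_fun `]a, b[ h.
  by have /integrableP[/measurable_EFinP] := hi'.
have [|||||_] := @Rintegral_dominated_cvg _ _ _ mu `]a, b[
  (fun n x => bump (c n) a b x * h x) h (fun x => `|h x|).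
- by [].
- move=> n; apply: measurable_funM => //.
  apply: measurable_funTS; apply: continuous_measurable_fun.
  exact: continuous_bump.
- move=> x /=; rewrite in_itv /= => xab.
  rewrite -[X in _ --> X]mul1r; apply: cvgM; last exact: cvg_cst.
  have -> : (fun n => bump (c n) a b x) = fun n =>
      expR (- (c n / (x - a))) * expR (- (c n / (b - x))).
    apply/funext => n; rewrite /bump /flat !subr_gt0.
    by move/andP: xab => [-> ->]; rewrite !hornerC !mul1r.
  have L y : expR (- (c n / y)) @[n --> \oo] --> (1 : R).
    rewrite -expR0; apply: cvg_comp (_ : (fun n => - (c n / y)) @ \oo --> (0 : R)) _;
      last exact: continuous_expR.
    by rewrite -oppr0; apply: cvgN; rewrite -[X in _ --> X](mul0r y^-1); exact: cvgMl.
  by rewrite -[X in _ --> X]mul1r; exact: cvgM.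
- by apply: (integrable_abse hi').
- move=> n x _; rewrite normrM ler_piMl // ger0_norm ?bump_ge0 //.
  exact: bump_le1.
have -> : (fun n => Rintegral mu `]a, b[ (fun x => bump (c n) a b x * h x)) = fun=> 0.
  apply/funext => n; rewrite -(hG _ (test_fun_bump (c0 n) a0 b1)).
  rewrite /inner Rintegral_mkcond [RHS]Rintegral_mkcond.
  apply: eq_Rintegral => x _; rewrite !patchE.
  case: ifPn => [|xab]; first by rewrite !inE => /sub; rewrite -inE => ->.
  rewrite bump_out ?mul0r ?if_same //.
  by move: xab; rewrite notin_setE /= in_itv /= => /negP.
by move=> cv; apply/esym; apply: (cvg_unique (@Rhausdorff R) _ cv); exact: cvg_cst.
Qed.

Lemma ae_neq (a : R) : {ae mu, forall x, x <> a}.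
Proof.
exists [set a]; split; [exact: measurable_set1|exact: lebesgue_measure_set1|].
by move=> x /= /contrapT.
Qed.

(** By [orthogonal_bump_itv] the primitive [F] of the zero extension of [h] is constant on []0, 1[];
    by Lebesgue's differentiation theorem its derivative is [h] almost everywhere there. *)
Lemma orthogonal_test_fun_ae0 h : integ 0 1 h ->
  (forall G, test_fun G -> inner G h = 0) ->
  {ae mu, forall u : R, u \in `[0, 1] -> h u = 0}.
Proof.
move=> hi hG; pose k := h \_ `[0, 1].
have ki : mu.-integrable setT (EFin \o k).
  have : mu.-integrable setT ((EFin \o h) \_ `[0, 1]).
    by apply/(integrable_mkcond _ _).1.
  by rewrite restrict_EFin.
have kl : locally_integrable setT k.
  by apply: integrable_locally => //; exact: openT.
have kN y : mu.-integrable `]-oo, y] (EFin \o k) by exact: integrableS ki.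
pose F x : R := Rintegral mu `]-oo, x] k.
have FE : {ae mu, forall x, derivable F x 1 /\ derive1 F x = k x}.
  exact: FTC1Ny kN kl.
have Fc x y : 0 < x -> x <= y -> y < 1 -> F x = F y.
  move=> x0; rewrite le_eqVlt => /predU1P[-> //|xy] y1.
  apply/eqP; rewrite eq_sym -subr_eq0; apply/eqP.
  rewrite /F (@Rintegral_itvB R k -oo%O (BRight y) x) //; last by rewrite bnd_simp ltW.
  have kio : mu.-integrable `]x, y[ (EFin \o k) by exact: integrableS ki.
  rewrite -Rintegral_itv_bndo_bndc //.
  rewrite -(orthogonal_bump_itv hi x0 y1 hG).
  apply: eq_Rintegral => u; rewrite inE /= in_itv /= => /andP[xu uy].
  by rewrite /k patchE mem_set //= in_itv /= (ltW (lt_trans x0 xu)) (ltW (lt_trans uy y1)).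
have a0 := ae_neq 0; have a1 := ae_neq 1.
have aF := ae_filter_ringOfSetsType mu.
move: FE a0 a1; apply: filterS3 => x [dF Fx] xn0 xn1.
rewrite in_itv /= !le_eqVlt => /andP[/orP[/eqP /esym //|x0]] /orP[/eqP //|x1].
have kx : k x = h x by rewrite /k patchE mem_set //= in_itv /= (ltW x0) (ltW x1).
rewrite -kx -Fx derive1E.
have d0 : is_derive x 1 F 0.
  apply: near_eq_is_derive (is_derive_cst (F x) x (1 : R)).
  near=> y.
  have y0 : 0 < y by near: y; exact: lt_nbhsr.
  have y1 : y < 1 by near: y; exact: lt_nbhsl.
  by have [xy|/ltW yx] := leP x y; [exact: Fc|rewrite /cst; apply/esym; exact: Fc].
exact: derive_val.
Unshelve. all: by end_near. Qed.

End bump.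

(** * One-sided derivatives at the ends of a segment *)

Section derive_within.
Context {R : realType}.
Implicit Types (a b x d : R) (f g : R -> R).

(** Properness of the filter makes limits along it unique, so that [lim] in [derive_within] is the
    expected one-sided derivative at [a] and [b]. *)
Lemma within_dnbhs_proper a b x : a < b -> x \in `[a, b] ->
  ProperFilter (within `[a, b] x^').
Proof.
move=> ab; rewrite in_itv /= => /andP[ax xb]; apply: Build_ProperFilter_ex.
move=> P [e /= e0 He].
have [xlt|xge] := ltP x b.
- pose y := Num.min b (x + e / 2).
  have e2 : 0 < e / 2 by rewrite divr_gt0.
  have xy : x < y by rewrite lt_min xlt ltrDl.
  have yb : y <= b by rewrite ge_min lexx.
  exists y; apply: He; last 2 first.
  + by rewrite gt_eqF.
  + by rewrite /= in_itv /= yb (le_trans ax (ltW xy)).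
  rewrite /ball_ /= ltr0_norm ?subr_lt0 // opprB ltrBlDl.
  by apply: (@le_lt_trans _ _ (x + e / 2)); [rewrite ge_min lexx orbT|lra].
- have bx : x = b by apply/eqP; rewrite eq_le xb xge.
  pose y := Num.max a (x - e / 2).
  have e2 : 0 < e / 2 by rewrite divr_gt0.
  have yx : y < x by rewrite gt_max bx ab ltrBlDr ltrDl.
  have ay : a <= y by rewrite le_max lexx.
  exists y; apply: He; last 2 first.
  + by rewrite lt_eqF.
  + by rewrite /= in_itv /= ay (le_trans (ltW yx) xb).
  rewrite /ball_ /= gtr0_norm ?subr_gt0 //.
  suff : x - e / 2 <= y by lra.
  by rewrite le_max lexx orbT.
Qed.

(** Here [g] is differentiable at [x] in the two-sided sense while [f] agrees with it only on the
    segment. This is the situation of second derivatives: [du H] is known by a formula on [[0, 1]]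
    only. *)
Lemma derive_within_eq a b x f g d : a < b -> x \in `[a, b] ->
  (forall y, y \in `[a, b] -> f y = g y) -> is_derive x 1 g d ->
  derivable_within `[a, b] f x /\ derive_within `[a, b] f x = d.
Proof.
move=> ab xab fg; move=> /is_derive1_caratheodory [q [qE qc qx]].
have P := within_dnbhs_proper ab xab.
suff cv : (f y - f x) / (y - x) @[y --> within `[a, b] x^'] --> d.
  by split; [apply/cvg_ex; exists d|apply: cvg_lim].
have cq : q y @[y --> within `[a, b] x^'] --> d.
  rewrite -qx; apply: cvg_trans qc; apply: cvg_app => A xA.
  have H : nbhs x [set y | `[a, b]%classic y -> A y] by apply: filterS xA => y Ay _.
  exact: nbhs_dnbhs H.
apply: cvg_trans cq; apply: near_eq_cvg.
rewrite near_withinE; near=> y => yab.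
rewrite fg // fg // qE mulfK // subr_eq0; near: y.
exact: nbhs_dnbhs_neq.
Unshelve. all: by end_near. Qed.

Lemma derive_within_is_derive a b x f : a < x < b ->
  derivable_within `[a, b] f x -> is_derive x 1 f (derive_within `[a, b] f x).
Proof.
move=> /andP[ax xb]; rewrite /derivable_within => cv.
set d := derive_within _ _ _.
have {}cv : (f y - f x) / (y - x) @[y --> x^'] --> d.
  move: cv; rewrite /d /derive_within.
  suff -> : within `[a, b] x^' = x^' by [].
  apply/seteqP; split => A; rewrite /within /=; last by apply: filterS.
  move=> H; near=> y; apply: (near H) => //=.
  rewrite in_itv /=; apply/andP; split; near: y; apply: nbhs_dnbhs.
  - by apply: lt_le_nbhsr.
  - by apply: lt_le_nbhsl.
have H : h^-1 *: (f (h *: 1 + x) - f x) @[h --> 0^'] --> d.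
  have -> : (fun h : R => h^-1 *: (f (h *: 1 + x) - f x)) =
      (fun y => (f y - f x) / (y - x)) \o (fun h : R => h + x).
    apply/funext => h /=; rewrite addrK /GRing.scale /= mulr1 mulrC.
    by [].
  have sh : (fun h : R => h + x) h @[h --> 0^'] --> x^'.
    have := @continuous_injective_withinNx R R (fun h => h + x) 0.
    rewrite add0r; apply; first by apply: cvgD; [exact: cvg_id|exact: cvg_cst].
    by move=> y E; apply: (@addIr _ x); rewrite E add0r.
  exact: cvg_comp sh cv.
apply: DeriveDef; first by apply/cvg_ex; exists d; exact: H.
by apply: cvg_lim => //; exact: H.
Unshelve. all: by end_near. Qed.

End derive_within.

(** * Comparison of [sqint] with membership in L^2 *)

Section square_integrable_L2.
Context {R : realType}.
Local Notation mu := (@lebesgue_measure R).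
Local Notation integ a b f := (mu.-integrable [set` `[a, b]%R] (EFin \o f)).
Implicit Types f : R -> R.

Lemma L2_01_sqint f : L2_01 f -> sqint f.
Proof.
rewrite /L2_01 => fL; have f2 := Lfun2_integrable_sqr fL.
have mf : measurable_fun `[(0 : R), 1] f.
  by move: fL; rewrite inE => /andP[] /set_mem mf _; apply/measurable_restrictT.
have f2i : integ 0 1 (fun u => f u ^+ 2).
  apply/integrable_mkcond => //; rewrite restrict_EFin.
  apply: eq_integrable f2 => // x _ /=; congr (_%:E); rewrite !patchE.
  by case: ifP => //; rewrite expr0n.
split => //.
have i1 : integ 0 1 (fun u => 1 + f u ^+ 2).
  apply: integrable_itvD f2i; apply: within_continuous_integrable.
  exact: within_continuous_cst.
apply: le_integrable i1 => //; first exact/measurable_EFinP.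
move=> x _ /=; rewrite lee_fin [leRHS]ger0_norm ?addr_ge0 ?sqr_ge0 //.
by rewrite ler_norml; apply/andP; split; nra.
Qed.

Lemma sqint_L2_01 f : sqint f -> L2_01 f.
Proof.
move=> [fi f2i]; have mf : measurable_fun `[(0 : R), 1] f.
  by have /integrableP[/measurable_EFinP] := fi.
have mf' : measurable_fun setT (f \_ `[(0 : R), 1]).
  exact: (measurable_restrictT f (measurable_itv _)).1 mf.
rewrite /L2_01 inE; apply/andP; split; first exact: mem_set.
rewrite inE /= /finite_norm unlock; apply: poweR_lty.
have /integrableP[_] := f2i.
suff -> : (\int[mu]_x `|(EFin \o f \_ `[0%R, 1%R]) x| `^ 2 =
  \int[mu]_(x in `[0%R, 1%R]) `|(EFin \o (fun u => f u ^+ 2)%R) x|)%E by [].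
rewrite [RHS]integral_mkcond; apply: eq_integral => x _.
rewrite /= !patchE; case: ifP => _ /=.
  by rewrite powR_mulrn // real_normK ?num_real // ger0_norm ?sqr_ge0.
by rewrite normr0 powR0.
Qed.

Lemma bounded_sqint f (M : R) : measurable_fun `[(0 : R), 1] f ->
  (forall u, u \in `[0, 1] -> `|f u| <= M) -> sqint f.
Proof.
move=> mf fM.
have fin1 : (mu `[0%R, 1%R] < +oo)%E by rewrite lebesgue_measure_itv /= lte01 ltry.
split; apply: measurable_bounded_integrable => //.
- exists M; split; first by rewrite num_real.
  move=> N MN x /= x01; exact: le_trans (fM _ x01) (ltW MN).
- exact: measurable_funX.
- exists (M ^+ 2); split; first by rewrite num_real.
  move=> N MN x /= x01; apply: le_trans (ltW MN).
  by rewrite normrX lerXn2r ?nnegrE //; have := fM _ x01; [exact: le_trans|].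
Qed.

End square_integrable_L2.

(** * Uniqueness of weak solutions *)

Section uniqueness.
Context {R : realType} (T alpha : R).
Hypotheses (T_gt0 : 0 < T) (alpha_gt0 : 0 < alpha).
Local Notation mu := (@lebesgue_measure R).
Local Notation itg a b := (Rintegral mu [set` `[a, b]%R]).
Local Notation w := (robin_freq alpha).
Local Notation e := (robin_mode alpha).
Local Notation de := (robin_dmode alpha).
Local Notation coef := (coef alpha).

(* [H] solves the backward heat equation with the Robin conditions, so only the
   end-point terms of the weak formulation survive. *)
Let H k (s u : R) : R := expR (w k ^+ 2 * s) * e k u.

Let dexp k (s : R) : is_derive s 1 (fun s => expR (w k ^+ 2 * s))
  (w k ^+ 2 * expR (w k ^+ 2 * s)).
Proof.
have d : is_derive s 1 (fun s => w k ^+ 2 * s) (w k ^+ 2).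
  by have := is_deriveZ (w k ^+ 2) (is_derive_id s (1:R)); rewrite /GRing.scale /= mulr1.
have := @is_derive1_comp R expR (fun s => w k ^+ 2 * s) s _ _ (is_derive_expR _) d.
by rewrite mulrC.
Qed.

Let H_dt k (t u : R) : t \in `[0, T] ->
  derivable_within `[0, T] (H k ^~ u) t /\ dt T (H k) t u = w k ^+ 2 * H k t u.
Proof.
move=> t0T; apply: (derive_within_eq T_gt0 t0T (g := H k ^~ u)) => //.
rewrite /H; have -> : (fun s => expR (w k ^+ 2 * s) * e k u) =
    (e k u \*: (fun s => expR (w k ^+ 2 * s))).
  by apply/funext => x /=; rewrite /GRing.scale /= mulrC.
apply: is_derive_eq (is_deriveZ (e k u) (dexp k t)) _.
by rewrite /GRing.scale /=; ring.
Qed.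

Let H_du k (t u : R) : u \in `[0, 1] ->
  derivable_within `[0, 1] (H k t) u /\
  du (H k) t u = expR (w k ^+ 2 * t) * de k u.
Proof.
move=> u01; apply: (derive_within_eq ltr01 u01 (g := H k t)) => //.
exact: (is_deriveZ (expR (w k ^+ 2 * t)) (is_derive_mode alpha k u)).
Qed.

Let H_ddu k (t u : R) : u \in `[0, 1] ->
  derivable_within `[0, 1] (du (H k) t) u /\
  du (du (H k)) t u = - w k ^+ 2 * H k t u.
Proof.
move=> u01; apply: (derive_within_eq ltr01 u01
  (g := fun u => expR (w k ^+ 2 * t) * de k u)) => [y y01|].
  by have [_] := H_du k t y01.
apply: is_derive_eq (is_deriveZ (expR (w k ^+ 2 * t)) (is_derive_dmode alpha k u)) _.
by rewrite /GRing.scale /= /H; ring.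
Qed.

Lemma cont_on_prod (A B : set R) (F : R -> R -> R) (f g : R -> R) :
  (forall t u, A t -> B u -> F t u = f t * g u) -> continuous f ->
  continuous g -> cont_on A B F.
Proof.
move=> E cf cg; apply: (@subspace_eq_continuous _ _ _ (fun p : R * R => f p.1 * g p.2)).
  by move=> p /set_mem [Ap Bp]; rewrite /from_subspace /= E.
apply: continuous_subspaceT => p; apply: cvgM.
- by apply: (@continuous_comp _ _ _ (fst : R * R -> R) f); [exact: cvg_fst|exact: cf].
- by apply: (@continuous_comp _ _ _ (snd : R * R -> R) g); [exact: cvg_snd|exact: cg].
Qed.

Let H_C12 k : C12 T (H k).
Proof.
have cexp : continuous (fun s => expR (w k ^+ 2 * s)).
  exact: is_derive_continuous (dexp k).
have ce := @continuous_mode R alpha k.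
have cde := @continuous_dmode R alpha k.
split=> [t u tT u01|].
  by split; [case: (H_dt k u tT)|case: (H_du k t u01)|case: (H_ddu k t u01)].
split.
- by apply: (@cont_on_prod _ _ _ _ (e k)); [by []|exact: cexp|].
- apply: (@cont_on_prod _ _ _ (fun s => w k ^+ 2 * expR (w k ^+ 2 * s)) (e k)) => //.
    by move=> t u tT u01; have [_ ->] := H_dt k u tT; rewrite /H mulrA.
  exact: continuous_scale.
- apply: (@cont_on_prod _ _ _ (fun s => expR (w k ^+ 2 * s)) (de k)) => //.
  by move=> t u tT u01; have [_ ->] := H_du k t u01.
- apply: (@cont_on_prod _ _ _ (fun s => - w k ^+ 2 * expR (w k ^+ 2 * s)) (e k)) => //.
    by move=> t u tT u01; have [_ ->] := H_ddu k t u01; rewrite /H mulrA.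
  exact: continuous_scale.
Qed.

Lemma Robin_weak_sol_coef rho0 rho t k : t \in `[0, T] ->
  Robin_weak_sol T alpha rho0 rho ->
  expR (w k ^+ 2 * t) * coef (rho t) k = coef rho0 k.
Proof.
move=> tT [_ rhoL2 weak]; have := weak t (H k) tT (H_C12 k).
have sub s : 0 <= s <= t -> s \in `[0, T].
  move: tT; rewrite !in_itv /= => /andP[_ ?] /andP[-> ?] /=.
  by apply: le_trans; eassumption.
have u0 : (0:R) \in `[0, 1] by rewrite in_itv /= lexx ler01.
have u1 : (1:R) \in `[0, 1] by rewrite in_itv /= lexx ler01.
rewrite (@eq_itg _ _ _ _ (fun=> 0)); last first.
  move=> s st; transitivity (itg 0 1 (fun=> 0 : R)); last first.
    by rewrite itg_cst // mul0r.
  apply: eq_itg => u u01.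
  have [_ E1] := H_dt k u (sub s st).
  have u01' : u \in `[0, 1] by rewrite in_itv.
  have [_ E2] := H_ddu k s u01'.
  by rewrite /= E1 E2; ring.
have t0 : 0 <= t by move: tT; rewrite in_itv => /andP[].
rewrite itg_cst // mul0r subr0.
set B1 := itg 0 t _; set B2 := itg 0 t _.
(* By [mode_bc0] and [mode_bc1] the flux integrand and the jump integrand coincide pointwise,
   whatever the boundary values of the solution are. *)
have -> : B1 = B2.
  apply: eq_itg => s _; have [_ ->] := H_du k s u0; have [_ ->] := H_du k s u1.
  by rewrite /H mode_bc0 // mode_bc1 //; ring.
rewrite subrK => /eqP; rewrite subr_eq0 => /eqP E.
transitivity (inner (rho t) (H k t)).
  rewrite /inner -RintegralZl //.
    by apply: eq_itg => u _; rewrite /H; ring.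
  by apply: (sqint_mul (L2_01_sqint (rhoL2 t tT))); exact: within_continuous_mode.
rewrite E; apply: eq_itg => u _.
by rewrite /H mulr0 expR0 mul1r.
Qed.

(** Completeness of the modes: Parseval equates the inner products of [f] and [g] with every test
    function. *)
Lemma coef_eq_ae f g : sqint f -> sqint g ->
  (forall k, coef f k = coef g k) ->
  {ae mu, forall u : R, u \in `[0, 1] -> f u = g u}.
Proof.
move=> sf sg fg; have [fi _] := sf; have [gi _] := sg.
have aF := ae_filter_ringOfSetsType mu.
suff : {ae mu, forall u : R, u \in `[0, 1] -> f u - g u = 0}.
  by apply: filterS => u h u01; apply/eqP; rewrite -subr_eq0 h.
apply: orthogonal_test_fun_ae0; first exact: integrable_itvB.
move=> G [dG _ _].
have cG n : continuous (derive1n n G).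
  move=> x; apply: differentiable_continuous; exact/derivable1_diffP/dG.
have CG : C1on 0 1 G (derive1 G).
  apply: C1onT; last by have := cG 1%N; rewrite derive1n1.
  by move=> x; have := dG 0%N x; rewrite derive1n0 => d; apply: DeriveDef => //; rewrite derive1E.
have [cg _ _] := CG.
have Pf := parseval alpha_gt0 sf CG; have Pg := parseval alpha_gt0 sg CG.
have E : itg 0 1 (fun u => f u * G u) = itg 0 1 (fun u => g u * G u).
  apply: (cvg_unique (@Rhausdorff R) Pf).
  rewrite (_ : (fun k => coef f k * coef G k) = fun k => coef g k * coef G k) //.
  by apply/funext => k; rewrite fg.
transitivity (itg 0 1 (fun u => f u * G u - g u * G u)).
  by apply: eq_itg => u _; ring.
rewrite RintegralB //; [by rewrite E subrr|exact: sqint_mul|exact: sqint_mul].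
Qed.

Lemma Robin_weak_sol_unique rho0 rho rho' t :
  Robin_weak_sol T alpha rho0 rho -> Robin_weak_sol T alpha rho0 rho' ->
  t \in `[0, T] ->
  {ae mu, forall u : R, u \in `[0, 1] -> rho t u = rho' t u}.
Proof.
move=> S S' tT; have [_ L _] := S; have [_ L' _] := S'.
apply: coef_eq_ae => [||k]; [exact/L2_01_sqint/L|exact/L2_01_sqint/L'|].
apply: (@mulfI _ (expR (w k ^+ 2 * t))); first by rewrite gt_eqF // expR_gt0.
by rewrite (Robin_weak_sol_coef k tT S) (Robin_weak_sol_coef k tT S').
Qed.

End uniqueness.

(** * The mode series, its derivatives and its continuity at positive times *)

Section heat_series.
Context {R : realType} (alpha : R).
Hypothesis alpha_gt0 : 0 < alpha.
Local Notation mu := (@lebesgue_measure R).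
Local Notation itg a b := (Rintegral mu [set` `[a, b]%R]).
Local Notation wc a b f := ({within [set` `[a, b]%R], continuous f}).
Local Notation w := (robin_freq alpha).
Local Notation e := (robin_mode alpha).
Local Notation de := (robin_dmode alpha).
Local Notation coef := (coef alpha).
Local Notation comb := (comb alpha).
Local Notation dcomb := (dcomb alpha).

Lemma cvg_series_inv_sqr : cvgn (series (fun k => (k.+1%:R ^- 2 : R))).
Proof.
(* The increments [2/(k+1) - 2/(k+2) = 2/((k+1)(k+2))] dominate [1/(k+1)^2]. *)
pose v n : R := - (2 * n.+1%:R^-1).
have cv : cvgn (series (telescope v)).
  rewrite telescopeK; apply: is_cvgB; last exact: is_cvg_cst.
  apply: is_cvgN; apply: is_cvgMr; apply/cvg_ex; exists 0; exact: cvg_harmonic.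
apply: (series_le_cvg _ _ _ cv) => k.
- by rewrite invr_ge0 exprn_ge0.
- rewrite /telescope /v /= opprK addrC subr_ge0 ler_wpM2l //.
  by rewrite lef_pV2 ?posrE ?ltr0n // ler_nat.
have k1 : 0 < k.+1%:R :> R by rewrite ltr0n.
rewrite /telescope /v /= -[k.+2%:R]natr1.
have k10 : k.+1%:R <> 0 :> R by apply/eqP; rewrite gt_eqF.
have -> : - (2 * (k.+1%:R + 1)^-1) - - (2 * k.+1%:R^-1) =
    2 / (k.+1%:R * (k.+1%:R + 1)) :> R.
  by field; rewrite !gt_eqF // ltr_wpDr.
rewrite -[leLHS]mul1r ler_pdivrMr ?exprn_gt0 // mulrAC ler_pdivlMr; last first.
  by rewrite mulr_gt0 // ltr_wpDr.
rewrite mul1r expr2 mulrCA ler_wpM2l ?(ltW k1) //.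
have : 1 <= k.+1%:R :> R by rewrite ler1n.
by lra.
Qed.

Definition decay (t : R) k : R := expR (- (w k ^+ 2 * t)).

Lemma robin_freq_ge_nat k : k%:R <= w k.
Proof.
apply: le_trans (robin_freq_ge alpha_gt0 k).
rewrite ler_peMr ?ler0n //; have := pi_ge2 R; lra.
Qed.

Lemma robin_freq_sqr_ge k : k%:R <= w k ^+ 2.
Proof.
have := robin_freq_ge_nat k; case: k => [|k] h; first exact: sqr_ge0.
have k1 : 1 <= k.+1%:R :> R by rewrite ler1n.
by rewrite expr2; nra.
Qed.

Lemma decay_ge0 t k : 0 <= decay t k. Proof. exact: expR_ge0. Qed.

Lemma decay_le1 t k : 0 <= t -> decay t k <= 1.
Proof.
by move=> t0; rewrite -expR0 ler_expR oppr_le0 mulr_ge0 // sqr_ge0.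
Qed.

Lemma decay0 k : decay 0 k = 1.
Proof. by rewrite /decay mulr0 oppr0 expR0. Qed.

(** One half of the exponential absorbs the factor [1 + w^2], by [1 + y <= exp y] at
    [y = w^2 d / 2]; the other half is geometric in [k] because [w^2 >= k]. *)
Lemma decay_bound d t k : 0 < d -> d <= t ->
  (1 + w k ^+ 2) * decay t k <= (1 + 2 / d) * expR (- (d / 2)) ^+ k.
Proof.
move=> d0 dt; set W := w k ^+ 2.
have W0 : 0 <= W by exact: sqr_ge0.
have d2 : 0 < d / 2 by rewrite divr_gt0.
have Ek : expR (- (W * (d / 2))) <= expR (- (d / 2)) ^+ k.
  rewrite -expRM_natr ler_expR mulNr lerN2 mulrC ler_wpM2r ?(ltW d2) //.
  exact: robin_freq_sqr_ge.
have step : decay t k <= expR (- (W * (d / 2))) * expR (- (W * (d / 2))).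
  rewrite /decay -expRD ler_expR -opprD lerN2 -mulrDr -splitr.
  by rewrite ler_wpM2l.
have WE : (1 + W) * expR (- (W * (d / 2))) <= 1 + 2 / d.
  rewrite mulrDl mul1r; apply: lerD.
    by rewrite -[leRHS]expR0 ler_expR oppr_le0 mulr_ge0 // ltW.
  have := expR_ge1Dx (W * (d / 2)); rewrite expRN => h.
  rewrite ler_pdivrMr ?expR_gt0 //.
  apply: (@le_trans _ _ (2 / d * (1 + W * (d / 2)))); last first.
    by rewrite ler_wpM2l // divr_ge0 // ltW.
  have -> : 2 / d * (1 + W * (d / 2)) = 2 / d + W by field; rewrite gt_eqF.
  by rewrite lerDr divr_ge0 // ltW.
apply: (le_trans (ler_wpM2l _ step)); first by rewrite addr_ge0.
rewrite mulrA; apply: ler_pM => //.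
by rewrite mulr_ge0 ?expR_ge0 // addr_ge0.
Qed.

Section coefficients.
Variables (c : nat -> R) (C : R).
Hypothesis cC : forall k, `|c k| <= C.

Definition heat_coef (t : R) k : R := c k * decay t k.
Definition heat t u := limn (series (fun k => heat_coef t k * e k u)).
Definition dheat t u := limn (series (fun k => heat_coef t k * de k u)).
Definition ddheat t u :=
  limn (series (fun k => heat_coef t k * (- w k ^+ 2 * e k u))).

(** The weight [2 (1 + w^2)] bounds a mode and its first two derivatives, so this one geometric
    sequence dominates the series of [heat], [dheat] and [ddheat], uniformly for [t >= d]. *)
Definition majorant d k := C * 2 * ((1 + 2 / d) * expR (- (d / 2)) ^+ k).

Lemma cvg_majorant d : 0 < d -> cvgn (series (majorant d)).
Proof.
move=> d0.
have -> : majorant d = geometric (C * 2 * (1 + 2 / d)) (expR (- (d / 2))).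
  by apply/funext => k; rewrite /majorant /geometric /= mulrA.
apply: is_cvg_geometric_series; rewrite ger0_norm ?expR_ge0 //.
by rewrite -expR0 ltr_expR oppr_lt0 divr_gt0.
Qed.

Lemma heat_coef_bound d t k : 0 < d -> d <= t ->
  `|heat_coef t k| * (2 * (1 + w k ^+ 2)) <= majorant d k.
Proof.
move=> d0 dt; rewrite /heat_coef normrM (ger0_norm (decay_ge0 _ _)) /majorant.
have := decay_bound k d0 dt; move: (_ * _ ^+ k) => X h.
have -> : `|c k| * decay t k * (2 * (1 + w k ^+ 2)) =
   `|c k| * 2 * ((1 + w k ^+ 2) * decay t k) by ring.
apply: ler_pM => //.
- by rewrite mulr_ge0 ?decay_ge0 // addr_ge0 // sqr_ge0.
- by rewrite ler_wpM2r.
Qed.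

Lemma mode_weight k u : `|e k u| <= 2 * (1 + w k ^+ 2).
Proof.
have := mode_le2 alpha_gt0 k u; have := sqr_ge0 (w k).
by move: (w k ^+ 2) => W; lra.
Qed.

Lemma dmode_weight k u : `|de k u| <= 2 * (1 + w k ^+ 2).
Proof.
have := dmode_le2 alpha_gt0 k u; rewrite expr2; nra.
Qed.

Lemma ddmode_weight k u : `|- w k ^+ 2 * e k u| <= 2 * (1 + w k ^+ 2).
Proof.
rewrite normrM normrN (ger0_norm (sqr_ge0 _)).
have := mode_le2 alpha_gt0 k u; have := sqr_ge0 (w k).
by move: (w k ^+ 2) `|e k u| => W E; nra.
Qed.

Lemma heat_term_bound d t k x : 0 < d -> d <= t ->
  `|x| <= 2 * (1 + w k ^+ 2) -> `|heat_coef t k * x| <= majorant d k.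
Proof.
move=> d0 dt hx; apply: le_trans (heat_coef_bound k d0 dt).
by rewrite normrM ler_wpM2l.
Qed.

Lemma cvg_heat_series t (x : nat -> R) : 0 < t ->
  (forall k, `|x k| <= 2 * (1 + w k ^+ 2)) ->
  cvgn (series (fun k => heat_coef t k * x k)).
Proof.
move=> t0 hx; apply: dominated_series_cvg (cvg_majorant t0) => k.
exact: heat_term_bound.
Qed.

Lemma comb_series M (a : nat -> R) u :
  comb M a u = series (fun k => a k * e k u) M.
Proof. by rewrite seriesEord. Qed.

Lemma dcomb_series M (a : nat -> R) u :
  dcomb M a u = series (fun k => a k * de k u) M.
Proof. by rewrite seriesEord. Qed.

Lemma cvg_comb_heat t u : 0 < t ->
  comb M (heat_coef t) u @[M --> \oo] --> heat t u.
Proof.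
move=> t0; under eq_fun do rewrite comb_series.
by apply: cvg_heat_series => // k; exact: mode_weight.
Qed.

Lemma cvg_dcomb_dheat t u : 0 < t ->
  dcomb M (heat_coef t) u @[M --> \oo] --> dheat t u.
Proof.
move=> t0; under eq_fun do rewrite dcomb_series.
by apply: cvg_heat_series => // k; exact: dmode_weight.
Qed.

Lemma series_bounded_by_majorant d t (x : nat -> R) M : 0 < d -> d <= t ->
  (forall k, `|x k| <= 2 * (1 + w k ^+ 2)) ->
  `|series (fun k => heat_coef t k * x k) M| <= limn (series (majorant d)).
Proof.
move=> d0 dt hx.
have m0 k : 0 <= majorant d k.
  apply: le_trans (heat_coef_bound k d0 dt).
  by rewrite mulr_ge0 // mulr_ge0 // addr_ge0 // sqr_ge0.
apply: (@le_trans _ _ (series (majorant d) M)).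
  rewrite /series /=; apply: le_trans (ler_norm_sum _ _ _) _.
  by apply: ler_sum => k _; exact: heat_term_bound.
apply: (@nondecreasing_cvgn_le _ (series (majorant d))) => //; last exact: cvg_majorant.
by apply: nondecreasing_series => k _ _; exact: m0.
Qed.

Lemma comb_heat_bounded t u M : 0 < t ->
  `|comb M (heat_coef t) u| <= limn (series (majorant t)).
Proof.
move=> t0; rewrite comb_series; apply: series_bounded_by_majorant => // k.
exact: mode_weight.
Qed.

Lemma dcomb_heat_bounded t u M : 0 < t ->
  `|dcomb M (heat_coef t) u| <= limn (series (majorant t)).
Proof.
move=> t0; rewrite dcomb_series; apply: series_bounded_by_majorant => // k.
exact: dmode_weight.
Qed.

Lemma is_derive_heat_u t (u : R) : 0 < t ->
  is_derive u 1 (heat t) (dheat t u).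
Proof.
move=> t0; apply: (@is_derive_series _ (fun k u => heat_coef t k * e k u)
  (fun k u => heat_coef t k * de k u) (majorant t) u 1) => //.
- exact: cvg_majorant.
- move=> k y _; exact: (is_deriveZ (heat_coef t k) (is_derive_mode alpha k y)).
- by move=> k y _; apply: heat_term_bound => //; exact: dmode_weight.
- by move=> y _; apply: cvg_heat_series => // k; exact: mode_weight.
Qed.

Lemma is_derive_dheat_u t (u : R) : 0 < t ->
  is_derive u 1 (dheat t) (ddheat t u).
Proof.
move=> t0; apply: (@is_derive_series _ (fun k u => heat_coef t k * de k u)
  (fun k u => heat_coef t k * (- w k ^+ 2 * e k u)) (majorant t) u 1) => //.
- exact: cvg_majorant.
- move=> k y _; exact: (is_deriveZ (heat_coef t k) (is_derive_dmode alpha k y)).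
- by move=> k y _; apply: heat_term_bound => //; exact: ddmode_weight.
- by move=> y _; apply: cvg_heat_series => // k; exact: dmode_weight.
Qed.

Lemma is_derive_decay k (t : R) :
  is_derive t 1 (fun s => decay s k) (- w k ^+ 2 * decay t k).
Proof.
have d : is_derive t 1 (fun s => - w k ^+ 2 * s) (- w k ^+ 2).
  have := is_deriveZ (- w k ^+ 2) (is_derive_id t (1:R)).
  by rewrite /GRing.scale /= mulr1.
have := @is_derive1_comp R expR (fun s => - w k ^+ 2 * s) t _ _ (is_derive_expR _) d.
rewrite (_ : expR \o _ = fun s => decay s k); last first.
  by apply/funext => s; rewrite /= /decay mulNr.
by move=> H; apply: is_derive_eq H _; rewrite [LHS]mulrC /decay (mulNr _ t).
Qed.

(** The heat equation: the time derivative is the series [ddheat], which is also the second space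
    derivative. Working within distance [t / 2] of [t] keeps times away from 0, where the majorant
    blows up. *)
Lemma is_derive_heat_t (t u : R) : 0 < t ->
  is_derive t 1 (heat ^~ u) (ddheat t u).
Proof.
move=> t0; have t2 : 0 < t / 2 by rewrite divr_gt0.
have near_t y : `|y - t| < t / 2 -> t / 2 <= y.
  by rewrite ltr_norml => /andP[? _]; lra.
apply: (@is_derive_series _ (fun k s => heat_coef s k * e k u)
  (fun k s => heat_coef s k * (- w k ^+ 2 * e k u)) (majorant (t / 2)) t (t / 2)) => //.
- exact: cvg_majorant.
- move=> k y _; have := is_deriveZ (c k * e k u) (is_derive_decay k y).
  rewrite /GRing.scale /= /heat_coef => d.
  have -> : (fun s => c k * decay s k * e k u) =
      (c k * e k u \*: (fun s => decay s k)).
    by apply/funext => s /=; rewrite /GRing.scale /=; ring.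
  by apply: is_derive_eq d _; ring.
- move=> k y /near_t yt; apply: (heat_term_bound t2 yt); exact: ddmode_weight.
- move=> y /near_t yt; apply: cvg_heat_series => [|k]; last exact: mode_weight.
  exact: lt_le_trans t2 yt.
Qed.

Lemma continuous_heat t : 0 < t -> continuous (heat t).
Proof.
by move=> t0; apply: is_derive_continuous => u; exact: is_derive_heat_u.
Qed.

Lemma continuous_dheat t : 0 < t -> continuous (dheat t).
Proof.
by move=> t0; apply: is_derive_continuous => u; exact: is_derive_dheat_u.
Qed.

Lemma C1on_heat a b t : 0 < t -> C1on a b (heat t) (dheat t).
Proof.
move=> t0; apply: C1onT; last exact: continuous_dheat.
by move=> u; exact: is_derive_heat_u.
Qed.

Lemma heat_bc0 t : 0 < t -> dheat t 0 = alpha * (heat t 0 - heat t 1).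
Proof.
move=> t0; apply: (cvg_unique (@Rhausdorff R) (cvg_dcomb_dheat (u := 0) t0)).
have -> : (fun M => dcomb M (heat_coef t) 0) = fun M =>
    alpha * (comb M (heat_coef t) 0 - comb M (heat_coef t) 1).
  apply/funext => M; rewrite /dcomb /comb -sumrB mulr_sumr.
  by apply: eq_bigr => k _; rewrite mode_bc0 //; ring.
by apply: cvgMr; apply: cvgB; exact: cvg_comb_heat.
Qed.

Lemma heat_bc1 t : 0 < t -> dheat t 1 = alpha * (heat t 0 - heat t 1).
Proof.
move=> t0; apply: (cvg_unique (@Rhausdorff R) (cvg_dcomb_dheat (u := 1) t0)).
have -> : (fun M => dcomb M (heat_coef t) 1) = fun M =>
    alpha * (comb M (heat_coef t) 0 - comb M (heat_coef t) 1).
  apply/funext => M; rewrite /dcomb /comb -sumrB mulr_sumr.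
  by apply: eq_bigr => k _; rewrite mode_bc1 //; ring.
by apply: cvgMr; apply: cvgB; exact: cvg_comb_heat.
Qed.

Lemma cvg_itg01_bounded (f_ : nat -> R -> R) f (B : R) :
  (forall n, wc 0 1 (f_ n)) ->
  (forall u, 0 <= u <= 1 -> f_ n u @[n --> \oo] --> f u) ->
  (forall n u, 0 <= u <= 1 -> `|f_ n u| <= B) ->
  itg 0 1 (f_ n) @[n --> \oo] --> itg 0 1 f.
Proof.
move=> cf ff fB; apply: (@Rintegral_dominated_cvg _ _ _ mu `[(0:R), 1] f_ f (fun=> B) _ _ _ _ _).2.
- by [].
- by move=> n; have /integrableP[/measurable_EFinP] := within_continuous_integrable (cf n).
- by move=> x /=; rewrite in_itv /=; exact: ff.
- by apply: within_continuous_integrable; exact: within_continuous_cst.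
- by move=> n x /=; rewrite in_itv /=; exact: fB.
Qed.

Lemma cvg_inner_heat t (F : R -> R) : 0 < t -> wc 0 1 F ->
  series (fun k => heat_coef t k * coef F k) @ \oo -->
  itg 0 1 (fun u => heat t u * F u).
Proof.
move=> t0 cF; have [B FB] := within_continuous_bounded cF.
have -> : series (fun k => heat_coef t k * coef F k) =
    fun M => itg 0 1 (fun u => comb M (heat_coef t) u * F u).
  apply/funext => M; rewrite seriesEord /= -itg_comb; last exact: within_continuous_sqint.
  by apply: eq_itg => u _; rewrite mulrC.
apply: (@cvg_itg01_bounded _ _ (limn (series (majorant t)) * B)).
- by move=> M; apply: within_continuousM => //; exact: within_continuous_comb.
- by move=> u _; apply: cvgMl; exact: cvg_comb_heat.
- by move=> M u u01; rewrite normrM ler_pM // ?FB // comb_heat_bounded.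
Qed.

Lemma cvg_robin_form_heat t : 0 < t ->
  series (fun k => w k ^+ 2 * heat_coef t k ^+ 2) @ \oo -->
  robin_form alpha (heat t) (dheat t).
Proof.
move=> t0.
have -> : series (fun k => w k ^+ 2 * heat_coef t k ^+ 2) =
    fun M => robin_form alpha (comb M (heat_coef t)) (dcomb M (heat_coef t)).
  by apply/funext => M; rewrite seriesEord robin_form_comb.
apply: cvgD.
  apply: (@cvg_itg01_bounded _ _ (limn (series (majorant t)) ^+ 2)).
  - move=> M; apply: within_continuousX2.
    by have [] := C1on_comb alpha 0 1 M (heat_coef t).
  - by move=> u _; rewrite expr2; under eq_fun do rewrite expr2; apply: cvgM; exact: cvg_dcomb_dheat.
  - move=> M u u01; rewrite normrX lerXn2r ?nnegrE //; last exact: dcomb_heat_bounded.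
    by apply: le_trans (dcomb_heat_bounded 0 0 t0).
apply: cvgMr; rewrite expr2; under eq_fun do rewrite expr2.
by apply: cvgM; apply: cvgB; exact: cvg_comb_heat.
Qed.

(* Dominates both [|heat t - heat s|] and [|dheat t - dheat s|] uniformly in
   space. *)
Definition heat_gap (s t : R) :=
  limn (series (fun k => `|heat_coef t k - heat_coef s k| * (2 * (1 + w k ^+ 2)))).

Let gap_bound d s t k : 0 < d -> d <= s -> d <= t ->
  `|(`|heat_coef t k - heat_coef s k| * (2 * (1 + w k ^+ 2)))|
  <= 2 * majorant d k.
Proof.
move=> d0 ds dt; have W0 : 0 <= 2 * (1 + w k ^+ 2).
  by rewrite mulr_ge0 // addr_ge0 // sqr_ge0.
rewrite ger0_norm; last by rewrite mulr_ge0.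
have -> : 2 * majorant d k = majorant d k + majorant d k by ring.
apply: le_trans (lerD (heat_coef_bound k d0 dt) (heat_coef_bound k d0 ds)).
by rewrite -mulrDl ler_wpM2r // ler_normB.
Qed.

Let cvg_majorant2 d : 0 < d -> cvgn (series (fun k => 2 * majorant d k)).
Proof. by move=> d0; exact: is_cvg_seriesZ 2 (cvg_majorant d0). Qed.

Lemma cvg_heat_gap (s : R) : 0 < s -> heat_gap s t @[t --> s] --> 0.
Proof.
move=> s0; have s2 : 0 < s / 2 by rewrite divr_gt0.
have s2s : s / 2 <= s by lra.
have -> : 0 = limn (series (fun k : nat => 0 : R)).
  rewrite (_ : series _ = fun=> 0) ?lim_cst //.
  by apply/funext => n; rewrite /series /= big1.
apply: (@series_cvg_dominated _ _ (nbhs s) _ _ _ _ (cvg_majorant2 s2)).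
  near=> t => k; apply: gap_bound => //; apply: ltW.
  by near: t; apply: lt_nbhsr; lra.
move=> k; rewrite -[X in _ --> X](mul0r (2 * (1 + w k ^+ 2))); apply: cvgMl.
have -> : 0 = `|heat_coef s k - heat_coef s k| by rewrite subrr normr0.
apply: cvg_norm; apply: cvgB; last exact: cvg_cst.
apply: cvgMr; exact: (is_derive_continuous (is_derive_decay k)).
Unshelve. all: by end_near. Qed.

Let diff_le s t (x : nat -> R) : 0 < s -> 0 < t ->
  (forall k, `|x k| <= 2 * (1 + w k ^+ 2)) ->
  `|limn (series (fun k => heat_coef t k * x k)) -
    limn (series (fun k => heat_coef s k * x k))| <= heat_gap s t.
Proof.
move=> s0 t0 hx; rewrite -lim_seriesB; [|exact: cvg_heat_series..].
have d0 : 0 < Num.min s t by rewrite lt_min s0.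
have [ds dt] : Num.min s t <= s /\ Num.min s t <= t.
  by rewrite !ge_min !lexx orbT.
apply: dominated_series_le => [k|].
  rewrite /= fctE /=.
  by rewrite -mulrBl normrM ler_wpM2l.
apply: dominated_series_cvg (cvg_majorant2 d0) => k.
exact: gap_bound.
Qed.

Lemma heat_gap_u s t u : 0 < s -> 0 < t ->
  `|heat t u - heat s u| <= heat_gap s t.
Proof. by move=> s0 t0; apply: diff_le => // k; exact: mode_weight. Qed.

Lemma dheat_gap_u s t u : 0 < s -> 0 < t ->
  `|dheat t u - dheat s u| <= heat_gap s t.
Proof. by move=> s0 t0; apply: diff_le => // k; exact: dmode_weight. Qed.

End coefficients.
End heat_series.

(** * Weak derivatives, the H^1 norm and boundary values of regular functions *)

Section sobolev.
Context {R : realType}.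
Local Notation mu := (@lebesgue_measure R).
Local Notation itg a b := (Rintegral mu [set` `[a, b]%R]).
Local Notation wc a b f := ({within [set` `[a, b]%R], continuous f}).
Local Notation integ a b f := (mu.-integrable [set` `[a, b]%R] (EFin \o f)).
Implicit Types f g h p q z dz G : R -> R.

Lemma sqint_measurable f : sqint f -> measurable_fun `[(0 : R), 1] f.
Proof. by move=> [/integrableP[/measurable_EFinP]]. Qed.

Lemma ae_itg_sqr f g : sqint f -> sqint g ->
  {ae mu, forall u : R, u \in `[0, 1] -> f u = g u} ->
  itg 0 1 (fun u => f u * f u) = itg 0 1 (fun u => g u * g u).
Proof.
move=> /sqint_measurable mf /sqint_measurable mg fg; rewrite /Rintegral; congr fine.
apply: ae_eq_integral => //.
- by apply/measurable_EFinP; exact: measurable_funM.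
- by apply/measurable_EFinP; exact: measurable_funM.
have aF := ae_filter_ringOfSetsType mu.
by apply: filterS fg => u E u01; rewrite E.
Qed.

Lemma test_fun_vanish G (x : R) : test_fun G -> ~~ (0 < x < 1) -> G x = 0.
Proof.
move=> [_ _ sub] x01; apply/eqP; apply: contraNT x01 => Gx.
have : `]0, 1[%classic x by apply: sub; apply: subset_closure.
by rewrite /= in_itv.
Qed.

Lemma test_fun_C1 G a b : test_fun G -> C1on a b G (derive1 G).
Proof.
move=> [dG _ _].
have cG n : continuous (derive1n n G).
  move=> x; apply: differentiable_continuous; exact/derivable1_diffP/dG.
apply: C1onT; last by have := cG 1%N; rewrite derive1n1.
move=> x; have := dG 0%N x; rewrite derive1n0 => d.
by apply: DeriveDef => //; rewrite derive1E.
Qed.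

Lemma weak_deriv_ae_unique z p q : is_weak_deriv z p -> is_weak_deriv z q ->
  {ae mu, forall u : R, u \in `[0, 1] -> p u = q u}.
Proof.
move=> [/L2_01_sqint sp Hp] [/L2_01_sqint sq Hq].
have [pi _] := sp; have [qi _] := sq.
suff : {ae mu, forall u : R, u \in `[0, 1] -> p u - q u = 0}.
  have aF := ae_filter_ringOfSetsType mu.
  by apply: filterS => u h u01; apply/eqP; rewrite -subr_eq0 h.
apply: orthogonal_test_fun_ae0; first exact: integrable_itvB.
move=> G tG; have [cG _ _] := test_fun_C1 0 1 tG.
have I f : sqint f -> integ 0 1 (fun u => G u * f u).
  move=> sf; apply: eq_integrable (sqint_mul sf cG) => // u _ /=.
  by rewrite mulrC.
transitivity (inner G p - inner G q); last first.
  by have := Hp G tG; rewrite Hq // => /oppr_inj ->; rewrite subrr.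
rewrite /inner -RintegralB //; [|exact: I..].
by apply: eq_itg => u _; rewrite mulrBr.
Qed.

Lemma C1on_is_weak_deriv z dz : C1on 0 1 z dz -> is_weak_deriv z dz.
Proof.
move=> Cz; have [cz cdz _] := Cz.
split; first exact/sqint_L2_01/within_continuous_sqint.
move=> G tG; have CG := test_fun_C1 0 1 tG; have [cG cdG _] := CG.
have G0 : G 0 = 0 by apply: test_fun_vanish; rewrite // ltxx.
have G1 : G 1 = 0 by apply: test_fun_vanish; rewrite // ltxx andbF.
transitivity (itg 0 1 (fun u => z u * derive1 G u)).
  by apply: eq_itg => u _; rewrite mulrC.
rewrite (C1on_parts ler01 Cz CG) G0 G1 !mulr0 subr0 sub0r; congr (- _).
by apply: eq_itg => u _; rewrite mulrC.
Qed.

Lemma C1on_H1 z dz : C1on 0 1 z dz -> H1 z.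
Proof.
move=> Cz; have [cz cdz _] := Cz; split; last by exists dz; exact: C1on_is_weak_deriv.
apply: open_integrable_locally; first exact: interval_open.
apply: integrableS (within_continuous_integrable cz) => //.
exact: subset_itv_oo_cc.
Qed.

(** [weak_deriv] is an arbitrary choice, but weak derivatives are unique almost everywhere, so it
    may be replaced by the classical derivative under the integral. *)
Lemma C1on_H1norm z dz : C1on 0 1 z dz ->
  H1norm z ^+ 2 = itg 0 1 (fun u => z u ^+ 2) + itg 0 1 (fun u => dz u ^+ 2).
Proof.
move=> Cz; have [cz cdz _] := Cz.
have W := C1on_is_weak_deriv Cz.
have W' : is_weak_deriv z (weak_deriv z).
  by rewrite /weak_deriv; apply: getPex; exists dz.
have [/L2_01_sqint s1 _] := W; have [/L2_01_sqint s2 _] := W'.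
rewrite /H1norm (_ : inner (weak_deriv z) (weak_deriv z) = inner dz dz); last first.
  by apply: ae_itg_sqr => //; exact: weak_deriv_ae_unique W' W.
rewrite sqr_sqrtr; last first.
  by apply: addr_ge0; apply: itg_ge0 => u _; rewrite -expr2 sqr_ge0.
by congr (_ + _); apply: eq_itg => u _; rewrite expr2.
Qed.

(** If [(f - g)^2] were positive at a point it would exceed half that value on a segment of positive
    length, and its integral could not be 0. *)
Lemma within_continuous_ae_eq f g : wc 0 1 f -> wc 0 1 g ->
  {ae mu, forall u : R, u \in `[0, 1] -> f u = g u} ->
  forall u, 0 <= u <= 1 -> f u = g u.
Proof.
move=> cf cg fg.
pose D u := (f u - g u) ^+ 2.
have cD : wc 0 1 D by apply: within_continuousX2; exact: within_continuousB.
have D0 : itg 0 1 D = 0.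
  rewrite /Rintegral (_ : (\int[mu]_(x in `[0%R, 1%R]) (D x)%:E = 0)%E) //.
  rewrite (@ae_eq_integral _ _ _ mu `[0%R, 1%R] (fun=> 0%E)) ?integral0 //.
  - by have /integrableP[] := within_continuous_integrable cD.
  - have aF := ae_filter_ringOfSetsType mu.
    by apply: filterS fg => u E u01; rewrite /D E // subrr expr0n.
move=> u u01; apply/eqP; rewrite -subr_eq0; apply/negPn/negP => n0.
have Du : 0 < D u by rewrite /D exprn_even_gt0.
have Dge v : 0 <= D v by exact: sqr_ge0.
have /subspace_continuousP /(_ u) cDu := cD.
have {}cDu : D x @[x --> within `[0, 1] (nbhs u)] --> D u by apply: cDu; rewrite /= in_itv.
have /cvgrPdist_lt /(_ _ (divr_gt0 Du (ltr0n R 2))) := cDu.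
rewrite near_withinE => -[r /= r0 Hr].
(* The radius [r / 2] keeps [[a, b]] inside the ball, and clipping to [[0, 1]] leaves a positive
   length even if [u] is an end point. *)
pose a := Num.max 0 (u - r / 2); pose b := Num.min 1 (u + r / 2).
have /andP[u0 u1] := u01.
have ab : a < b.
  by rewrite lt_min !gt_max; apply/andP; split; apply/andP; split; lra.
have a0 : 0 <= a by rewrite le_max lexx.
have b1 : b <= 1 by rewrite ge_min lexx.
have au : u - r / 2 <= a by rewrite le_max lexx orbT.
have bu : b <= u + r / 2 by rewrite ge_min lexx orbT.
have Dab v : a <= v <= b -> D u / 2 <= D v.
  move=> /andP[av vb]; have : ball_ [eta Num.Def.normr] u r v.
    by rewrite /ball_ /= ltr_norml; apply/andP; split; lra.
  move=> /Hr /=; rewrite in_itv /= => /(_ _); rewrite ltr_norml.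
  have -> : 0 <= v <= 1 by apply/andP; split; lra.
  by move=> /(_ isT) /andP[_ ?]; lra.
have iD := within_continuous_integrable cD.
have E1 := itg_split (le_trans a0 (ltW ab)) b1 iD.
have iDb : integ 0 b D by apply: integrable_itvS iD.
have E2 := itg_split a0 (ltW ab) iDb.
have P1 : 0 <= itg 0 a D by apply: itg_ge0.
have P2 : 0 <= itg b 1 D by apply: itg_ge0.
have P3 : D u / 2 * (b - a) <= itg a b D.
  rewrite -itg_cst ?(ltW ab) //; apply: itg_le => //; first exact: within_continuous_cst.
  exact: within_continuousS cD.
have : 0 < D u / 2 * (b - a) by rewrite mulr_gt0 ?divr_gt0 // subr_gt0.
by move: E1 E2 D0; lra.
Qed.

Lemma bval_continuous f x : wc 0 1 f -> 0 <= x <= 1 -> bval f x = f x.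
Proof.
move=> cf x01; have aF := ae_filter_ringOfSetsType mu.
have [cg fg] : is_cont_rep f (get (is_cont_rep f)).
  by apply: getPex; exists f; split => //; exact: aeW.
by apply/esym; exact: within_continuous_ae_eq cf cg fg _ x01.
Qed.

End sobolev.

(** * The candidate solution and its membership in L^2(0, T; H^1) *)

Section solution.
Context {R : realType} (alpha : R).
Hypothesis alpha_gt0 : 0 < alpha.
Local Notation mu := (@lebesgue_measure R).
Local Notation itg a b := (Rintegral mu [set` `[a, b]%R]).
Local Notation integ a b f := (mu.-integrable [set` `[a, b]%R] (EFin \o f)).
Local Notation w := (robin_freq alpha).
Local Notation coef := (coef alpha).
Local Notation comb := (comb alpha).
Variable f : R -> R.
Hypothesis sf : sqint f.
Local Notation c := (coef f).
Local Notation "'|f|^2'" := (itg 0 1 (fun u => f u ^+ 2)).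

Lemma sqr_norm_ge0 : 0 <= |f|^2.
Proof. by apply: itg_ge0 => u _; exact: sqr_ge0. Qed.

(** Bessel's inequality gives [c^2 <= |f|^2], and [|c| <= c^2 + 1] avoids a square root. *)
Lemma coef_bound k : `|c k| <= |f|^2 + 1.
Proof.
have B : c k ^+ 2 <= |f|^2.
  apply: le_trans (bessel alpha_gt0 k.+1 sf); rewrite big_ord_recr /= lerDr.
  by apply: sumr_ge0 => i _; exact: sqr_ge0.
have := sqr_norm_ge0; move: |f|^2 B => F B F0.
by rewrite ler_norml; apply/andP; split; nra.
Qed.

Local Notation heat := (heat alpha c).
Local Notation dheat := (dheat alpha c).
Local Notation heat_coef := (heat_coef alpha c).

Lemma itg_heat_sqr_le t : 0 < t -> itg 0 1 (fun u => heat t u ^+ 2) <= |f|^2.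
Proof.
move=> t0; have cv : itg 0 1 (fun u => comb M (heat_coef t) u ^+ 2) @[M --> \oo]
    --> itg 0 1 (fun u => heat t u ^+ 2).
  apply: (@cvg_itg01_bounded _ _ _ (limn (series (majorant (|f|^2 + 1) t)) ^+ 2)).
  - by move=> M; apply: within_continuousX2; exact: within_continuous_comb.
  - move=> u _; rewrite expr2; under eq_fun do rewrite expr2.
    by apply: cvgM; apply: (cvg_comb_heat alpha_gt0 coef_bound).
  - move=> M u u01; rewrite normrX lerXn2r ?nnegrE //;
      last exact: (comb_heat_bounded alpha_gt0 coef_bound).
    by apply: le_trans (comb_heat_bounded alpha_gt0 coef_bound 0 0 t0).
rewrite -(cvg_lim (@Rhausdorff R) cv); apply: limr_le.
  by apply/cvg_ex; eexists; exact: cv.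
apply: nearW => M; rewrite itg_comb2 //; apply: le_trans (bessel alpha_gt0 M sf).
apply: ler_sum => k _; rewrite /heat_coef exprMn ler_piMr ?sqr_ge0 //.
by rewrite expr_le1 ?decay_ge0 // decay_le1 // ltW.
Qed.

Lemma integral_decay (k : nat) (t : R) : 0 <= t ->
  w k ^+ 2 * itg 0 t (fun s => decay alpha s k) = 1 - decay alpha t k.
Proof.
move=> t0; pose F s := - decay alpha s k.
have CF : C1on 0 t F (fun s => w k ^+ 2 * decay alpha s k).
  apply: C1onT => [s|].
    apply: is_derive_eq (is_deriveN (is_derive_decay alpha k s)) _; ring.
  by apply: continuous_scale; exact: is_derive_continuous (is_derive_decay alpha k).
have := C1on_FTC t0 CF; rewrite itgZ; last first.
  by apply: within_continuousT; exact: is_derive_continuous (is_derive_decay alpha k).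
by move=> ->; rewrite /F decay0 opprK addrC.
Qed.

Lemma continuous_decay k : continuous (fun s => decay alpha s k).
Proof. exact: is_derive_continuous (is_derive_decay alpha k). Qed.

Lemma integral_decay_sqr (k : nat) (t : R) : 0 <= t ->
  itg 0 t (fun s => w k ^+ 2 * heat_coef s k ^+ 2) <= c k ^+ 2 / 2.
Proof.
move=> t0; pose F s := - (c k ^+ 2 / 2) * (decay alpha s k * decay alpha s k).
have CF : C1on 0 t F (fun s => w k ^+ 2 * heat_coef s k ^+ 2).
  apply: C1onT => [s|].
    have d := is_derive_decay alpha k s.
    apply: is_derive_eq (is_deriveZ (- (c k ^+ 2 / 2)) (is_deriveM d d)) _.
    by rewrite /GRing.scale /= /heat_coef; field.
  apply: continuous_scale; rewrite /heat_coef; under eq_fun do rewrite expr2.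
  by apply: continuous_mul; apply: continuous_scale; exact: continuous_decay.
rewrite (C1on_FTC t0 CF) /F decay0 mulr1 mulr1.
have : 0 <= c k ^+ 2 / 2 * (decay alpha t k * decay alpha t k).
  by rewrite mulr_ge0 ?divr_ge0 ?sqr_ge0 // mulr_ge0 // decay_ge0.
by rewrite mulNr; lra.
Qed.

Lemma measurable_robin_form_heat (T : R) :
  measurable_fun `]0, T] (fun s => robin_form alpha (heat s) (dheat s)).
Proof.
apply: (@measurable_fun_cvg _ _ _ _
  (fun M s => series (fun k => w k ^+ 2 * heat_coef s k ^+ 2) M)).
  move=> M; apply: measurable_funTS; apply: continuous_measurable_fun.
  have -> : (fun s => series (fun k => w k ^+ 2 * heat_coef s k ^+ 2) M) =
      fun s => \sum_(0 <= k < M) (w k ^+ 2 * c k ^+ 2) * (decay alpha s k * decay alpha s k).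
    apply/funext => s; rewrite /series /=; apply: eq_bigr => k _.
    by rewrite /heat_coef; ring.
  move=> s; apply: cvg_big => [|k _]; first exact: add_continuous.
  apply: cvgMr; apply: cvgM; exact: continuous_decay.
move=> s /=; rewrite in_itv /= => /andP[s0 _].
exact: cvg_robin_form_heat coef_bound _ s0.
Qed.

(** The dissipation estimate. The terms are nonnegative, so the sum and the time integral commute;
    mode [k] contributes at most [c_k^2 / 2], and Bessel's inequality sums these to a bound free of
    [T] and [alpha]. *)
Lemma integral_robin_form_heat (T : R) : 0 <= T ->
  (\int[mu]_(s in `]0%R, T]) (robin_form alpha (heat s) (dheat s))%:E <=
   (|f|^2 / 2)%:E)%E.
Proof.
move=> T0; pose g k s : \bar R := (w k ^+ 2 * heat_coef s k ^+ 2)%:E.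
have g0 k s : (0 <= g k s)%E by rewrite lee_fin mulr_ge0 ?sqr_ge0.
have cg k : continuous (fun s => w k ^+ 2 * heat_coef s k ^+ 2).
  apply: continuous_scale; rewrite /heat_coef; under eq_fun do rewrite expr2.
  by apply: continuous_mul; apply: continuous_scale; exact: continuous_decay.
have mg k : measurable_fun `]0, T] (g k).
  apply/measurable_EFinP; apply: measurable_funTS.
  exact: continuous_measurable_fun (cg k).
have -> : (\int[mu]_(s in `]0%R, T]) (robin_form alpha (heat s) (dheat s))%:E =
    \int[mu]_(s in `]0%R, T]) (\sum_(0 <= k <oo) g k s))%E.
  apply: eq_integral => s; rewrite inE /= in_itv /= => /andP[s0 _].
  have cv := cvg_robin_form_heat alpha_gt0 coef_bound s0.
  apply/esym/cvg_lim => //.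
  have -> : (fun n => \sum_(0 <= k < n) g k s)%E = EFin \o
      series (fun k => w k ^+ 2 * heat_coef s k ^+ 2).
    by apply/funext => n; rewrite /= /series /= sumEFin.
  by apply: cvg_EFin; [exact: nearW|exact: cv].
rewrite integral_nneseries //.
apply: lime_le; first by apply: is_cvg_nneseries => k _ _; apply: integral_ge0 => s _.
apply: nearW => M.
have gle k : (\int[mu]_(s in `]0%R, T]) g k s <= (c k ^+ 2 / 2)%:E)%E.
  rewrite integral_itv_obnd_cbnd //.
  have ig : integ 0 T (fun s => w k ^+ 2 * heat_coef s k ^+ 2).
    by apply: within_continuous_integrable; apply: within_continuousT; exact: cg.
  rewrite -[X in (X <= _)%E]fineK; last exact: integrable_fin_num.
  by rewrite lee_fin; exact: integral_decay_sqr.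
apply: (@le_trans _ _ (\sum_(0 <= k < M) (c k ^+ 2 / 2)%:E)%E).
  by apply: lee_sum => k _.
rewrite sumEFin lee_fin -mulr_suml ler_wpM2r ?invr_ge0 //.
by rewrite big_mkord; exact: bessel.
Qed.

(** The mode series need not converge pointwise to [f] at time 0, so the datum is inserted by hand
    there. *)
Definition robin_sol (t u : R) : R := if 0 < t then heat t u else f u.

Lemma robin_solE t : 0 < t -> robin_sol t = heat t.
Proof. by move=> t0; apply/funext => u; rewrite /robin_sol t0. Qed.

Let C1h a b t (t0 : 0 < t) := C1on_heat alpha_gt0 coef_bound a b t0.

(** Continuity of the time slices in H^1, which makes preimages of H^1-open sets open in []0,
    +oo[]. *)
Lemma cvg_H1norm_heat t : 0 < t ->
  H1norm (heat s \- heat t) @[s --> t] --> 0.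
Proof.
move=> t0; apply/cvgr0Pnorm_lt => eps eps0.
have gap := cvg_heat_gap alpha_gt0 coef_bound t0.
have e2 : 0 < eps / 2 by rewrite divr_gt0.
have /cvgr0Pnorm_lt /(_ _ e2) gap' := gap.
near=> s.
have s0 : 0 < s by near: s; exact: lt_nbhsr.
have gs : `|heat_gap alpha c t s| < eps / 2 by near: s.
set d := heat_gap alpha c t s in gs.
have CD := C1onB (C1h 0 1 s0) (C1h 0 1 t0); have [cD cdD _] := CD.
have HN := C1on_H1norm CD.
(* Each of the two integrals is at most [eps^2 / 4], and their sum [eps^2 / 2] is below [eps^2]. *)
have sq x : `|x| <= d -> x ^+ 2 <= eps ^+ 2 / 4.
  move=> xd; have : `|x| < eps / 2.
    by apply: le_lt_trans xd _; apply: le_lt_trans (ler_norm _) gs.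
  by rewrite ltr_norml => /andP[? ?]; nra.
have B1 : itg 0 1 (fun u => (heat s u - heat t u) ^+ 2) <= eps ^+ 2 / 4.
  rewrite -[leRHS]mulr1 -[X in _ * X](subr0 (1:R)) -itg_cst //; apply: itg_le.
  - exact: within_continuousX2.
  - exact: within_continuous_cst.
  - by move=> u _; apply: sq; exact: (heat_gap_u alpha_gt0 coef_bound u t0 s0).
have B2 : itg 0 1 (fun u => (dheat s u - dheat t u) ^+ 2) <= eps ^+ 2 / 4.
  rewrite -[leRHS]mulr1 -[X in _ * X](subr0 (1:R)) -itg_cst //; apply: itg_le.
  - exact: within_continuousX2.
  - exact: within_continuous_cst.
  - by move=> u _; apply: sq; exact: (dheat_gap_u alpha_gt0 coef_bound u t0 s0).
rewrite ger0_norm ?sqrtr_ge0 // -(ltr_pXn2r (n := 2)) ?nnegrE ?sqrtr_ge0 ?(ltW eps0) //.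
rewrite HN; apply: (le_lt_trans (lerD B1 B2)).
have : 0 < eps ^+ 2 by rewrite exprn_gt0.
by lra.
Unshelve. all: by end_near. Qed.

Lemma robin_sol_L2H1 (T : R) : 0 < T -> L2H1 T robin_sol.
Proof.
(* The null set consists of time 0, where the slice is [f], which may fail to lie in H^1. *)
move=> T0; exists [set 0]; set D := _ `\` _.
have DE : D = `]0, T]%classic.
  apply/seteqP; split => t; rewrite /D /= !in_itv /=.
    by move=> [/andP[t0 tT] /eqP tn0]; rewrite lt_neqAle eq_sym tn0 t0 tT.
  by move=> /andP[t0 tT]; rewrite (ltW t0) tT; split => //; apply/eqP; rewrite gt_eqF.
have Dpos t : D t -> 0 < t by rewrite DE /= in_itv /= => /andP[].
split.
- exact: measurable_set1.
- exact: lebesgue_measure_set1.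
- move=> t /Dpos t0; rewrite robin_solE //; exact: C1on_H1 (C1h 0 1 t0).
- move=> U [_ oU].
  pose S := [set t : R | 0 < t /\ U (heat t)].
  have oS : open S.
    rewrite openE => t [t0 /oU [r r0 Hr]].
    have /cvgr0Pnorm_lt /(_ _ r0) near_t := cvg_H1norm_heat t0.
    rewrite /interior; near=> s.
    have s0 : 0 < s by near: s; exact: lt_nbhsr.
    split => //; apply: Hr; first exact: C1on_H1 (C1h 0 1 s0).
    by apply: le_lt_trans (ler_norm _) _; near: s.
  have -> : D `&` robin_sol @^-1` U = D `&` S.
    apply/seteqP; split => t [Dt]; have t0 := Dpos _ Dt; rewrite /= robin_solE //.
    by move=> [].
  by apply: measurableI; [rewrite DE|exact: open_measurable].
rewrite DE.
pose q s := robin_form alpha (heat s) (dheat s).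
have E : forall s, `]0, T]%classic s -> H1norm (robin_sol s) ^+ 2 =
    itg 0 1 (fun u => heat s u ^+ 2) + itg 0 1 (fun u => dheat s u ^+ 2).
  move=> s /=; rewrite in_itv /= => /andP[s0 _].
  by rewrite robin_solE // (C1on_H1norm (C1h 0 1 s0)).
(* Adding the nonnegative jump term completes the gradient part to the Robin form, whose time
   integral is controlled. *)
have H1le s : `]0, T]%classic s -> H1norm (robin_sol s) ^+ 2 <= |f|^2 + q s.
  move=> /[dup] sT; rewrite /= in_itv /= => /andP[s0 _]; rewrite E //.
  apply: lerD; first exact: itg_heat_sqr_le.
  by rewrite /q /robin_form lerDl mulr_ge0 ?sqr_ge0 // ltW.
apply: (@le_lt_trans _ _ (\int[mu]_(s in `]0%R, T]) (|f|^2 + q s)%:E)%E).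
  apply: ge0_le_integral => //.
  - by move=> s _; rewrite lee_fin sqr_ge0.
  - have gapc (h : R -> R -> R) :
       (forall s t, 0 < s -> 0 < t -> forall u, `|h t u - h s u| <= heat_gap alpha c s t) ->
       (forall t, 0 < t -> continuous (h t)) ->
       measurable_fun `]0, T] (fun s => itg 0 1 (fun u => h s u ^+ 2)).
      move=> hgap hc.
      suff : measurable_fun `](0 : R), +oo[ (fun s => itg 0 1 (fun u => h s u ^+ 2)).
        move=> H; refine (measurable_funS _ _ H); first exact: measurable_itv.
        by move=> s /=; rewrite !in_itv /= andbT => /andP[].
      apply: open_continuous_measurable_fun; first exact: interval_open.
      move=> s; rewrite inE /= in_itv /= andbT => s0.
      have [B hB] := within_continuous_bounded (within_continuousT (a := 0) (b := 1) (hc s s0)).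
      have B0 : 0 <= B by apply: le_trans (hB 0 _); rewrite ?normr_ge0 // lexx ler01.
      apply/cvgrPdist_le => eps eps0.
      have gap := cvg_heat_gap alpha_gt0 coef_bound s0.
      (* A gap below 1 bounds the sum of the two slices by [2 B + 1]; a gap below the quotient then
         makes the difference of squares at most [eps]. *)
      have e1 : 0 < Num.min 1 (eps / (2 * B + 1)).
        by rewrite lt_min ltr01 divr_gt0 // ltr_wpDl // mulr_ge0.
      have /cvgr0Pnorm_lt /(_ _ e1) gap' := gap.
      near=> t.
      have t0 : 0 < t by near: t; exact: lt_nbhsr.
      have : `|heat_gap alpha c s t| < Num.min 1 (eps / (2 * B + 1)) by near: t.
      rewrite lt_min => /andP[g1 g2].
      have cht := within_continuousT (a := 0) (b := 1) (hc t t0).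
      have chs := within_continuousT (a := 0) (b := 1) (hc s s0).
      rewrite -itgB; try exact: within_continuousX2.
      apply: (@le_trans _ _ (eps * (1 - 0))); last by rewrite subr0 mulr1.
      apply: normr_itg_le => //.
        by apply: within_continuousB; exact: within_continuousX2.
      move=> u u01; rewrite -opprB normrN subr_sqr normrM.
      have hd := hgap s t s0 t0 u.
      have hd2 : `|h t u - h s u| <= eps / (2 * B + 1).
        by apply: le_trans hd (le_trans (ler_norm _) (ltW g2)).
      have hd3 : `|h t u - h s u| <= 1.
        by apply: le_trans hd (le_trans (ler_norm _) (ltW g1)).
      have hs : `|h t u + h s u| <= 2 * B + 1.
        have -> : h t u + h s u = (h t u - h s u) + 2 * h s u by ring.
        apply: le_trans (ler_normD _ _) _; rewrite addrC; apply: lerD => //.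
        by rewrite normrM ger0_norm // ler_wpM2l // hB.
      apply: (le_trans (ler_pM _ _ hd2 hs)) => //.
      by rewrite divfK // gt_eqF // ltr_wpDl // mulr_ge0.
    apply/measurable_EFinP.
    apply: (eq_measurable_fun (fun s => itg 0 1 (fun u => heat s u ^+ 2) +
       itg 0 1 (fun u => dheat s u ^+ 2))) => [s|].
      by rewrite inE => /E ->.
    apply: measurable_funD; apply: gapc.
    + by move=> s t s0 t0 u; exact: (heat_gap_u alpha_gt0 coef_bound u s0 t0).
    + by move=> t t0; exact: (continuous_heat alpha_gt0 coef_bound t0).
    + by move=> s t s0 t0 u; exact: (dheat_gap_u alpha_gt0 coef_bound u s0 t0).
    + by move=> t t0; exact: (continuous_dheat alpha_gt0 coef_bound t0).
  - apply/measurable_EFinP; apply: measurable_funD => //.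
    exact: measurable_robin_form_heat.
under eq_integral do rewrite EFinD.
rewrite ge0_integralD //; last 3 first.
- by move=> s _; rewrite lee_fin sqr_norm_ge0.
- by move=> s _; rewrite lee_fin robin_form_ge0.
- by apply/measurable_EFinP; exact: measurable_robin_form_heat.
apply: lte_add_pinfty.
  rewrite integral_cst //= lebesgue_measure_itv /= lte_fin T0 -EFinD -EFinM.
  exact: ltry.
by apply: le_lt_trans (integral_robin_form_heat (ltW T0)) _; exact: ltry.
Unshelve. all: by end_near. Qed.

End solution.

(** * Integrals depending on a time parameter *)

Section parametric_integrals.
Context {R : realType}.
Local Notation mu := (@lebesgue_measure R).
Local Notation itg a b := (Rintegral mu [set` `[a, b]%R]).
Local Notation wc a b f := ({within [set` `[a, b]%R], continuous f}).
Implicit Types (A B : set R) (F : R -> R -> R) (g : R -> R).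

Lemma cont_on_row A B F t : cont_on A B F -> A t -> {within B, continuous (F t)}.
Proof.
move=> /subspace_continuousP cF At; apply/subspace_continuousP => u Bu.
have := cF (t, u) (conj At Bu) => /= cv.
apply: (cvg_comp (fun v => (t, v)) _ _ cv) => Q [[P1 P2] [/= h1 h2] sub].
rewrite /within /=; apply: filterS h2 => v Pv Bv; apply: (sub (t, v)) => //.
by split => //=; exact: nbhs_singleton.
Qed.

Lemma cont_on_col A B F u : cont_on A B F -> B u ->
  {within A, continuous (F ^~ u)}.
Proof.
move=> /subspace_continuousP cF Bu; apply/subspace_continuousP => t At.
have := cF (t, u) (conj At Bu) => /= cv.
apply: (cvg_comp (fun s => (s, u)) _ _ cv) => Q [[P1 P2] [/= h1 h2] sub].
rewrite /within /=; apply: filterS h1 => s Ps As; apply: (sub (s, u)) => //.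
by split => //=; exact: nbhs_singleton.
Qed.

Lemma cont_on_bounded a b c d F : a <= b -> c <= d -> cont_on `[a, b] `[c, d] F ->
  exists2 M, 0 <= M & forall t u, a <= t <= b -> c <= u <= d -> `|F t u| <= M.
Proof.
move=> ab cd cF.
have cn : {within `[a, b] `*` `[c, d], continuous (fun p : R * R => `|F p.1 p.2|)}.
  by move=> p; apply: continuous_comp; [exact: cF|exact: norm_continuous].
have K := compact_setX (@segment_compact R a b) (@segment_compact R c d).
have [|[t0 u0] _ H] := compact_EVT_max _ K cn.
  by exists (a, c); split; rewrite /= in_itv /= lexx.
exists `|F t0 u0| => // t u tab ucd; apply: (H (t, u)).
by apply/mem_set; split; rewrite /= in_itv.
Qed.

(** The projection onto [[a, b]]. Composing with it extends a function continuous on the segment to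
    a continuous function on the line. *)
Definition clamp (a b x : R) : R := Num.min b (Num.max a x).

Lemma clamp_itv a b x : a <= b -> a <= clamp a b x <= b.
Proof.
by move=> ab; rewrite /clamp le_min ab le_max lexx ge_min lexx.
Qed.

Lemma clamp_id a b x : a <= x <= b -> clamp a b x = x.
Proof. by move=> /andP[ax xb]; rewrite /clamp max_r // min_r. Qed.

Lemma clamp_lip a b x y : a <= b -> `|clamp a b x - clamp a b y| <= `|x - y|.
Proof.
move=> ab; rewrite /clamp.
have := ler_norm (x - y); have := ler_norm (y - x); rewrite distrC => h1 h2.
rewrite ler_norml; case: (leP a x) => ?; case: (leP a y) => ?.
- by case: (leP b x) => ?; case: (leP b y) => ?; apply/andP; split; lra.
- by case: (leP b x) => ?; case: (leP b a) => ?; apply/andP; split; lra.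
- by case: (leP b a) => ?; case: (leP b y) => ?; apply/andP; split; lra.
- by case: (leP b a) => ?; apply/andP; split; lra.
Qed.

Lemma continuous_clamp a b g : a <= b -> wc a b g ->
  continuous (fun x => g (clamp a b x)).
Proof.
move=> ab /subspace_continuousP cg x.
have xI : `[a, b]%classic (clamp a b x) by rewrite /= in_itv /= clamp_itv.
have := cg _ xI; apply: cvg_comp => Q; rewrite /within /= => -[r /= r0 Hr].
exists r => //= y xy; apply: Hr => /=; last by rewrite in_itv /= clamp_itv.
exact: le_lt_trans (clamp_lip _ _ ab) xy.
Qed.

(** Continuity under the integral is applied on the open interval []-1, T + 1[], which contains
    [[0, T]]; there the clamped integrand is defined, continuous in time and bounded by [M N]. *)
Lemma within_continuous_param T F g : 0 <= T -> cont_on `[0, T] `[0, 1] F ->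
  wc 0 1 g -> wc 0 T (fun s => itg 0 1 (fun u => F s u * g u)).
Proof.
move=> T0 cF cg.
have [M M0 FM] := cont_on_bounded T0 ler01 cF.
have [N gN] := within_continuous_bounded cg.
pose G s u := F (clamp 0 T s) u * g u.
have cl s : `[0, T]%classic (clamp 0 T s) by rewrite /= in_itv /= clamp_itv.
have cG s : wc 0 1 (G s).
  by apply: within_continuousM => //; exact: cont_on_row cF (cl s).
have cI : {in `](-1), T + 1[, continuous (fun s => itg 0 1 (G s))}.
  move=> s sI.
  apply: (@continuity_under_integral R _ _ mu G `[0, 1] _ (-1) (T + 1) _ _ (fun=> M * N)).
  - by [].
  - by move=> x _; exact: within_continuous_integrable.
  - apply: aeW => u /= u01 x _; apply: cvgMl.
    exact: (continuous_clamp T0 (cont_on_col cF u01)).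
  - by apply: within_continuous_integrable; exact: within_continuous_cst.
  - move=> x _; apply: aeW => u /=; rewrite in_itv /= => u01.
    by rewrite /G normrM ler_pM ?FM ?gN ?clamp_itv.
  - by rewrite inE.
apply: (within_continuous_eq (f := fun s => itg 0 1 (G s))).
  by move=> s sT; apply: eq_itg => u _; rewrite /G clamp_id.
apply: (@continuous_subspaceW _ _ _ [set` `](-1), T + 1[%R]).
  by move=> s /=; rewrite !in_itv /= => /andP[? ?]; apply/andP; split; lra.
by apply: continuous_in_subspaceT => s /set_mem; exact: cI.
Qed.

End parametric_integrals.

(** * The series satisfies the weak formulation *)

Section weak_formulation.
Context {R : realType} (alpha T : R).
Hypotheses (alpha_gt0 : 0 < alpha) (T_gt0 : 0 < T).
Local Notation mu := (@lebesgue_measure R).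
Local Notation itg a b := (Rintegral mu [set` `[a, b]%R]).
Local Notation wc a b f := ({within [set` `[a, b]%R], continuous f}).
Local Notation integ a b f := (mu.-integrable [set` `[a, b]%R] (EFin \o f)).
Local Notation w := (robin_freq alpha).
Local Notation e := (robin_mode alpha).
Local Notation de := (robin_dmode alpha).
Local Notation coef := (coef alpha).
Local Notation decay := (decay alpha).
Local Notation heat_coef := (heat_coef alpha).

(** For positive index, [w^2] times the integral is at most 1, [w] is at least the index, and
    [(k + 1)^2 <= 4 k^2] accounts for the shift; the factor [1 + t] serves mode 0, which does not
    decay. *)
Lemma itg_decay_le (k : nat) (t : R) : 0 <= t ->
  itg 0 t (fun s => decay s k) <= 4 * (1 + t) * k.+1%:R ^- 2.
Proof.
move=> t0; case: k => [|k].
  apply: (@le_trans _ _ (itg 0 t (fun=> 1))); last first.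
    by rewrite itg_cst // expr1n invr1 subr0; lra.
  apply: itg_le; last by move=> s /andP[s0 _]; exact: decay_le1.
  - by apply: within_continuousT; exact: continuous_decay.
  - exact: within_continuous_cst.
have := integral_decay alpha k.+1 t0; have := decay_ge0 alpha t k.+1.
have I0 : 0 <= itg 0 t (fun s => decay s k.+1).
  by apply: itg_ge0 => s _; exact: decay_ge0.
have wk := robin_freq_ge_nat alpha_gt0 k.+1.
have k1 : 1 <= k.+1%:R :> R by rewrite ler1n.
move: (decay t k.+1) (itg _ _ _) I0 => D I I0 D0 E.
have W : k.+1%:R ^+ 2 <= w k.+1 ^+ 2 by rewrite lerXn2r ?nnegrE // (le_trans _ wk).
have I1 : k.+1%:R ^+ 2 * I <= 1.
  by apply: le_trans (ler_wpM2r I0 W) _; rewrite E; lra.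
rewrite ler_pdivlMr ?exprn_gt0 ?ltr0n // -[k.+2%:R]natr1.
move: (k.+1%:R : R) k1 I1 => K K1 I1.
have : (K + 1) ^+ 2 <= 4 * K ^+ 2 by nra.
by nra.
Qed.

Lemma measurable_heat_series (c : nat -> R) (t : R) (b : nat -> R -> R)
    (F : R -> R) : (forall k, wc 0 t (b k)) ->
  (forall s, 0 < s <= t ->
    series (fun k => heat_coef c s k * b k s) @ \oo --> F s) ->
  measurable_fun `]0, t] F.
Proof.
move=> cb FE; apply: (@measurable_fun_cvg _ _ _ _
  (fun M s => series (fun k => heat_coef c s k * b k s) M)); last first.
  by move=> s /=; rewrite in_itv /=; exact: FE.
move=> M; have cM : wc 0 t (fun s => series (fun k => heat_coef c s k * b k s) M).
  have [] := @itg_sum R 0 t _ (index_iota 0 M) xpredT (fun k s => heat_coef c s k * b k s).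
    move=> k; apply: within_continuousM => //; apply: within_continuousZ.
    by apply: within_continuousT; exact: continuous_decay.
  by [].
have /integrableP[/measurable_EFinP mh _] := within_continuous_integrable cM.
refine (measurable_funS _ _ mh); first exact: measurable_itv.
by move=> s /=; rewrite !in_itv /= => /andP[/ltW -> ->].
Qed.

(** Dominated convergence on []0, t]] by the sum over [k] of [C B decay s k]. This sum is not
    uniformly bounded as [s] tends to 0 in general, but it is integrable by [itg_decay_le]. *)
Lemma cvg_series_time_integral (c : nat -> R) (C B t : R) (b : nat -> R -> R)
    (F : R -> R) : 0 <= t -> (forall k, `|c k| <= C) ->
  (forall k, wc 0 t (b k)) ->
  (forall k s, 0 <= s <= t -> `|b k s| <= B) ->
  (forall s, 0 < s <= t ->
    series (fun k => heat_coef c s k * b k s) @ \oo --> F s) ->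
  series (fun k => c k * itg 0 t (fun s => decay s k * b k s)) @ \oo -->
  itg 0 t F.
Proof.
move=> t0 cC cb bB FE.
have C0 : 0 <= C := le_trans (normr_ge0 _) (cC 0).
have B0 : 0 <= B by apply: le_trans (bB 0 0 _); rewrite ?normr_ge0 // lexx t0.
have cdec k : wc 0 t (fun s => decay s k).
  by apply: within_continuousT; exact: continuous_decay.
have cterm k : wc 0 t (fun s => heat_coef c s k * b k s).
  by apply: within_continuousM => //; exact: within_continuousZ.
pose g k s : \bar R := (C * B * decay s k)%:E.
have g0 k s : (0 <= g k s)%E.
  by rewrite lee_fin mulr_ge0 ?decay_ge0 // mulr_ge0.
have cg k : wc 0 t (fun s => C * B * decay s k) by exact: within_continuousZ.
have mo (h : R -> R) : wc 0 t h -> measurable_fun `]0, t] h.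
  move=> ch; have /integrableP[/measurable_EFinP mh _] := within_continuous_integrable ch.
  refine (measurable_funS _ _ mh); first exact: measurable_itv.
  by move=> s /=; rewrite !in_itv /= => /andP[/ltW -> ->].
have mg k : measurable_fun `]0, t] (g k) by apply/measurable_EFinP; exact: mo.
pose G s := (\sum_(0 <= k <oo) g k s)%E.
have mG : measurable_fun `]0, t] G.
  by apply: ge0_emeasurable_sum => // k s _ _; exact: g0.
have iG : mu.-integrable `]0, t] G.
  apply/integrableP; split => //.
  have -> : (\int[mu]_(s in `]0%R, t]) `|G s| = \int[mu]_(s in `]0%R, t]) G s)%E.
    apply: eq_integral => s _; rewrite gee0_abs //.
    by apply: nneseries_ge0 => k _ _; exact: g0.
  rewrite integral_nneseries //.
  have gk k : (\int[mu]_(s in `]0%R, t]) g k s <=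
      (C * B * (4 * (1 + t)) * k.+1%:R ^- 2)%:E)%E.
    rewrite integral_itv_obnd_cbnd //.
    have ig := within_continuous_integrable (cg k).
    rewrite -[X in (X <= _)%E]fineK; last exact: integrable_fin_num.
    rewrite lee_fin -/(Rintegral _ _ _) itgZ // -!mulrA ler_wpM2l // ler_wpM2l //.
    by rewrite mulrA; exact: itg_decay_le.
  have cv := is_cvg_seriesZ (k := C * B * (4 * (1 + t))) (@cvg_series_inv_sqr R).
  apply: (@le_lt_trans _ _ (limn (series (fun k => C * B * (4 * (1 + t)) * k.+1%:R ^- 2)))%:E);
    last exact: ltry.
  apply: lime_le; first by apply: is_cvg_nneseries => k _ _; apply: integral_ge0 => s _.
  apply: nearW => M; apply: (@le_trans _ _
    (series (fun k => C * B * (4 * (1 + t)) * k.+1%:R ^- 2) M)%:E).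
    by rewrite /series /= -sumEFin; apply: lee_sum => k _.
  rewrite lee_fin; apply: nondecreasing_cvgn_le; last exact: cv.
  apply: nondecreasing_series => k _ _.
  by rewrite mulr_ge0 ?invr_ge0 ?exprn_ge0 // mulr_ge0 ?mulr_ge0 // addr_ge0.
have [sc sI] : (forall M, wc 0 t (fun s => series (fun k => heat_coef c s k * b k s) M)) /\
    (forall M, itg 0 t (fun s => series (fun k => heat_coef c s k * b k s) M) =
    series (fun k => c k * itg 0 t (fun s => decay s k * b k s)) M).
  have H M := @itg_sum R 0 t _ (index_iota 0 M) predT
    (fun k s => heat_coef c s k * b k s) cterm.
  split => M; have [h1 h2] := H M; first exact: h1.
  rewrite [LHS]h2; apply: eq_bigr => k _.
  rewrite -itgZ; last by apply: within_continuousM.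
  by apply: eq_itg => s _; rewrite /heat_coef mulrA.
have msc M : measurable_fun `]0, t] (fun s => series (fun k => heat_coef c s k * b k s) M).
  exact: mo.
have mF : measurable_fun `]0, t] F := measurable_heat_series cb FE.
have [] := @dominated_convergence _ _ R mu `]0%R, t] (measurable_itv _)
  (fun M s => (series (fun k => heat_coef c s k * b k s) M)%:E) (EFin \o F) G.
- by move=> M; apply/measurable_EFinP; exact: msc.
- by apply/measurable_EFinP; exact: mF.
- apply: aeW => s /=; rewrite in_itv /= => s0.
  by apply: cvg_EFin; [exact: nearW|exact: FE].
- exact: iG.
- apply: aeW => s M /=; rewrite in_itv /= => /andP[s0 st].
  apply: (@le_trans _ _ (\sum_(0 <= k < M) g k s)%E); last first.
    by apply: nneseries_lim_ge => k _ _; exact: g0.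
  rewrite sumEFin lee_fin; apply: le_trans (ler_norm_sum _ _ _) _.
  apply: ler_sum => k _; rewrite !normrM (ger0_norm (decay_ge0 _ _ _)) -mulrA.
  rewrite [_ * `|b k s|]mulrC mulrA; apply: ler_wpM2r; first exact: decay_ge0.
  by apply: ler_pM => //; apply: bB; rewrite (ltW s0).
move=> iF _ cv.
have EF : Rintegral mu `]0, t] F = itg 0 t F.
  exact: Rintegral_itv_obnd_cbnd.
rewrite -EF; have : (fun M => (series (fun k => c k * itg 0 t (fun s => decay s k * b k s)) M)%:E)
    @ \oo --> (Rintegral mu `]0, t] F)%:E.
  rewrite [X in _ --> X]fineK; last by apply: integrable_fin_num => //; exact: measurable_itv.
  apply: cvg_trans cv; apply: near_eq_cvg; apply: nearW => M /=.
  rewrite -sI -(Rintegral_itv_obnd_cbnd (b := BRight t)).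
    rewrite fineK //; apply: integrable_fin_num; first exact: measurable_itv.
    apply: integrableS (within_continuous_integrable (sc M)) => //.
    by move=> s /=; rewrite !in_itv /= => /andP[/ltW -> ->].
  apply: integrableS (within_continuous_integrable (sc M)) => //.
  by move=> s /=; rewrite !in_itv /= => /andP[/ltW -> ->].
by move=> /fine_cvg.
Qed.

Section test_function.
Variable H : R -> R -> R.
Hypothesis CH : C12 T H.

Lemma C12_du s : 0 <= s <= T -> C1on 0 1 (H s) (du H s).
Proof.
move=> sT; have [dH [cH _ cdu _]] := CH.
have sT' : `[0, T]%classic s by rewrite /= in_itv.
split; [exact: cont_on_row cH sT'|exact: cont_on_row cdu sT'|].
move=> u u01; apply: derive_within_is_derive => //.
have u01' : u \in `[0, 1].
  by move/andP: u01 => [? ?]; rewrite in_itv /=; apply/andP; split; lra.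
by have [] := dH s u sT' u01'.
Qed.

Lemma C12_ddu s : 0 <= s <= T -> C1on 0 1 (du H s) (du (du H) s).
Proof.
move=> sT; have [dH [_ _ cdu cddu]] := CH.
have sT' : `[0, T]%classic s by rewrite /= in_itv.
split; [exact: cont_on_row cdu sT'|exact: cont_on_row cddu sT'|].
move=> u u01; apply: derive_within_is_derive => //.
have u01' : u \in `[0, 1].
  by move/andP: u01 => [? ?]; rewrite in_itv /=; apply/andP; split; lra.
by have [] := dH s u sT' u01'.
Qed.

Lemma C12_dt u : 0 <= u <= 1 -> C1on 0 T (H ^~ u) ((dt T H) ^~ u).
Proof.
move=> u01; have [dH [cH cdt _ _]] := CH.
have u01' : `[0, 1]%classic u by rewrite /= in_itv.
split; [exact: cont_on_col cH u01'|exact: cont_on_col cdt u01'|].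
move=> s s01; apply: derive_within_is_derive => //.
have s01' : s \in `[0, T].
  by move/andP: s01 => [? ?]; rewrite in_itv /=; apply/andP; split; lra.
by have [] := dH s u s01' u01'.
Qed.

Lemma C1on_coef k : C1on 0 T (fun s => coef (H s) k) (fun s => coef (dt T H s) k).
Proof.
have [dH [cH cdt _ _]] := CH.
have ce := @within_continuous_mode R alpha 0 1 k.
split.
- exact: within_continuous_param (ltW T_gt0) cH ce.
- exact: within_continuous_param (ltW T_gt0) cdt ce.
move=> s s0T.
have [M M0 HM] := cont_on_bounded (ltW T_gt0) ler01 cdt.
pose F x y := H x y * e k y.
have IT x : `]0, T[%classic x -> 0 <= x <= T /\ 0 < x < T.
  by rewrite /= in_itv /= => /andP[? ?]; split; apply/andP; split; lra.
have dF x y : `]0, T[%classic x -> `[0, 1]%classic y ->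
    is_derive x 1 (F ^~ y) (dt T H x y * e k y).
  move=> /IT [_ xT]; rewrite /= in_itv /= => y01.
  have [_ _ /(_ x xT) d] := C12_dt y01.
  apply: is_derive_eq (is_deriveM d (is_derive_cst (e k y) x (1 : R))) _.
  by rewrite /GRing.scale /= mulr0 add0r mulrC.
have iF x : `]0, T[%classic x -> integ 0 1 (F x).
  move=> /IT [xT _]; apply: within_continuous_integrable.
  by apply: within_continuousM => //; have [] := C12_du xT.
have derF x y : `]0, T[%classic x -> `[0, 1]%classic y -> derivable (F ^~ y) x 1.
  by move=> xI yI; exact: (@ex_derive _ _ _ _ _ _ _ (dF x y xI yI)).
have pF x y : `]0, T[%classic x -> `[0, 1]%classic y ->
    partial1of2 F x y = dt T H x y * e k y.
  move=> xI yI; have := dF x y xI yI => d.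
  by rewrite /partial1of2 derive1E; exact: derive_val.
have bF x y : `]0, T[%classic x -> `[0, 1]%classic y ->
    `|partial1of2 F x y| <= M * 2.
  move=> xI yI; rewrite pF // normrM; apply: ler_pM => //; last exact: mode_le2.
  by have [xT _] := IT x xI; exact: HM.
have sI : `]0, T[%classic s by rewrite /= in_itv.
have iG : integ 0 1 (fun=> M * 2).
  by apply: within_continuous_integrable; exact: within_continuous_cst.
have G0 (y : R) : 0 <= (fun=> M * 2) y by rewrite mulr_ge0.
have mB : measurable (`[(0:R), 1]%classic : set R) by exact: measurable_itv.
have D1 := @derivable_under_integral R _ _ mu F `[0, 1] mB s 0 T sI iF derF
  (fun=> M * 2) G0 iG bF.
have D2 := @differentiation_under_integral R _ _ mu F `[0, 1] mB s 0 T sI iF derF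
  (fun=> M * 2) G0 iG bF.
apply: DeriveDef; first exact: D1.
rewrite -derive1E; apply: (etrans D2); apply: eq_itg => u u01.
have uI : `[0, 1]%classic u by rewrite /= in_itv.
exact: pF.
Qed.

(** [b1], [b2] and [b3] are the integrands of the three time integrals of the weak formulation with
    the mode [e k] in place of the solution. *)
Let b1 k s := coef (dt T H s) k + coef (du (du H) s) k.
Let b2 k s := e k 0 * du H s 0 - e k 1 * du H s 1.
Let b3 k s := alpha * (e k 0 - e k 1) * (H s 0 - H s 1).

(* Green's formula against [e k]: the boundary terms produced by the Robin
   conditions on [e k] are those of the weak formulation. *)
Lemma coef_ddu k s : 0 <= s <= T ->
  - w k ^+ 2 * coef (H s) k = coef (du (du H) s) k + b2 k s - b3 k s.
Proof.
move=> sT; have C1 := C12_du sT; have C2 := C12_ddu sT.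
have [cH cdu _] := C1; have [_ cddu _] := C2.
have P1 := C1on_parts ler01 C1 (C1on_dmode alpha 0 1 k).
have P2 := C1on_parts ler01 C2 (C1on_mode alpha 0 1 k).
have -> : - w k ^+ 2 * coef (H s) k =
    itg 0 1 (fun u => H s u * (- w k ^+ 2 * e k u)).
  rewrite /coef -itgZ; last by apply: within_continuousM => //; exact: within_continuous_mode.
  by apply: eq_itg => u _; ring.
rewrite P1 P2 -/(coef (du (du H) s) k) /b2 /b3 mode_bc0 // mode_bc1 //.
move: (coef _ k) (e k 0) (e k 1) (H s 0) (H s 1) (du H s 0) (du H s 1).
by move=> x1 x2 x3 x4 x5 x6 x7; ring.
Qed.

(** The weak formulation for the single solution [decay s k] times [e k]: the product rule produces
    [- w^2 coef (H s) k], which [coef_ddu] turns into space derivatives and boundary terms. *)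
Lemma coef_ode k t : 0 <= t <= T ->
  decay t k * coef (H t) k - coef (H 0) k =
  itg 0 t (fun s => decay s k * (b1 k s + b2 k s - b3 k s)).
Proof.
move=> /andP[t0 tT].
have Cd : C1on 0 t (fun s => decay s k) (fun s => - w k ^+ 2 * decay s k).
  apply: C1onT; first exact: is_derive_decay.
  by apply: continuous_scale; exact: continuous_decay.
have Cc := C1onS (lexx 0) tT (C1on_coef k).
have := C1on_FTC t0 (C1onM Cd Cc); rewrite decay0 mul1r => <-.
apply: eq_itg => s /andP[s0 st].
have sT : 0 <= s <= T by rewrite s0 (le_trans st).
have := coef_ddu k sT; rewrite /b1.
move: (coef (H s) k) (coef (dt T H s) k) (coef (du (du H) s) k) (b2 k s) (b3 k s).
move=> x1 x2 x3 x4 x5 E.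
have -> : x2 + x3 + x4 - x5 = x2 + (x3 + x4 - x5) by ring.
by rewrite -E; ring.
Qed.

Lemma robin_sol_weak f t : sqint f -> 0 <= t <= T ->
  let rho := robin_sol alpha f in
  inner (rho t) (H t) - inner f (H 0)
  - itg 0 t (fun s => inner (rho s) (dt T H s \+ du (du H) s))
  - itg 0 t (fun s => bval (rho s) 0 * du H s 0 - bval (rho s) 1 * du H s 1)
  + itg 0 t (fun s => alpha * (bval (rho s) 0 - bval (rho s) 1) * (H s 0 - H s 1))
  = 0.
Proof.
move=> sf /andP[t0 tT] rho.
(* At time 0 the slice is [f] itself and all time integrals run over one point. *)
move: t0; rewrite le_eqVlt => /predU1P[<-|t0].
  by rewrite !set_itv1 !Rintegral_set1 /rho /robin_sol ltxx subrr !subr0 addr0.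
have [dH [cH cdt cdu cddu]] := CH.
have T0 := ltW T_gt0.
have cC := coef_bound alpha_gt0 sf.
set c := coef f in cC; set C := _ + 1 in cC.
have sub (g : R -> R) : wc 0 T g -> wc 0 t g by exact: (within_continuousS (lexx 0) tT).
have u0 : `[0, 1]%classic (0 : R) by rewrite /= in_itv /= lexx ler01.
have u1 : `[0, 1]%classic (1 : R) by rewrite /= in_itv /= lexx ler01.
have v0 : 0 <= (0 : R) <= 1 by rewrite lexx ler01.
have v1 : 0 <= (1 : R) <= 1 by rewrite lexx ler01.
have sT s : 0 <= s <= t -> 0 <= s <= T by move=> /andP[-> /le_trans]; apply.
have ce k := @within_continuous_mode R alpha 0 1 k.
have cb1 k : wc 0 t (b1 k).
  apply: sub; apply: within_continuousD.
  - exact: within_continuous_param T0 cdt (ce k).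
  - exact: within_continuous_param T0 cddu (ce k).
have cb2 k : wc 0 t (b2 k).
  apply: sub; apply: within_continuousB; apply: within_continuousZ.
  - exact: cont_on_col cdu u0.
  - exact: cont_on_col cdu u1.
have cb3 k : wc 0 t (b3 k).
  apply: sub; apply: within_continuousZ; apply: within_continuousB.
  - exact: cont_on_col cH u0.
  - exact: cont_on_col cH u1.
have [M1 M10 B1] := cont_on_bounded T0 ler01 cdt.
have [M2 M20 B2] := cont_on_bounded T0 ler01 cddu.
have [M3 M30 B3] := cont_on_bounded T0 ler01 cdu.
have [M4 M40 B4] := cont_on_bounded T0 ler01 cH.
have coefB (F : R -> R) k M : wc 0 1 F -> (forall u, 0 <= u <= 1 -> `|F u| <= M) ->
    `|coef F k| <= M * 2.
  move=> cF FM; rewrite -[leRHS]mulr1 -[X in _ * X](subr0 (1 : R)).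
  apply: normr_itg_le => //; first exact: within_continuousM.
  by move=> u u01; rewrite normrM ler_pM // ?FM // mode_le2.
have bb1 k s : 0 <= s <= t -> `|b1 k s| <= M1 * 2 + M2 * 2.
  move=> /sT sT'; have sTc : `[0, T]%classic s by rewrite /= in_itv.
  apply: le_trans (ler_normD _ _) _; apply: lerD; apply: coefB.
  - exact: cont_on_row cdt sTc.
  - by move=> u; exact: B1.
  - exact: cont_on_row cddu sTc.
  - by move=> u; exact: B2.
have bb2 k s : 0 <= s <= t -> `|b2 k s| <= 2 * M3 + 2 * M3.
  move=> /sT sT'; apply: le_trans (ler_normB _ _) _.
  by apply: lerD; rewrite normrM ler_pM ?B3 ?mode_le2.
have bb3 k s : 0 <= s <= t -> `|b3 k s| <= alpha * (2 + 2) * (M4 + M4).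
  move=> /sT sT'; rewrite /b3 !normrM (gtr0_norm alpha_gt0).
  apply: ler_pM => //; first by rewrite mulr_ge0 // ltW.
    apply: ler_wpM2l; first exact: ltW.
    by apply: le_trans (ler_normB _ _) _; apply: lerD; exact: mode_le2.
  by apply: le_trans (ler_normB _ _) _; apply: lerD; exact: B4.
have hw s x : 0 < s -> 0 <= x <= 1 -> bval (rho s) x = heat alpha c s x.
  move=> s0 x01; rewrite /rho robin_solE // bval_continuous //.
  by apply: within_continuousT; exact: (continuous_heat alpha_gt0 cC s0).
have hs s x : 0 < s -> series (fun k => heat_coef c s k * e k x) @ \oo --> heat alpha c s x.
  move=> s0; have := cvg_comb_heat alpha_gt0 cC (u := x) s0.
  by under eq_fun do rewrite comb_series.
have S1 := cvg_series_time_integral (ltW t0) cC cb1 bb1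
  (F := fun s => inner (rho s) (dt T H s \+ du (du H) s)).
have S2 := cvg_series_time_integral (ltW t0) cC cb2 bb2
  (F := fun s => bval (rho s) 0 * du H s 0 - bval (rho s) 1 * du H s 1).
have S3 := cvg_series_time_integral (ltW t0) cC cb3 bb3
  (F := fun s => alpha * (bval (rho s) 0 - bval (rho s) 1) * (H s 0 - H s 1)).
have {}S1 : series (fun k => c k * itg 0 t (fun s => decay s k * b1 k s)) @ \oo -->
    itg 0 t (fun s => inner (rho s) (dt T H s \+ du (du H) s)).
  apply: S1 => s /andP[s0 st].
  have sT' : 0 <= s <= T by apply: sT; rewrite (ltW s0).
  have sTc : `[0, T]%classic s by rewrite /= in_itv.
  have r1 := cont_on_row cdt sTc; have r2 := cont_on_row cddu sTc.
  have := cvg_inner_heat alpha_gt0 cC s0 (within_continuousD r1 r2).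
  rewrite (_ : (fun k => heat_coef c s k * coef _ k) = fun k => heat_coef c s k * b1 k s).
    by rewrite /rho robin_solE.
  apply/funext => k; congr (_ * _); rewrite /b1 /coef -itgD; try exact: within_continuousM.
  by apply: eq_itg => u _; rewrite mulrDl.
have {}S2 : series (fun k => c k * itg 0 t (fun s => decay s k * b2 k s)) @ \oo -->
    itg 0 t (fun s => bval (rho s) 0 * du H s 0 - bval (rho s) 1 * du H s 1).
  apply: S2 => s /andP[s0 st]; rewrite !hw //.
  have -> : series (fun k => heat_coef c s k * b2 k s) = fun M =>
     series (fun k => heat_coef c s k * e k 0) M * du H s 0 -
     series (fun k => heat_coef c s k * e k 1) M * du H s 1.
    apply/funext => M; rewrite /series /= !mulr_suml -sumrB.
    by apply: eq_bigr => k _; rewrite /b2; ring.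
  by apply: cvgB; apply: cvgMl; exact: hs.
have {}S3 : series (fun k => c k * itg 0 t (fun s => decay s k * b3 k s)) @ \oo -->
    itg 0 t (fun s => alpha * (bval (rho s) 0 - bval (rho s) 1) * (H s 0 - H s 1)).
  apply: S3 => s /andP[s0 st]; rewrite !hw //.
  have -> : series (fun k => heat_coef c s k * b3 k s) = fun M =>
     alpha * (series (fun k => heat_coef c s k * e k 0) M -
     series (fun k => heat_coef c s k * e k 1) M) * (H s 0 - H s 1).
    apply/funext => M; rewrite /series /= -sumrB mulr_sumr mulr_suml.
    by apply: eq_bigr => k _; rewrite /b3; ring.
  by apply: cvgMl; apply: cvgMr; apply: cvgB; exact: hs.
have tT' : 0 <= t <= T by rewrite (ltW t0).
(* Parseval enters here, [H 0] being C^1 while [f] is merely square integrable. *)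
have P0 : series (fun k => c k * coef (H 0) k) @ \oo --> inner f (H 0).
  by apply: (parseval alpha_gt0 sf (C12_du _)); rewrite lexx.
have Pt : series (fun k => heat_coef c t k * coef (H t) k) @ \oo --> inner (rho t) (H t).
  rewrite /rho robin_solE //; apply: cvg_inner_heat => //.
  by have [] := C12_du tT'.
pose proof (cvgD (cvgB (cvgB (cvgB Pt P0) S1) S2) S3) as cv.
have <- := cvg_lim (@Rhausdorff R) cv; apply: (cvg_lim (@Rhausdorff R)).
apply: cvg_near_cst; apply: nearW => M.
(* By [coef_ode] each mode contributes 0, so the partial sums, whose limit is the left-hand side,
   are constantly 0. *)
rewrite /series !fctE /= -!sumrN -!big_split /= big1 // => k _.
have -> : itg 0 t (fun s => decay s k * b1 k s) =
   itg 0 t (fun s => decay s k * (b1 k s + b2 k s - b3 k s)) - itg 0 t (fun s => decay s k * b2 k s) + itg 0 t (fun s => decay s k * b3 k s).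
  have cdec : wc 0 t (fun s => decay s k).
    by apply: within_continuousT; exact: continuous_decay.
  have x1 := within_continuousM cdec (cb1 k).
  have x2 := within_continuousM cdec (cb2 k).
  have x3 := within_continuousM cdec (cb3 k).
  have -> : itg 0 t (fun s => decay s k * (b1 k s + b2 k s - b3 k s)) =
      itg 0 t (fun s => decay s k * b1 k s + decay s k * b2 k s - decay s k * b3 k s).
    by apply: eq_itg => s _; ring.
  rewrite itgB //; last exact: within_continuousD.
  rewrite itgD //; move: (itg _ _ _) (itg _ _ _) (itg _ _ _) => y1 y2 y3.
  by ring.
rewrite -coef_ode // /heat_coef.
move: (c k) (decay t k) (coef _ k) (coef _ k) (itg _ _ _) (itg _ _ _).
by move=> y1 y2 y3 y4 y5 y6; ring.
Qed.

End test_function.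
End weak_formulation.

(** * A C^2 convex penalty for negative values *)

Section penalty.
Context {R : realType}.

Lemma continuous_fun_comp (f g : R -> R) : continuous f -> continuous g ->
  continuous (fun x => g (f x)).
Proof. by move=> cf cg x; exact: (@continuous_comp _ _ _ f g x (cf x) (cg (f x))). Qed.

Lemma within_continuous_fun_comp (a b : R) (f g : R -> R) :
  {within `[a, b], continuous f} -> continuous g ->
  {within `[a, b], continuous (fun x => g (f x))}.
Proof. by move=> cf cg x; apply: continuous_comp; [exact: cf|exact: cg]. Qed.

Let inv1 (x : R) : R := (1 + x ^+ 2)^-1.
(** Equal to [x^4 / (1 + x^2)] by [penE]: flat enough at 0 to be continued by 0 with two continuous
    derivatives, and at most [x^2] everywhere. *)
Let pen (x : R) : R := x ^+ 2 - 1 + inv1 x.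
Let dpen (x : R) : R := 2 * x - 2 * x * inv1 x ^+ 2.
Let ddpen (x : R) : R := 2 - 2 * inv1 x ^+ 2 + 8 * x ^+ 2 * inv1 x ^+ 3.

(* A smoothing of the square of the negative part: convex, C^2, vanishing exactly
   on [0, +oo[, and still bounded by that square, so that continuity in L^2 at
   time 0 suffices to start the comparison argument. *)
Definition penalty (x : R) : R := pen (Num.min x 0).
Definition dpenalty (x : R) : R := dpen (Num.min x 0).
Definition ddpenalty (x : R) : R := ddpen (Num.min x 0).

Let inv1E (x : R) : (1 + x ^+ 2) * inv1 x = 1.
Proof. by rewrite mulfV // gt_eqF // ltr_pwDl ?sqr_ge0. Qed.

Let inv1_itv (x : R) : 0 < inv1 x <= 1.
Proof.
rewrite invr_gt0 ltr_pwDl ?sqr_ge0 //= invf_le1 ?ltr_pwDl ?sqr_ge0 //.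
by rewrite lerDl sqr_ge0.
Qed.

Let is_derive_inv1 (x : R) : is_derive x 1 inv1 (- 2 * x * inv1 x ^+ 2).
Proof.
have n0 : 1 + x ^+ 2 != 0 by rewrite gt_eqF // ltr_pwDl ?sqr_ge0.
have d : is_derive x 1 (fun y : R => 1 + y ^+ 2) (2 * x).
  apply: is_derive_eq (is_deriveD (is_derive_cst (1 : R) x (1 : R))
    (is_deriveX 2 (is_derive_id x (1 : R)))) _.
  by rewrite /GRing.scale /=; ring.
apply: is_derive_eq (@is_deriveV _ (fun y : R => 1 + y ^+ 2) _ _ _ n0 d) _.
by rewrite /GRing.scale /= /inv1 -exprVn; move: (_^-1) => y; ring.
Qed.

Let is_derive_pen (x : R) : is_derive x 1 pen (dpen x).
Proof.
have d := is_deriveD (is_deriveB (is_deriveX 2 (is_derive_id x (1 : R)))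
  (is_derive_cst (1 : R) x (1 : R))) (is_derive_inv1 x).
by apply: is_derive_eq d _; rewrite /dpen /GRing.scale /=; ring.
Qed.

Let is_derive_dpen (x : R) : is_derive x 1 dpen (ddpen x).
Proof.
have d2 := is_deriveZ 2 (is_derive_id x (1 : R)).
have d := is_deriveB d2 (is_deriveM d2 (is_deriveX 2 (is_derive_inv1 x))).
apply: is_derive_eq d _; rewrite /ddpen !fctE.
rewrite (_ : (2 \*: id) x = 2 * x) // /GRing.scale /=.
by move: (inv1 x) => y; ring.
Qed.

(** Gluing with 0 at the origin, where the quadratic bound forces derivative 0 from both sides. It
    serves twice, for [pen] and for [dpen]. *)
Let is_derive_min (g dg : R -> R) (C x : R) : g 0 = 0 -> dg 0 = 0 ->
  (forall y, `|y| <= 1 -> `|g y| <= C * y ^+ 2) ->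
  (forall y : R, is_derive y 1 g (dg y)) ->
  is_derive x 1 (fun y => g (Num.min y 0)) (dg (Num.min x 0)).
Proof.
move=> g0 dg0 gC dgg; have [x0|x0|->] := ltgtP x 0.
- apply: near_eq_is_derive (dgg x); near=> y.
  by rewrite min_l //; near: y; exact: lt_le_nbhsl.
- rewrite dg0; apply: near_eq_is_derive (is_derive_cst (0 : R) x (1 : R)).
  near=> y; rewrite min_r ?g0 //; near: y; exact: lt_le_nbhsr.
- rewrite dg0; apply: (@is_derive_flat0 _ _ _ C); first by rewrite minxx.
  move=> y; rewrite subr0 => y1; have [y0|y0] := leP y 0; first exact: gC.
  have := gC 1; rewrite normr1 expr1n mulr1 lexx => /(_ isT) h.
  by rewrite g0 normr0 mulr_ge0 ?sqr_ge0 // (le_trans (normr_ge0 (g 1))).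
Unshelve. all: by end_near. Qed.

Let penE (x : R) : pen x = x ^+ 2 * x ^+ 2 * inv1 x.
Proof.
have := inv1E x; rewrite /pen; move: (inv1 x) (x ^+ 2) => y z E.
have zy : z * y = 1 - y by rewrite -E; ring.
by rewrite -mulrA zy mulrBr mulr1 zy; ring.
Qed.

Let dpen_abs (x : R) : `|dpen x| <= 2 * `|x|.
Proof.
have -> : dpen x = 2 * x * (1 - inv1 x ^+ 2) by rewrite /dpen; ring.
rewrite normrM normrM ger0_norm // ler_piMr ?mulr_ge0 //.
by have /andP[] := inv1_itv x; move: (inv1 x) => y ? ?; rewrite ler_norml; nra.
Qed.

Let sub1_inv1 (x : R) : 0 <= 1 - inv1 x ^+ 2 <= 2 * x ^+ 2.
Proof.
have := inv1E x; have /andP[] := inv1_itv x; have := sqr_ge0 x.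
by move: (inv1 x) (x ^+ 2) => y z; nra.
Qed.

Let min0_norm (x : R) : `|Num.min x 0| <= `|x|.
Proof. by have [?|?] := leP x 0; rewrite ?normr0. Qed.

Lemma is_derive_penalty (x : R) : is_derive x 1 penalty (dpenalty x).
Proof.
apply: (@is_derive_min pen dpen 1); last exact: is_derive_pen.
- by rewrite penE expr0n /= mul0r mul0r.
- by rewrite /dpen !mulr0 mul0r subrr.
- move=> y y1; rewrite penE mul1r normrM ger0_norm; last by rewrite mulr_ge0 ?sqr_ge0.
have y2 : y ^+ 2 <= 1 by rewrite -real_normK ?num_real // expr_le1.
have /andP[i0 i1] := inv1_itv y; rewrite ger0_norm ?(ltW i0) // -mulrA ler_piMr ?sqr_ge0 //.
have := sqr_ge0 y; move: (y ^+ 2) (inv1 y) y2 i0 i1 => z w; nra.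
Qed.

Lemma is_derive_dpenalty (x : R) : is_derive x 1 dpenalty (ddpenalty x).
Proof.
apply: (@is_derive_min dpen ddpen 4); last exact: is_derive_dpen.
- by rewrite /dpen !mulr0 mul0r subrr.
- by rewrite /ddpen /inv1 expr0n /= addr0 invr1 !expr1n; ring.
move=> y y1; have -> : dpen y = 2 * y * (1 - inv1 y ^+ 2) by rewrite /dpen; ring.
have /andP[h1 h2] := sub1_inv1 y.
rewrite normrM normrM (ger0_norm h1) ger0_norm //.
have -> : 4 * y ^+ 2 = 2 * 1 * (2 * y ^+ 2) by ring.
by rewrite ler_pM // ?mulr_ge0 // ler_pM.
Qed.

Lemma continuous_ddpenalty : continuous ddpenalty.
Proof.
have cm : continuous (fun x : R => Num.min x 0).
  by move=> x; apply: continuous_min; [exact: cvg_id|exact: cvg_cst].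
have cd : continuous ddpen.
  have ci : continuous inv1 := is_derive_continuous is_derive_inv1.
  have cx : continuous (fun x : R => x) by move=> x; exact: cvg_id.
  apply: continuous_add.
    apply: continuous_sub; first by move=> x; exact: cvg_cst.
    by apply: continuous_scale; apply: continuous_mul.
  apply: continuous_mul; first by apply: continuous_scale; apply: continuous_mul.
  by apply: continuous_mul => //; apply: continuous_mul.
exact: continuous_fun_comp.
Qed.

Lemma ddpenalty_ge0 x : 0 <= ddpenalty x.
Proof.
rewrite /ddpenalty /ddpen; have /andP[i0 _] := inv1_itv (Num.min x 0).
have /andP[h _] := sub1_inv1 (Num.min x 0).
have := mulr_ge0 (sqr_ge0 (Num.min x 0)) (exprn_ge0 3 (ltW i0)).
by move: (_ ^+ 2) h => y h; rewrite -mulrA; move: (_ * _) => z ?; lra.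
Qed.

Lemma dpenalty_le0 x : dpenalty x <= 0.
Proof.
have -> : dpenalty x = 2 * Num.min x 0 * (1 - inv1 (Num.min x 0) ^+ 2).
  by rewrite /dpenalty /dpen; ring.
have /andP[h _] := sub1_inv1 (Num.min x 0).
by rewrite mulr_le0_ge0 // mulr_ge0_le0 // ge_min lexx orbT.
Qed.

Lemma normr_dpenalty x : `|dpenalty x| <= 2 * `|x|.
Proof.
apply: le_trans (dpen_abs _) _; rewrite ler_wpM2l //; exact: min0_norm.
Qed.

Lemma dpenalty_mono x y : x <= y -> dpenalty x <= dpenalty y.
Proof.
move=> xy; apply: (@ger0_derive1_ndecr R dpenalty x y _ _ _ x y (lexx x) xy (lexx y)).
- by move=> z _; exact: (@ex_derive _ _ _ _ _ _ _ (is_derive_dpenalty z)).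
- move=> z _; rewrite derive1E (@derive_val _ _ _ _ _ _ _ (is_derive_dpenalty z)).
  exact: ddpenalty_ge0.
- apply: continuous_subspaceT; exact: is_derive_continuous is_derive_dpenalty.
Qed.

Lemma penalty_ge0 x : 0 <= penalty x.
Proof.
rewrite /penalty penE; have /andP[i0 _] := inv1_itv (Num.min x 0).
by rewrite mulr_ge0 ?(ltW i0) // mulr_ge0 ?sqr_ge0.
Qed.

Lemma penalty_le x y : 0 <= y -> penalty x <= (x - y) ^+ 2.
Proof.
move=> y0; rewrite /penalty /pen; have /andP[_ i1] := inv1_itv (Num.min x 0).
apply: (@le_trans _ _ (Num.min x 0 ^+ 2)); first by move: (_ ^+ 2) => z; lra.
by have [x0|x0] := leP x 0; rewrite ?expr0n /= ?sqr_ge0 //; nra.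
Qed.

Lemma penalty_eq0 x : penalty x <= 0 -> 0 <= x.
Proof.
rewrite leNgt => h; rewrite leNgt; apply: contra h => x0.
rewrite /penalty min_l ?(ltW x0) // penE.
have /andP[i0 _] := inv1_itv x; rewrite mulr_gt0 // mulr_gt0 //;
  by rewrite exprn_even_gt0 //= lt_eqF.
Qed.

Lemma mul_dpenalty_ge0 x : 0 <= x * dpenalty x.
Proof.
have [x0|x0] := leP x 0; first by rewrite mulr_le0 // dpenalty_le0.
by rewrite /dpenalty min_r ?(ltW x0) // /dpen !mulr0 mul0r subrr mulr0.
Qed.

Lemma mul_dpenalty_eq0 x : x * dpenalty x <= 0 -> 0 <= x.
Proof.
rewrite leNgt => h; rewrite leNgt; apply: contra h => x0.
have -> : x * dpenalty x = 2 * x ^+ 2 * (1 - inv1 x ^+ 2).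
  by rewrite /dpenalty min_l ?(ltW x0) // /dpen; ring.
have x2 : 0 < x ^+ 2 by rewrite exprn_even_gt0 //= lt_eqF.
apply: mulr_gt0; first by rewrite mulr_gt0.
have := inv1E x; have /andP[] := inv1_itv x.
move: (inv1 x) (x ^+ 2) x2 => y z z0 y0 y1 E.
have := mulr_gt0 z0 y0; have -> : z * y = 1 - y by rewrite -E; ring.
by move=> ?; nra.
Qed.

End penalty.

Lemma itg_eq0 {R : realType} (f : R -> R) : {within `[0, 1], continuous f} ->
  (forall u, 0 <= u <= 1 -> 0 <= f u) ->
  \int[lebesgue_measure]_(u in `[0, 1]) f u <= 0 ->
  forall u, 0 <= u <= 1 -> f u = 0.
Proof.
move=> cf f0 If; have I0 : \int[lebesgue_measure]_(u in `[0, 1]) f u = 0.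
  by apply/eqP; rewrite eq_le If itg_ge0.
have fi := within_continuous_integrable cf.
suff ae0 : {ae lebesgue_measure, forall u : R, u \in `[0, 1] -> f u = 0}.
  by have := within_continuous_ae_eq cf (@within_continuous_cst R 0 1 0) ae0.
have mf : measurable_fun `[(0:R), 1] (EFin \o f).
  exact: measurable_int fi.
have aF := ae_filter_ringOfSetsType (@lebesgue_measure R).
have [+ _] := @ae_eq_integral_abs _ _ R lebesgue_measure `[0%R, 1%R] (measurable_itv _) _ mf.
have -> : (\int[lebesgue_measure]_(x in `[0%R, 1%R]) `|(EFin \o f) x| = 0)%E.
  transitivity (\int[lebesgue_measure]_(x in `[0%R, 1%R]) (EFin \o f) x)%E.
    by apply: eq_integral => x; rewrite inE /= in_itv /= => x01; rewrite ger0_norm ?f0.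
  rewrite -[LHS]fineK; last by apply: integrable_fin_num => //; exact: measurable_itv.
  by congr (_%:E).
move=> /(_ erefl); apply: filterS => u h u01.
by have /(_ u01) [] := h.
Qed.

(** * Preservation of the bounds 0 and 1 *)

Section positivity.
Context {R : realType} (alpha : R).
Hypothesis alpha_gt0 : 0 < alpha.
Local Notation mu := (@lebesgue_measure R).
Local Notation itg a b := (Rintegral mu [set` `[a, b]%R]).
Local Notation wc a b f := ({within [set` `[a, b]%R], continuous f}).
Local Notation integ a b f := (mu.-integrable [set` `[a, b]%R] (EFin \o f)).
Local Notation w := (robin_freq alpha).
Local Notation e := (robin_mode alpha).
Local Notation coef := (coef alpha).
Local Notation decay := (decay alpha).
Local Notation heat_coef := (heat_coef alpha).
Local Notation heat := (heat alpha).
Local Notation dheat := (dheat alpha).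
Local Notation ddheat := (ddheat alpha).

Lemma mode0 u : e 0 u = 1.
Proof.
have E v : w 0 * v + - (0%:R * pi + robin_shift alpha 0) = 0.
  by rewrite /robin_freq /robin_shift /= !mul0r mulr0 !addr0 mul0r oppr0 addr0.
rewrite /robin_mode E cos0 mulr1.
have -> : robin_norm2 alpha 0 = 1.
  rewrite -[RHS]mulr1 -[X in _ = _ * X]subr0 -itg_cst //.
  by apply: eq_itg => v _; rewrite E cos0 expr1n.
by rewrite sqrtr1 invr1.
Qed.

Lemma coef_heat c C t k : (forall j, `|c j| <= C) -> 0 < t ->
  coef (heat c t) k = heat_coef c t k.
Proof.
move=> cC t0; have := cvg_inner_heat alpha_gt0 cC t0 (@within_continuous_mode R alpha 0 1 k).
rewrite -/(coef (heat c t) k) => cv.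
apply: (cvg_unique (@Rhausdorff R) cv); apply: cvg_near_cst.
exists k.+1 => // M /= kM; rewrite /series /= big_mkord.
rewrite (bigD1 (Ordinal kM)) //= {1}/coef mode_orthonormal // eqxx mulr1 big1 ?addr0 //.
move=> j jk; rewrite /coef mode_orthonormal //.
suff /negbTE -> : k != j by rewrite mulr0.
by apply: contra jk => /eqP jk; apply/eqP/val_inj.
Qed.

(** Half of the decay absorbs [- w^2] into bounded coefficients; [ddheat] is then itself a heat
    series at time [t / 2] and inherits its continuity. *)
Lemma ddheat_heat c C t : (forall k, `|c k| <= C) -> 0 < t ->
  let c' k := - w k ^+ 2 * heat_coef c (t / 2) k in
  (forall k, `|c' k| <= majorant C (t / 2) 0) /\
  ddheat c t = heat c' (t / 2).
Proof.
move=> cC t0 c'; have t2 : 0 < t / 2 by rewrite divr_gt0.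
have C0 : 0 <= C := le_trans (normr_ge0 _) (cC 0).
split=> [k|].
  apply: (@le_trans _ _ (majorant C (t / 2) k)).
    rewrite /c' mulrC; apply: (heat_term_bound alpha_gt0 cC t2 (lexx _)).
    by rewrite normrN ger0_norm ?sqr_ge0 //; have := sqr_ge0 (w k); move: (w k ^+ 2) => W; lra.
  rewrite /majorant ler_wpM2l ?mulr_ge0 // ler_wpM2l //.
    by rewrite addr_ge0 // divr_ge0 // ltW.
  rewrite expr0 exprn_ile1 ?expR_ge0 //.
  by rewrite -[leRHS]expR0 ler_expR oppr_le0 divr_ge0 // ltW.
apply/funext => u; congr (limn (series _)); apply/funext => k.
rewrite /heat_coef /c' /heat_coef /decay {1}[t]splitr mulrDr opprD expRD.
by ring.
Qed.

Lemma continuous_ddheat c C t : (forall k, `|c k| <= C) -> 0 < t ->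
  continuous (ddheat c t).
Proof.
move=> cC t0; have [cC' ->] := ddheat_heat cC t0.
by apply: (continuous_heat alpha_gt0 cC'); rewrite divr_gt0.
Qed.

Lemma heat_norm_le c C d t u : (forall k, `|c k| <= C) -> 0 < d -> d <= t ->
  `|heat c t u| <= limn (series (majorant C d)) /\
  `|ddheat c t u| <= limn (series (majorant C d)).
Proof.
move=> cC d0 dt; split; apply: dominated_series_le; try exact: cvg_majorant.
- by move=> k; apply: (heat_term_bound alpha_gt0 cC) => //; exact: (mode_weight alpha_gt0).
- by move=> k; apply: (heat_term_bound alpha_gt0 cC) => //; exact: (ddmode_weight alpha_gt0).
Qed.

(* Green's formula: the boundary terms have a sign because [dpenalty] is
   nondecreasing. *)
Lemma penalty_dissipation c C t : (forall k, `|c k| <= C) -> 0 < t ->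
  itg 0 1 (fun u => dpenalty (heat c t u) * ddheat c t u) <= 0.
Proof.
move=> cC t0.
have dh u := is_derive_heat_u alpha_gt0 cC u t0.
have ddh u := is_derive_dheat_u alpha_gt0 cC u t0.
have ch := continuous_heat alpha_gt0 cC t0.
have cd := continuous_dheat alpha_gt0 cC t0.
have cdd := continuous_ddheat cC t0.
have cpp : continuous (fun u => ddpenalty (heat c t u)).
  by apply: continuous_fun_comp => //; exact: continuous_ddpenalty.
have C1 : C1on 0 1 (fun u => dpenalty (heat c t u))
    (fun u => dheat c t u * ddpenalty (heat c t u)).
  apply: C1onT; last exact: continuous_mul.
  move=> u; rewrite mulrC.
  exact: (@is_derive1_comp R (@dpenalty R) (heat c t) u _ _ (is_derive_dpenalty _) (dh u)).
have C2 : C1on 0 1 (dheat c t) (ddheat c t) by apply: C1onT.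
rewrite (C1on_parts ler01 C1 C2) (heat_bc0 alpha_gt0 cC t0) (heat_bc1 alpha_gt0 cC t0).
have I0 : 0 <= itg 0 1 (fun u => dheat c t u * ddpenalty (heat c t u) * dheat c t u).
  apply: itg_ge0 => u _; rewrite mulrAC -expr2 mulr_ge0 ?sqr_ge0 ?ddpenalty_ge0 //.
have B : dpenalty (heat c t 1) * (alpha * (heat c t 0 - heat c t 1)) -
    dpenalty (heat c t 0) * (alpha * (heat c t 0 - heat c t 1)) <= 0.
  rewrite -mulrBl mulrCA; apply: mulr_ge0_le0; first exact: ltW.
  have [h|h] := leP (heat c t 0) (heat c t 1).
    by rewrite mulr_ge0_le0 ?subr_ge0 ?subr_le0 ?dpenalty_mono.
  by rewrite mulr_le0_ge0 ?subr_ge0 ?subr_le0 ?dpenalty_mono // ltW.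
by move: I0 B; move: (itg _ _ _) => I; lra.
Qed.

(** Differentiating under the integral and using the heat equation, the derivative in time is the
    integral of [penalty_dissipation]. Bounds are taken on times above [s / 2], which leaves room
    for a two-sided derivative at [s]. *)
Lemma penalty_decreasing c C s t : (forall k, `|c k| <= C) -> 0 < s -> s <= t ->
  itg 0 1 (fun u => penalty (heat c t u)) <= itg 0 1 (fun u => penalty (heat c s u)).
Proof.
move=> cC s0 st.
pose Phi r := itg 0 1 (fun u => penalty (heat c r u)).
have s2 : 0 < s / 2 by rewrite divr_gt0.
pose B := limn (series (majorant C (s / 2))).
have cp : continuous (@penalty R) := is_derive_continuous (@is_derive_penalty R).
have cph r : 0 < r -> wc 0 1 (fun u => penalty (heat c r u)).
  move=> r0; apply: within_continuousT; apply: continuous_fun_comp => //.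
  exact: (continuous_heat alpha_gt0 cC r0).
have dPhi (r : R) : s / 2 < r -> is_derive r 1 Phi
    (itg 0 1 (fun u => dpenalty (heat c r u) * ddheat c r u)).
  move=> sr.
  have rI : `]s / 2, r + 1[%classic r by rewrite /= in_itv /= sr ltrDl ltr01.
  have gt x : `]s / 2, r + 1[%classic x -> s / 2 < x /\ 0 < x.
    by rewrite /= in_itv /= => /andP[h _]; split=> //; exact: lt_trans h.
  pose F x y := penalty (heat c x y).
  have dF x y : `]s / 2, r + 1[%classic x -> `[0, 1]%classic y ->
      is_derive x 1 (F ^~ y) (dpenalty (heat c x y) * ddheat c x y).
    move=> /gt[_ x0] _; have dt := is_derive_heat_t alpha_gt0 cC y x0.
    apply: is_derive_eq (@is_derive1_comp R (@penalty R) (heat c ^~ y) x _ _ (is_derive_penalty _) dt) _.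
    by rewrite /GRing.scale /= mulrC.
  have iF x : `]s / 2, r + 1[%classic x -> integ 0 1 (F x).
    by move=> /gt[_ x0]; apply: within_continuous_integrable; exact: cph.
  have derF x y : `]s / 2, r + 1[%classic x -> `[0, 1]%classic y -> derivable (F ^~ y) x 1.
    by move=> xI yI; exact: (@ex_derive _ _ _ _ _ _ _ (dF x y xI yI)).
  have pF x y : `]s / 2, r + 1[%classic x -> `[0, 1]%classic y ->
      partial1of2 F x y = dpenalty (heat c x y) * ddheat c x y.
    move=> xI yI; have := dF x y xI yI => d.
    by rewrite /partial1of2 derive1E; exact: derive_val.
  have bF x y : `]s / 2, r + 1[%classic x -> `[0, 1]%classic y ->
      `|partial1of2 F x y| <= 2 * B * B.
    move=> xI yI; rewrite pF // normrM; have [sx x0] := gt x xI.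
    have [h1 h2] := heat_norm_le y cC s2 (ltW sx).
    apply: ler_pM => //; apply: le_trans (normr_dpenalty _) _.
    by rewrite ler_wpM2l.
  have iG : integ 0 1 (fun=> 2 * B * B).
    by apply: within_continuous_integrable; exact: within_continuous_cst.
  have B0 : 0 <= B.
    have [h _] := heat_norm_le 0 cC s2 (lexx _); exact: le_trans h.
  have G0 (y : R) : 0 <= (fun=> 2 * B * B) y by rewrite !mulr_ge0.
  have mB : measurable (`[(0:R), 1]%classic : set R) by exact: measurable_itv.
  have D1 := @derivable_under_integral R _ _ mu F `[0, 1] mB r (s / 2) (r + 1) rI iF derF
    (fun=> 2 * B * B) G0 iG bF.
  have D2 := @differentiation_under_integral R _ _ mu F `[0, 1] mB r (s / 2) (r + 1) rI iF derF
    (fun=> 2 * B * B) G0 iG bF.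
  apply: DeriveDef; first exact: D1.
  rewrite -derive1E; apply: (etrans D2); apply: eq_itg => u u01.
  by apply: pF; rewrite //= in_itv.
have ss : s / 2 < s by rewrite ltr_pdivrMr // ltr_pMr // ltr1n.
apply: (@ler0_derive1_nincr R Phi s t) => //.
- move=> r; rewrite in_itv /= => /andP[sr _].
  exact: (@ex_derive _ _ _ _ _ _ _ (dPhi r (lt_trans ss sr))).
- move=> r; rewrite in_itv /= => /andP[sr _].
  rewrite derive1E (@derive_val _ _ _ _ _ _ _ (dPhi r (lt_trans ss sr))).
  by apply: (penalty_dissipation cC); exact: lt_trans sr.
- apply: (@continuous_in_subspaceT _ _ `[s, t]%classic) => r.
  rewrite inE /= in_itv /= => /andP[sr _].
  apply: differentiable_continuous; apply/derivable1_diffP.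
  exact: (@ex_derive _ _ _ _ _ _ _ (dPhi r (lt_le_trans ss sr))).
Qed.

(** For [0 < s <= t] the penalty at [t] is at most that at [s], hence at most the squared distance
    from [heat s] to [g >= 0]. As [heat s] has norm at most that of [g], this distance is bounded by
    [2 (<g, g> - <heat s, g>)], which tends to 0 with [s] by Parseval for [g]. *)
Lemma heat_C1_ge0 g dg t : C1on 0 1 g dg -> (forall u, 0 <= u <= 1 -> 0 <= g u) ->
  0 < t -> forall u, 0 <= u <= 1 -> 0 <= heat (coef g) t u.
Proof.
move=> Cg g0 t0; have [cg _ _] := Cg; have sg := within_continuous_sqint cg.
have cC := coef_bound alpha_gt0 sg; set c := coef g in cC *.
set C := _ + 1 in cC.
have ch s : 0 < s -> wc 0 1 (heat c s).
  by move=> s0; apply: within_continuousT; exact: (continuous_heat alpha_gt0 cC s0).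
have cp : continuous (@penalty R) := is_derive_continuous (@is_derive_penalty R).
have cph r : 0 < r -> wc 0 1 (fun u => penalty (heat c r u)).
  move=> r0; apply: within_continuousT; apply: continuous_fun_comp => //.
  exact: (continuous_heat alpha_gt0 cC r0).
pose L s := limn (series (fun k => c k ^+ 2 * decay s k)).
have P := parseval alpha_gt0 sg Cg.
have P2 : series (fun k => c k ^+ 2) @ \oo --> itg 0 1 (fun u => g u * g u).
  by under eq_fun do rewrite expr2.
have LE s : 0 < s -> itg 0 1 (fun u => heat c s u * g u) = L s.
  move=> s0; symmetry; apply: (cvg_lim (@Rhausdorff R)).
  have := cvg_inner_heat alpha_gt0 cC s0 cg.
  by rewrite (_ : (fun k => _ * coef g k) = fun k => c k ^+ 2 * decay s k) //;
    apply/funext => k; rewrite /heat_coef -/c mulrAC -expr2.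
have cvL : L s @[s --> 0^'+] --> itg 0 1 (fun u => g u * g u).
  rewrite -(cvg_lim (@Rhausdorff R) P2).
  apply: (@series_cvg_dominated _ _ _ _ (fun k s => c k ^+ 2 * decay s k) _ (fun k => c k ^+ 2)).
  - by apply/cvg_ex; eexists; exact: P2.
  - near=> s => k; have s0 : 0 < s by [].
    rewrite normrM ger0_norm ?sqr_ge0 // ger0_norm ?decay_ge0 //.
    by rewrite ler_piMr ?sqr_ge0 // decay_le1 // ltW.
  - move=> k; rewrite -[X in _ --> X]mulr1 -(decay0 alpha k); apply: cvgMr.
    by apply: cvg_at_right_filter; exact: continuous_decay.
have bound s : 0 < s -> s <= t ->
    itg 0 1 (fun u => penalty (heat c t u)) <= 2 * (itg 0 1 (fun u => g u * g u) - L s).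
  move=> s0 st; apply: le_trans (penalty_decreasing cC s0 st) _.
  have chs := ch s s0.
  have x1 := within_continuousX2 chs; have x2 := within_continuousM chs cg.
  have x3 := within_continuousM cg cg.
  apply: (@le_trans _ _ (itg 0 1 (fun u => heat c s u ^+ 2 - 2 * (heat c s u * g u) + g u * g u))).
    apply: itg_le; first exact: cph.
      by apply: within_continuousD => //; apply: within_continuousB => //; exact: within_continuousZ.
    move=> u u01; apply: le_trans (penalty_le _ (g0 u u01)) _.
    by rewrite le_eqVlt; apply/orP; left; apply/eqP; ring.
  rewrite itgD //; last by apply: within_continuousB => //; exact: within_continuousZ.
  rewrite itgB //; last exact: within_continuousZ.
  rewrite itgZ // LE //; have := itg_heat_sqr_le alpha_gt0 sg s0; rewrite -/c.
  have -> : itg 0 1 (fun u => g u ^+ 2) = itg 0 1 (fun u => g u * g u).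
    by apply: eq_itg => u _; rewrite expr2.
  by move: (itg _ _ _) (itg _ _ _) (L s) => x y z; lra.
have cv0 : 2 * (itg 0 1 (fun u => g u * g u) - L s) @[s --> 0^'+] --> (0 : R).
  move: cvL; move: (itg _ _ _) => I cvL.
  have : 2 * (I - L s) @[s --> 0^'+] --> 2 * (I - I).
    by apply: cvgMr; apply: cvgB => //; exact: cvg_cst.
  by rewrite subrr mulr0.
have I0 : itg 0 1 (fun u => penalty (heat c t u)) <= 0.
  rewrite -[leRHS](cvg_lim (@Rhausdorff R) cv0); apply: limr_ge.
    by apply/cvg_ex; eexists; exact: cv0.
  near=> s; apply: bound; first by [].
  by near: s; exact: nbhs_right_ltW.
move=> u u01; apply: penalty_eq0.
by rewrite (itg_eq0 (cph t t0) (fun v _ => penalty_ge0 _) I0).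
Unshelve. all: by end_near. Qed.

Lemma heat_itg f g dg t : sqint f -> C1on 0 1 g dg -> 0 < t ->
  itg 0 1 (fun u => heat (coef f) t u * g u) =
  itg 0 1 (fun u => f u * heat (coef g) t u).
Proof.
move=> sf Cg t0; have [cg _ _] := Cg; have sg := within_continuous_sqint cg.
have cf := coef_bound alpha_gt0 sf; have cCg := coef_bound alpha_gt0 sg.
have P := parseval alpha_gt0 sf (C1on_heat alpha_gt0 cCg 0 1 t0).
have Q := cvg_inner_heat alpha_gt0 cf t0 cg.
apply: (cvg_unique (@Rhausdorff R) Q).
rewrite (_ : (fun k => _ * coef g k) = fun k => coef f k * coef (heat (coef g) t) k) //.
by apply/funext => k; rewrite (coef_heat _ cCg t0) /heat_coef mulrA mulrAC.
Qed.

Lemma C1on_pos_part (h dh : R -> R) : C1on 0 1 h dh ->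
  C1on 0 1 (fun u => - dpenalty (h u)) (fun u => - (dh u * ddpenalty (h u))).
Proof.
move=> [ch cdh hdh]; split.
- apply: within_continuousN; apply: within_continuous_fun_comp => //.
  exact: (is_derive_continuous (@is_derive_dpenalty R)).
- apply: within_continuousN; apply: within_continuousM => //.
  by apply: within_continuous_fun_comp => //; exact: continuous_ddpenalty.
move=> x xI; apply: is_deriveN; rewrite mulrC.
exact: (@is_derive1_comp R (@dpenalty R) h x _ _ (is_derive_dpenalty _) (hdh x xI)).
Qed.

(* Testing against the [C^1] function [- dpenalty h >= 0]. *)
Lemma dual_ge0 (h dh : R -> R) : C1on 0 1 h dh ->
  (forall g dg, C1on 0 1 g dg -> (forall u, 0 <= u <= 1 -> 0 <= g u) ->
    0 <= itg 0 1 (fun u => h u * g u)) ->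
  forall u, 0 <= u <= 1 -> 0 <= h u.
Proof.
move=> Ch H; have Cp := C1on_pos_part Ch; have [cp _ _] := Cp.
have [ch _ _] := Ch.
have h0 := H _ _ Cp (fun u _ => _).
have {}h0 : 0 <= itg 0 1 (fun u => h u * - dpenalty (h u)).
  by apply: h0 => u; rewrite oppr_ge0 dpenalty_le0.
have cm : wc 0 1 (fun u => h u * dpenalty (h u)).
  apply: within_continuousM => //; apply: within_continuous_fun_comp => //.
  exact: (is_derive_continuous (@is_derive_dpenalty R)).
move=> u u01; apply: mul_dpenalty_eq0.
rewrite (itg_eq0 cm _ _ u01) //; first by move=> v _; exact: mul_dpenalty_ge0.
rewrite -oppr_ge0 -mulN1r -itgZ //; move: h0; congr (0 <= _).
by apply: eq_itg => v _; ring.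
Qed.

(** By symmetry the inner product of [heat] with [g >= 0] is that of [f] with the evolution of [g],
    which is nonnegative and has the same integral as [g]. It thus lies between 0 and the integral
    of [g], and [dual_ge0] applies to [heat] and to [1 - heat]. *)
Lemma heat_itv01 f t : sqint f -> (forall u, 0 <= u <= 1 -> 0 <= f u <= 1) ->
  0 < t -> forall u, 0 <= u <= 1 -> 0 <= heat (coef f) t u <= 1.
Proof.
move=> sf f01 t0; have cC := coef_bound alpha_gt0 sf.
have Ch := C1on_heat alpha_gt0 cC 0 1 t0; have [ch _ _] := Ch.
have C1h : C1on 0 1 (fun u => 1 - heat (coef f) t u) (fun u => 0 - dheat (coef f) t u).
  by apply: C1onB => //; exact: C1on_cst.
have key g dg : C1on 0 1 g dg -> (forall u, 0 <= u <= 1 -> 0 <= g u) ->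
    0 <= itg 0 1 (fun u => f u * heat (coef g) t u) <= itg 0 1 g.
  move=> Cg g0; have hg := heat_C1_ge0 Cg g0 t0.
  have [cg _ _] := Cg; have sg := within_continuous_sqint cg.
  have cCg := coef_bound alpha_gt0 sg.
  have [chg _ _] := C1on_heat alpha_gt0 cCg 0 1 t0.
  apply/andP; split.
    by apply: itg_ge0 => u u01; rewrite mulr_ge0 ?hg //; have /andP[] := f01 u u01.
  (* Conservation of mass: mode 0 is the constant 1 and has frequency 0, so its coefficient does not
     decay. *)
  have -> : itg 0 1 g = itg 0 1 (heat (coef g) t).
    have := coef_heat 0 cCg t0; rewrite /heat_coef /decay.
    have -> : w 0 = 0 by rewrite /robin_freq /robin_shift /= mul0r mulr0 addr0.
    rewrite expr0n /= mul0r oppr0 expR0 mulr1 /coef => E.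
    transitivity (itg 0 1 (fun u => g u * e 0 u)).
      by apply: eq_itg => u _; rewrite mode0 mulr1.
    by rewrite -E; apply: eq_itg => u _; rewrite mode0 mulr1.
  apply: le_Rintegral => //; first exact: sqint_mul.
    exact: within_continuous_integrable.
  move=> u; rewrite /= in_itv /= => u01.
  by rewrite ler_piMl ?hg //; have /andP[] := f01 u u01.
move=> u u01; apply/andP; split.
  apply: (dual_ge0 Ch) u u01 => g dg Cg g0.
  by rewrite (heat_itg sf Cg t0); have /andP[] := key g dg Cg g0.
rewrite -subr_ge0; apply: (dual_ge0 C1h) u u01 => g dg Cg g0.
have [cg _ _] := Cg.
have -> : itg 0 1 (fun u => (1 - heat (coef f) t u) * g u) =
    itg 0 1 (fun u => g u - heat (coef f) t u * g u).
  by apply: eq_itg => u _; ring.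
rewrite itgB //; last exact: within_continuousM.
by rewrite subr_ge0 (heat_itg sf Cg t0); have /andP[] := key g dg Cg g0.
Qed.

End positivity.

(** * Measurability of the initial datum *)

Section piecewise_continuous.
Context {R : realType}.

(** Off the discontinuities and the two end points, finitely many in all, [f] is continuous on an
    open set; on a finite set every function is measurable. *)
Lemma piecewise_continuous_measurable (f : R -> R) : piecewise_continuous_torus f ->
  measurable_fun `[(0 : R), 1] f.
Proof.
move=> [_ fin _]; set S := [set _ | _] in fin.
pose A := `]0, 1[%classic `\` S; pose B := S `|` [set (0 : R)] `|` [set (1 : R)].
have fB : finite_set B by rewrite !finite_setU; split => //; split.
have mf A' : finite_set A' -> measurable (A' : set R).
  by move=> /finite_set_countable; apply: countable_measurable => t; exact: measurable_set1.
have oA : open A.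
  rewrite /A setDE; apply: openI; first exact: interval_open.
  by apply: closed_openC; apply: (accessible_finite_set_closed.1 (hausdorff_accessible (@Rhausdorff R))).
suff mAB : measurable_fun (A `|` B) f.
  refine (measurable_funS _ _ mAB).
    apply: measurableU; last exact: mf.
    exact: open_measurable.
  move=> u; rewrite /= in_itv /= => /andP[u0 u1].
  have [uS|uS] := pselect (S u); first by right; left; left.
  move: u0 u1; rewrite !le_eqVlt => /predU1P[<-|u0]; first by right; left; right.
  move=> /predU1P[->|u1]; first by right; right.
  by left; split=> //=; rewrite in_itv /= u0.
apply/measurable_funU; [exact: open_measurable|exact: mf|split].
  apply: open_continuous_measurable_fun => // u /set_mem [/=].
  rewrite in_itv /= => /andP[u0 u1] uS; apply: contrapT => nc.
  by apply: uS; split=> //; rewrite (ltW u0).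
move=> mB Y mY; apply: mf; exact: finite_setIl.
Qed.

End piecewise_continuous.

(** * The energy estimate *)

Section energy.
Context {R : realType} (T : R) (alpha : {posnum R}) (f : R -> R).
Hypotheses (T_gt0 : 0 < T) (sf : sqint f).
Hypothesis f01 : forall u, 0 <= u <= 1 -> 0 <= f u <= 1.
Local Notation mu := (@lebesgue_measure R).
Local Notation itg a b := (Rintegral mu [set` `[a, b]%R]).
Local Notation wc a b f := ({within [set` `[a, b]%R], continuous f}).
Local Notation integ a b f := (mu.-integrable [set` `[a, b]%R] (EFin \o f)).
Local Notation a := (alpha%:num).
Local Notation coef := (coef a).
Local Notation heat := (heat a (coef f)).
Local Notation dheat := (dheat a (coef f)).

Let a_gt0 : 0 < a. Proof. by []. Qed.
Let T_ge0 : 0 <= T. Proof. exact: ltW. Qed.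
Let cC := coef_bound a_gt0 sf.

Lemma sqint_mul_ae (g h k : R -> R) : sqint g -> sqint h -> wc 0 1 k ->
  {ae mu, forall u : R, u \in `[0, 1] -> g u = h u} ->
  itg 0 1 (fun u => g u * k u) = itg 0 1 (fun u => h u * k u).
Proof.
move=> /sqint_measurable mg /sqint_measurable mh ck gh.
have /integrableP[/measurable_EFinP mk _] := within_continuous_integrable ck.
rewrite /Rintegral; congr fine; apply: ae_eq_integral => //.
- by apply/measurable_EFinP; exact: measurable_funM.
- by apply/measurable_EFinP; exact: measurable_funM.
have aF := ae_filter_ringOfSetsType mu.
by apply: filterS gh => u E u01; rewrite E.
Qed.

(** The half-open domain contains 0 and omits 1, so the Dirac mass of the circle is counted exactly
    once. *)
Lemma Rintegral_W (g : R -> R) : wc 0 1 g -> (forall u, 0 <= u <= 1 -> 0 <= g u) ->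
  \int[W alpha]_(u in `[0, 1[) g u = itg 0 1 g + a^-1 * g 0.
Proof.
move=> cg g0.
have gi := within_continuous_integrable cg.
have /integrableP[mg _] := gi.
have mg' : measurable_fun (`[(0:R), 1[%classic : set R) (EFin \o g).
  refine (measurable_funS _ _ mg); first exact: measurable_itv.
  by move=> u /=; rewrite !in_itv /= => /andP[-> /ltW ->].
have g0' (u : R) : `[(0:R), 1[%classic u -> (0 <= (EFin \o g) u)%E.
  by rewrite /= in_itv /= => /andP[u0 u1]; rewrite lee_fin g0 // u0 ltW.
rewrite /Rintegral /W ge0_integral_measure_add //.
rewrite ge0_integral_mscale // integral_dirac // integral_itv_bndo_bndc //.
rewrite diracE mem_set /=; last by rewrite in_itv /= lexx ltr01.
rewrite mul1e -EFinM fineD //; last by apply: integrable_fin_num => //; exact: measurable_itv.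
Qed.

Section competitor.
Variable H : R -> R -> R.
Hypothesis CH : C01_torus T H.
Local Notation dH s := (derive1 (H s)).

Lemma C01_torus_C1on s : 0 <= s <= T -> C1on 0 1 (H s) (dH s).
Proof.
move=> sT; have [_ dH cH cdH] := CH.
have sT' : `[0, T]%classic s by rewrite /= in_itv.
have sub (g : R -> R) : {within setT, continuous g} -> wc 0 1 g.
  by apply: continuous_subspaceW.
split; [exact/sub/(cont_on_row cH)|exact/sub/(cont_on_row cdH)|].
by move=> u _; have d := dH s u sT'; apply: DeriveDef => //; rewrite derive1E.
Qed.

Lemma cont_on_sub (F : R -> R -> R) : cont_on `[0, T] setT F -> cont_on `[0, T] `[0, 1] F.
Proof. by apply: continuous_subspaceW => p [? ?]; split. Qed.

Let I1 s := itg 0 1 (fun u => heat s u * dH s u).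
Let I2 s := itg 0 1 (fun u => H s u * H s u) + a^-1 * (H s 0 * H s 0).

(** Since [H s 1 = H s 0], integration by parts leaves the boundary term
    [(heat s 1 - heat s 0) H s 0]. In the bulk, [(x + 4 y)^2 >= 0] gives [- x y <= x^2 / 8 + 2 y^2].
    At the boundary the same square, with the jump for [x], [H s 0 / a] for [y] and prefactor [a],
    gives [a / 8] times the squared jump plus [2 (H s 0)^2 / a], the latter being twice the Dirac
    part of [I2]. *)
Lemma energy_pointwise s : 0 < s <= T ->
  I1 s - 2 * I2 s <= 1 / 8 * robin_form a (heat s) (dheat s).
Proof.
move=> /andP[s0 sT]; have sT' : 0 <= s <= T by rewrite (ltW s0).
have C1 := C1on_heat a_gt0 cC 0 1 s0; have C2 := C01_torus_C1on sT'.
have H1 : H s 1 = H s 0.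
  by have [per _ _ _] := CH; rewrite -[1]add0r per // in_itv.
have [ch cdh _] := C1; have [cH _ _] := C2.
have Y : - itg 0 1 (fun u => dheat s u * H s u) <=
    1 / 8 * itg 0 1 (fun u => dheat s u ^+ 2) + 2 * itg 0 1 (fun u => H s u * H s u).
  have x1 := within_continuousX2 cdh; have x2 := within_continuousM cH cH.
  have x3 := within_continuousM cdh cH.
  rewrite -mulN1r -!itgZ // -itgD //; [|exact: within_continuousZ..].
  apply: itg_le; [exact: within_continuousZ|by apply: within_continuousD; exact: within_continuousZ|].
  move=> u _; have := sqr_ge0 (dheat s u + 4 * H s u).
  by move: (dheat s u) (H s u) => x y; nra.
rewrite /I1 /I2 (C1on_parts ler01 C1 C2) H1 /robin_form.
move: Y; move: (itg _ _ _) (itg _ _ _) (itg _ _ _) => J1 J2 J3 Y.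
have Z : (heat s 1 - heat s 0) * H s 0 <=
    a / 8 * (heat s 0 - heat s 1) ^+ 2 + 2 * (a^-1 * (H s 0 * H s 0)).
  have := mulr_ge0 (ltW a_gt0) (sqr_ge0 ((heat s 0 - heat s 1) + 4 * (a^-1 * H s 0))).
  have E : a * a^-1 = 1 by rewrite mulfV.
  move: (heat s 0) (heat s 1) (H s 0) (a^-1) E => x y z b E.
  have -> : a * (x - y + 4 * (b * z)) ^+ 2 =
    a * (x - y) ^+ 2 + 8 * (a * b) * ((x - y) * z) + 16 * (a * b) * (b * (z * z)) by ring.
  rewrite E; move: (b * (z * z)) ((x - y) ^+ 2) => p q; nra.
by move: Z Y; move: (heat s 0) (heat s 1) (H s 0) => x y z; nra.
Qed.

Lemma integrable_I1 : mu.-integrable `]0, T] (EFin \o I1).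
Proof.
have [_ _ cH cdH] := CH.
have cd : cont_on `[0, T] `[0, 1] (fun t => dH t) := cont_on_sub cdH.
have [M M0 HM] := cont_on_bounded T_ge0 ler01 cd.
have mI : measurable_fun `]0, T] I1.
  apply: (@measurable_heat_series _ a (coef f) T (fun k s => coef (dH s) k)).
    by move=> k; exact: (within_continuous_param T_ge0 cd (@within_continuous_mode R a 0 1 k)).
  move=> s /andP[s0 sT]; apply: (cvg_inner_heat a_gt0 cC s0).
  by have [] := C01_torus_C1on (s := s); rewrite ?(ltW s0).
have ic : mu.-integrable `]0, T] (EFin \o (fun=> M : R)).
  apply: integrableS (within_continuous_integrable (@within_continuous_cst R 0 T M)) => //.
  by move=> s /=; rewrite !in_itv /= => /andP[/ltW -> ->].
apply: le_integrable ic => //; first exact/measurable_EFinP.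
move=> s /=; rewrite in_itv /= => /andP[s0 sT]; rewrite lee_fin (ger0_norm M0).
have [ch _ _] := C1on_heat a_gt0 cC 0 1 s0.
have sT' : 0 <= s <= T by rewrite (ltW s0).
have [_ cd' _] := C01_torus_C1on sT'.
rewrite -[leRHS]mulr1 -[X in _ * X](subr0 (1 : R)).
apply: normr_itg_le => //; first exact: within_continuousM.
move=> u u01; rewrite normrM -[leRHS]mul1r ler_pM // ?HM //.
by have /andP[h0 h1] := heat_itv01 a_gt0 sf f01 s0 u01; rewrite ger0_norm.
Qed.

Lemma within_continuous_I2 : wc 0 T I2.
Proof.
have [_ _ cH _] := CH; have cH' := cont_on_sub cH.
have z : `[0, 1]%classic (0 : R) by rewrite /= in_itv /= lexx ler01.
have c0 := cont_on_col cH' z.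
apply: within_continuousD; last by apply: within_continuousZ; exact: within_continuousM.
have cHH : cont_on `[0, T] `[0, 1] (fun s u => H s u * H s u).
  by move=> p; apply: cvgM; exact: cH'.
have := within_continuous_param T_ge0 cHH (@within_continuous_cst R 0 1 1).
by apply: within_continuous_eq => s _; apply: eq_itg => u _; rewrite mulr1.
Qed.

(** The constant is [1/8] from the pointwise estimate times [1/2] from the dissipation estimate, the
    squared norm of [f] being at most 1. *)
Lemma energy_competitor :
  Rintegral mu `]0, T] I1 - 2 * itg 0 T I2 <= 1 / 16.
Proof.
have i1 := integrable_I1; have i2 := within_continuous_integrable within_continuous_I2.
have sub : `]0, T]%classic `<=` (`[0, T]%classic : set R).
  by move=> s /=; rewrite !in_itv /= => /andP[/ltW -> ->].
have i2' : mu.-integrable `]0, T] (EFin \o I2).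
  by apply: integrableS i2.
have [f0 f2] := sf.
have f1 : itg 0 1 (fun u => f u ^+ 2) <= 1.
  rewrite -[leRHS]mulr1 -[X in _ * X](subr0 (1 : R)) -itg_cst //.
  apply: le_Rintegral => //.
    by apply: within_continuous_integrable; exact: within_continuous_cst.
  move=> u; rewrite /= in_itv /= => /f01 /andP[h0 h1].
  by rewrite expr_le1.
pose Q s := robin_form a (heat s) (dheat s).
have mQ := measurable_robin_form_heat a_gt0 sf (T := T).
have Q0 s : 0 <= Q s by apply: robin_form_ge0.
have Qle := integral_robin_form_heat a_gt0 sf T_ge0.
have iQ : mu.-integrable `]0, T] (EFin \o Q).
  apply/integrableP; split; first exact/measurable_EFinP.
  apply: le_lt_trans (ltry (itg 0 1 (fun u => f u ^+ 2) / 2)); apply: le_trans Qle.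
  by rewrite le_eqVlt; apply/orP; left; apply/eqP; apply: eq_integral => s _; rewrite /= ger0_norm.
have scale (k : R) (g : R -> R) : mu.-integrable `]0, T] (EFin \o g) ->
    mu.-integrable `]0, T] (EFin \o (fun s => k * g s)).
  by move=> ig; apply: eq_integrable (integrableZl _ k ig) => // s _; rewrite /= EFinM.
have iQ' := scale (1 / 8) _ iQ; have i2'' := scale 2 _ i2'.
have E2 : itg 0 T I2 = Rintegral mu `]0, T] I2 by rewrite Rintegral_itv_obnd_cbnd.
rewrite E2 -RintegralZl // -RintegralB //.
apply: (@le_trans _ _ (Rintegral mu `]0, T] (fun s => 1 / 8 * Q s))).
  apply: le_Rintegral => //.
    by apply: eq_integrable (integrableB _ i1 i2'') => // s _; rewrite /= EFinB.
  by move=> s /=; rewrite in_itv /=; exact: energy_pointwise.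
rewrite RintegralZl //.
have QR : Rintegral mu `]0, T] Q <= itg 0 1 (fun u => f u ^+ 2) / 2.
  rewrite -lee_fin /Rintegral fineK //; exact: integrable_fin_num.
by move: QR f1; move: (Rintegral _ _ _) (Rintegral _ _ _) => x y; lra.
Qed.

End competitor.

(** For each competitor the value depends on [rho] only through its slices at positive times up to
    null sets, so the estimate for the series transfers. *)
Lemma energy_le (rho : R -> R -> R) :
  (forall s, s \in `[0, T] -> L2_01 (rho s)) ->
  (forall s, 0 < s <= T ->
    {ae mu, forall u : R, u \in `[0, 1] -> rho s u = heat s u}) ->
  (energy T alpha rho <= (1 / 16)%:E)%E.
Proof.
move=> L2 ae; apply: ge_ereal_sup => _ [H CH <-]; rewrite lee_fin.
apply: le_trans (energy_competitor CH).
pose J s := \int[mu]_(u in `[0, 1[) (rho s u * derive1 (H s) u).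
have E s : 0 < s <= T -> J s = itg 0 1 (fun u => heat s u * derive1 (H s) u).
  move=> s0T; have /andP[s0 sT] := s0T; have sT' : 0 <= s <= T by rewrite (ltW s0).
  have [_ cd _] := C01_torus_C1on CH sT'.
  have sr : sqint (rho s) by apply/L2_01_sqint/L2; rewrite in_itv.
  have [ch _ _] := C1on_heat a_gt0 cC 0 1 s0.
  have sh := within_continuous_sqint ch.
  rewrite /J Rintegral_itv_bndo_bndc.
    by apply: sqint_mul_ae => //; exact: ae.
  apply: integrableS (sqint_mul sr cd) => //.
  by move=> u /=; rewrite !in_itv /= => /andP[-> /ltW ->].
have iJ : mu.-integrable `]0, T] (EFin \o J).
  apply: eq_integrable (integrable_I1 CH) => // s.
  by rewrite inE /= in_itv /= => /E E'; rewrite /= E'.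
rewrite le_eqVlt; apply/orP; left; apply/eqP; congr (_ - 2 * _).
  rewrite /bracket -(Rintegral_itv_obnd_cbnd iJ).
  by apply: eq_Rintegral => s; rewrite inE /= in_itv /=; exact: E.
rewrite /bracketW; apply: eq_itg => s sT; have [cH _ _] := C01_torus_C1on CH sT.
rewrite Rintegral_W //; first exact: within_continuousM.
by move=> u _; rewrite -expr2 sqr_ge0.
Qed.

End energy.

(** * Assembly of existence, uniqueness and the energy bound *)

Lemma robin_sol_is_weak_sol (R : realType) (T alpha : R) (f : R -> R) :
  0 < alpha -> 0 < T -> sqint f ->
  Robin_weak_sol T alpha f (robin_sol alpha f).
Proof.
move=> a0 T0 sf; split; first exact: robin_sol_L2H1.
  move=> t; rewrite in_itv /= => /andP[+ _]; rewrite le_eqVlt => /predU1P[<-|t0].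
    by rewrite /robin_sol ltxx; exact: sqint_L2_01.
  rewrite robin_solE //; apply/sqint_L2_01/within_continuous_sqint/within_continuousT.
  exact: (continuous_heat a0 (coef_bound a0 sf) t0).
move=> t H; rewrite in_itv /= => tT CH.
exact: (robin_sol_weak a0 T0 CH sf tT).
Qed.

Theorem proposition2p1 (R : realType) (T : R) (rho0 : R -> R) (hT : 0 < T)
    (hrho0 : piecewise_continuous_torus rho0)
    (hrho01 : forall u, rho0 u \in `[0, 1]) :
  (forall alpha : {posnum R}, exists rho : R -> R -> R,
     Robin_weak_sol T alpha%:num rho0 rho /\
     (forall t u : R, t \in `[0, T] -> u \in `[0, 1] -> rho t u \in `[0, 1])) /\
  (forall (alpha : {posnum R}) (rho rho' : R -> R -> R),
     Robin_weak_sol T alpha%:num rho0 rho ->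
     Robin_weak_sol T alpha%:num rho0 rho' ->
     forall t : R, t \in `[0, T] ->
       {ae lebesgue_measure, forall u : R, u \in `[0, 1] -> rho t u = rho' t u}) /\
  (exists K0 : R, forall (alpha : {posnum R}) (rho : R -> R -> R),
     Robin_weak_sol T alpha%:num rho0 rho ->
     (energy T alpha rho <= K0%:E)%E).
Proof.
have frho0 u : 0 <= u <= 1 -> 0 <= rho0 u <= 1.
  by have := hrho01 u; rewrite in_itv.
have s0 : sqint rho0.
  apply: (@bounded_sqint _ _ 1); first exact: piecewise_continuous_measurable.
  by move=> u _; have := hrho01 u; rewrite in_itv /= => /andP[? ?]; rewrite ger0_norm.
split.
  move=> alpha; exists (robin_sol alpha%:num rho0); split.
    exact: robin_sol_is_weak_sol.
  move=> t u; rewrite !in_itv /= => /andP[+ _]; rewrite le_eqVlt => /predU1P[<-|t0] u01.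
    by rewrite /robin_sol ltxx frho0.
  by rewrite robin_solE //; exact: heat_itv01.
split.
  by move=> alpha rho rho' sr sr' t tT; exact: (Robin_weak_sol_unique hT _ sr sr').
(* The bound is asserted for an arbitrary solution; uniqueness identifies its slices at positive
   times with those of the series. *)
exists (1 / 16) => alpha rho sr; have [_ L2 _] := sr.
apply: (energy_le hT s0 frho0 L2) => s /andP[s1 sT].
rewrite -robin_solE //; apply: (Robin_weak_sol_unique hT _ sr) => //.
  exact: robin_sol_is_weak_sol.
by rewrite in_itv /= sT ltW.
Qed.
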